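(* Let $p$ be a negative integer. The Kanenobu knot $K(p,0)$ is homologically thin over $\mathbb{Q}$, and its rational Khovanov bigraded homology groups satisfy \[ \dim \mathcal{H}^{i,j}(K(p,0)) = \begin{cases} \dim \mathcal{H}^{-p,-2p+1}(K(0,0)) + 1, & \text{if } (i,j)=(0,1),\\ \dim \mathcal{H}^{-p,-2p-1}(K(0,0)) + 1, & \text{if } (i,j)=(0,-1),\\ \dim \mathcal{H}^{-p-1,-2p-3}(K(0,0)), & \text{if } (i,j)=(-1,-3) \text{ and } p\neq -1,\\ \dim \mathcal{H}^{-p-1,-2p-1}(K(0,0)), & \text{if } (i,j)=(-1,-1) \text{ and } p\neq -1,\\ \dim \mathcal{H}^{0,1}(K(0,0)) - 1, & \text{if } (i,j)=(p,2p+1),\\ \dim \mathcal{H}^{0,-1}(K(0,0)) - 1, & \text{if } (i,j)=(p,2p-1),\\ \dim \mathcal{H}^{i-p,\,j-2p}(K(0,0)), & \text{otherwise.} \end{cases} \]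
   Context: Kanenobu knots. Let $D$ be the standard reduced alternating $4$-crossing diagram of the figure-eight knot $4_1$: its crossings are $a,b,c,d$; two edges join $a$ and $b$ and bound a bigon, two edges join $c$ and $d$ and bound a bigon, and there is exactly one edge joining each of the pairs $ac$, $ad$, $bc$, $bd$. Draw $D$ in the left half-plane so that its unbounded face is the triangle with vertices $a,b,c$, bounded by one of the edges $ab$, the edge $bc$ and the edge $ca$. Let $D^*$ be the mirror image of $D$ under reflection in the vertical axis (reflection of $\mathbb{R}^3$ in the plane through this axis perpendicular to the projection plane). Isotope so that each of the three outer edges $ca$, $bc$, $ab$ has a portion running next to the axis, facing its mirror image. Now (1) form the connected sum along $ca$: replace the two facing arcs of $ca$ and its mirror image by two parallel arcs crossing the axis; (2) twist the two facing arcs of $bc$ and its mirror image around each other by $p$ half twists, giving $|p|$ crossings stacked along the axis; (3) do the same for the outer edge $ab$ and its mirror image with $q$ half twists. In both twist regions the two strands are antiparallel; the twist crossings are positive crossings if the number of half twists is positive, negative crossings if it is negative. The resulting diagram, with $8+|p|+|q|$ crossings, is the standard diagram of $K(p,q)$. One has $K(0,0)\approx 4_1\#4_1$, $K(p,q)\approx K(q,p)$, the mirror image of $K(p,q)$ is $K(-p,-q)$, and the Jones polynomial of $K(p,q)$ is $(-t)^{p+q}\bigl((t^{-2}-t^{-1}+1-t+t^2)^2-1\bigr)+1$. $\mathcal{H}^{i,j}(L)$ denotes the rational Khovanov homology of an oriented link $L$ in homological degree $i$ and quantum degree $j$, normalized so that $\sum_{i,j}(-1)^i q^j\dim\mathcal{H}^{i,j}(L)=(q^{-1}+q)V(L)|_{\sqrt{t}=-q}$,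 where $V$ is the Jones polynomial with $V(\text{unknot})=1$ and $t^{-1}V(L_+)-tV(L_-)=(t^{1/2}-t^{-1/2})V(L_0)$. A knot $K$ is homologically thin over $\mathbb{Q}$ if its rational Khovanov homology is supported on the two lines $j-2i=\sigma(K)\pm1$, where $\sigma(K)$ is the signature (with the sign convention making the right-handed trefoil have signature $2$). *)

(* Defs.v *)
From mathcomp Require Import all_boot all_order all_algebra.

Set Implicit Arguments.
Unset Strict Implicit.
Unset Printing Implicit Defensive.

Import Order.TTheory GRing.Theory Num.Theory.
Local Open Scope ring_scope.

(* Oriented link diagrams.  A crossing lists the four edge ends around it in
   counterclockwise order c0, c1, c2, c3, where c0 and c2 are the ends of the
   understrand (planar diagram code).  The orientation is recorded separately:
   [under_fwd] iff the understrand runs from c0 to c2, [over_fwd] iff the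
   overstrand runs from c1 to c3. *)
Record crossing (E : Type) := Crossing {
  under_fwd : bool; over_fwd : bool; c0 : E; c1 : E; c2 : E; c3 : E }.

Record diagram := Diagram { edge : finType; crossings : seq (crossing edge) }.

Section Crossing.
Variables (E : finType) (x : crossing E).

(* With the understrand running from south (c0) to north (c2), c1 is east and
   c3 is west; the crossing is positive iff the overstrand runs from west to
   east. *)
Definition positive : bool := under_fwd x (+) over_fwd x.

Definition under_in : E := if under_fwd x then c0 x else c2 x.
Definition under_out : E := if under_fwd x then c2 x else c0 x.
Definition over_in : E := if over_fwd x then c1 x else c3 x.
Definition over_out : E := if over_fwd x then c3 x else c1 x.

(* Seen with both strands pointing upwards; [left_in] and [left_out] are the
   incoming and outgoing edges on the left side of the crossing. *)
Definition left_in : E := if positive then over_in else under_in.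
Definition left_out : E := if positive then under_out else over_out.

(* The 0-smoothing merges the two regions swept by the overstrand when it is
   turned counterclockwise; for a positive crossing it is the oriented one. *)
Definition smoothing (b : bool) : seq (E * E) :=
  if b then [:: (c1 x, c2 x); (c3 x, c0 x)]
  else [:: (c0 x, c1 x); (c2 x, c3 x)].

Definition joined_at (b : bool) (e f : E) : bool :=
  ((e, f) \in smoothing b) || ((f, e) \in smoothing b).

End Crossing.

Section Khovanov.
Variable D : diagram.

Definition ncross : nat := size (crossings D).
Definition xing (k : 'I_ncross) : crossing (edge D) :=
  tnth (in_tuple (crossings D)) k.

Definition n_plus : nat := #|[pred k | positive (xing k)]|.
Definition n_minus : nat := #|[pred k | ~~ positive (xing k)]|.

(* The vertices of the cube of resolutions. *)
Definition resolution := {ffun 'I_ncross -> bool}.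

Definition joined (s : resolution) : rel (edge D) :=
  fun e f => [exists k, joined_at (xing k) (s k) e f].

(* The edges e and f lie on the same circle of the resolution s. *)
Definition same_circle (s : resolution) : rel (edge D) := connect (joined s).

Definition weight (s : resolution) : nat := #|[pred k | s k]|.

(* A standard generator of the Khovanov complex is a resolution together with a
   labelling of its circles by v+ (true) or v- (false), encoded as a labelling
   of the edges that is constant on circles. *)
Definition labelled := (resolution * {ffun edge D -> bool})%type.

Definition is_gen (S : labelled) : bool :=
  [forall e, forall f, same_circle S.1 e f ==> (S.2 e == S.2 f)].

Definition circles (S : labelled) (b : bool) : nat :=
  n_comp (joined S.1) [pred e | S.2 e == b].

Definition hdeg (S : labelled) : int := (weight S.1)%:Z - n_minus%:Z.

Definition qdeg (S : labelled) : int :=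
  (circles S true)%:Z - (circles S false)%:Z
  + (weight S.1)%:Z + n_plus%:Z - 2 * n_minus%:Z.

Definition kh_gen (i j : int) : finType :=
  {S : labelled | [&& is_gen S, hdeg S == i & qdeg S == j]}.

(* The coefficient of v_z in m (v_x (x) v_y), and of v_y (x) v_z in Delta v_x:
     m (v+ v+) = v+,  m (v+ v-) = m (v- v+) = v-,  m (v- v-) = 0,
     Delta v+ = v+ v- + v- v+,  Delta v- = v- v-. *)
Definition mult_coef (x y z : bool) : bool :=
  match x, y, z with
  | true, true, true | true, false, false | false, true, false => true
  | _, _, _ => false
  end.

Definition comult_coef (x y z : bool) : bool :=
  match x, y, z with
  | true, true, false | true, false, true | false, false, false => true
  | _, _, _ => false
  end.

(* The coefficient of T in the image of S under the edge map of the cube that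
   changes the smoothing at k from 0 to 1: the circles of S.1 near k are those
   of c0 and c2, and the circles of T.1 near k are again those of c0 and c2. *)
Definition edge_coef (k : 'I_ncross) (S T : labelled) : bool :=
  let a := c0 (xing k) in
  let b := c2 (xing k) in
  [&& ~~ S.1 k,
      T.1 == [ffun l => (l == k) || S.1 l],
      [forall e, [|| same_circle S.1 a e, same_circle S.1 b e
                   | S.2 e == T.2 e]]
    & if same_circle S.1 a b then comult_coef (S.2 a) (T.2 a) (T.2 b)
      else mult_coef (S.2 a) (S.2 b) (T.2 a)].

Definition edge_sign (k : 'I_ncross) (s : resolution) : rat :=
  (-1) ^+ #|[pred l : 'I_ncross | (l < k)%N && s l]|.

Definition incidence (S T : labelled) : rat :=
  \sum_(k < ncross) edge_sign k S.1 * (edge_coef k S T)%:R.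

(* The matrix, acting on row vectors, of the differential between the chain
   groups of bidegrees (i, j) and (i', j); it is only used for i' = i + 1. *)
Definition kh_diff (i i' j : int) : 'M[rat]_(#|kh_gen i j|, #|kh_gen i' j|) :=
  \matrix_(r, s) incidence (val (enum_val r)) (val (enum_val s)).

(* The dimension of the homology: the rank of a complement of the image of the
   incoming differential in the kernel of the outgoing one. *)
Definition kh_dim (i j : int) : nat :=
  \rank (kermx (kh_diff i (i + 1) j) :\: kh_diff (i - 1) i j)%MS.

End Khovanov.

(* The knot signature, from the Seifert surface F produced by Seifert's
   algorithm.  Collars of the Seifert circles in F together with the bands at
   the crossings form a subsurface F', and H_1(F') maps onto H_1(F).  A class in
   H_1(F') is determined by the multiplicities z e with which it runs along the
   edges e of the diagram; they are subject to one equation at each crossing,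
   and the class runs through the band at a crossing, from the left to the
   right, with multiplicity z left_in - z left_out.  Push F' off in the
   direction of the side lying to the left of the Seifert circles, and read off
   lk(x, y^+) from the crossings of the planar projection at which x passes over
   y^+: the contribution of a crossing of the diagram is
     - x e * (y left_in - y left_out)
   where e = left_in if that crossing is positive and e = left_out otherwise. *)
Section Signature.
Variable D : diagram.

Definition H1vec := {ffun edge D -> rat^o}.

Definition is_cycle (z : H1vec) : bool :=
  all (fun c => z (under_in c) + z (over_in c)
                == z (under_out c) + z (over_out c)) (crossings D).

Definition seifert_form (x y : H1vec) : rat :=
  - \sum_(c <- crossings D)
      x (if positive c then left_in c else left_out c)
      * (y (left_in c) - y (left_out c)).

(* [s] is the signature of the symmetric bilinear form b on the subspace U, that
   is, the number of positive minus the number of negative diagonal values of b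
   in an orthogonal basis of U (well defined by Sylvester's law of inertia). *)
Definition form_signature (V : vectType rat) (U : pred V) (b : V -> V -> rat)
    (s : int) : Prop :=
  exists X : seq V,
    [/\ free X, <<X>>%VS =i U,
        forall k l, (k < size X)%N -> (l < size X)%N -> k != l ->
          b X`_k X`_l = 0
      & s = \sum_(x <- X) sgz (b x x)].

(* H_1(F') may be used in place of H_1(F), because the kernel of H_1(F') ->
   H_1(F) lies in the radical of the pulled back form.  The symmetrized Seifert
   form of the right-handed trefoil is negative definite of rank 2, whence the
   sign. *)
Definition knot_signature (s : int) : Prop :=
  form_signature is_cycle
    (fun x y => - (seifert_form x y + seifert_form y x)) s.

End Signature.

Definition homologically_thin (D : diagram) : Prop :=
  exists2 s : int, knot_signature D s &
    forall i j : int, kh_dim D i j <> 0%N ->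
      j - 2 * i = s + 1 \/ j - 2 * i = s - 1.

(* The standard diagram of the Kanenobu knot with m = |p| and n = |q|.  The axis
   is vertical.  The diagram of the figure-eight knot in the left half-plane
   consists of the triangle abc, counterclockwise, with d inside it; the edges
   facing the axis are, from bottom to top, ab, bc, ca.
   The strand through c, d, a passes over at c and a (the opposite choice gives
   the same knots).

   Names of the edges, where [false] refers to the left half and [true] to its
   mirror image on the right: the inner edge ab and the edges ad, bd, cd (on
   the left of d when looking from d to c) and cd (on its right), then the two
   edges crossing the axis, at a and at c, that result from the connected sum
   along ca, and finally the vertical edges along
   the two twist regions, numbered from bottom to top.  Without twists the
   edges 0 and m (resp. n) of a column coincide, as they should. *)
Section Kanenobu.
Variables m n : nat.

Definition kan_edge : finType :=
  ((bool * 'I_5) + bool + (bool * 'I_m.+1) + (bool * 'I_n.+1))%type.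

Definition inner (h : bool) (k : nat) : kan_edge :=
  inl (inl (inl (h, inord k))).
Definition e_ab h := inner h 0.
Definition e_ad h := inner h 1.
Definition e_bd h := inner h 2.
Definition e_cd1 h := inner h 3.
Definition e_cd2 h := inner h 4.
Definition ca_at_a : kan_edge := inl (inl (inr false)).
Definition ca_at_c : kan_edge := inl (inl (inr true)).
Definition col_bc (h : bool) (k : nat) : kan_edge := inl (inr (h, inord k)).
Definition col_ab (h : bool) (k : nat) : kan_edge := inr (h, inord k).

(* The orientation depends on the parities of the numbers of half twists.  The
   strand of the left half that runs from c over d to a is oriented in this
   direction; the strand through b, d, c runs from the edge ab to the edge bc
   iff [fwd_bdc], and the strand through b, a runs from the edge bc to the edge
   ca iff [fwd_ba].  On the right, all directions are opposite to those of the
   mirror image. *)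
Definition fwd_bdc : bool := ~~ odd n.
Definition fwd_ba : bool := ~~ odd (m + n).

(* The crossings of the left half, with edges named as on the side h. *)
Definition half_crossings (h : bool) : seq (crossing kan_edge) :=
  [:: (* a *) Crossing fwd_ba true (e_ab h) (e_ad h) ca_at_a (col_ab h 0);
      (* b *) Crossing (~~ fwd_bdc) (~~ fwd_ba)
                (e_bd h) (e_ab h) (col_ab h n) (col_bc h 0);
      (* c *) Crossing fwd_bdc false
                (e_cd1 h) (e_cd2 h) (col_bc h m) ca_at_c;
      (* d *) Crossing true (~~ fwd_bdc)
                (e_cd2 h) (e_cd1 h) (e_ad h) (e_bd h)].

(* Reflection of the plane followed by reversal of both strands. *)
Definition mirror (x : crossing kan_edge) : crossing kan_edge :=
  Crossing (~~ under_fwd x) (over_fwd x) (c0 x) (c3 x) (c2 x) (c1 x).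

(* The k-th crossing from below of a twist region with antiparallel strands;
   [up] tells whether the lowest left edge [col false 0] points upwards.  Then
   [col false k] points upwards iff up (+) odd k, and [col true k] points in the
   opposite direction. *)
Definition twist (pos up : bool) (col : bool -> nat -> kan_edge) (k : nat) :
    crossing kan_edge :=
  let t := up (+) odd k in
  let SW := col false k in let SE := col true k in
  let NW := col false k.+1 in let NE := col true k.+1 in
  if pos then Crossing t (~~ t) SW SE NE NW
  else Crossing (~~ t) (~~ t) SE NE NW SW.

Definition kan_crossings (p_pos q_pos : bool) : seq (crossing kan_edge) :=
  half_crossings false ++ map mirror (half_crossings true)
  ++ [seq twist p_pos (~~ fwd_ba) col_bc k | k <- iota 0 m]
  ++ [seq twist q_pos true col_ab k | k <- iota 0 n].

End Kanenobu.

Definition kanenobu (p q : int) : diagram :=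
  Diagram (@kan_crossings `|p|%N `|q|%N (0 < p) (0 < q)).

(* Main.v *)
(* Let m = |p|.  Smoothing the crossings of the twist region one after the other
   exhibits the Khovanov complex of K(-m, 0) as an iterated mapping cone: the m-th
   crossing adds the complex of the outer eight crossings closed up horizontally,
   with m - 1 curls.  Reidemeister moves remove the curls, and the horizontal
   closure is a two-component unlink, with homology Q[X, Y]/(X^2, Y^2).  The two
   arcs X and Y meet at the saddle, so the image of the connecting map in homology
   lies in the kernel of X - (-1)^m Y; it is one-dimensional in exactly two
   bidegrees, as two explicit cycles show.  Hence every crossing cancels one class
   in each of two bidegrees and creates one in each of two others.

   What is needed about the complexes of the two closures of the eight outer
   crossings is a finite computation: Gaussian elimination yields a contraction of
   each of them onto its homology (for the vertical closure, off the two diagonals),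
   and the identities that it has to satisfy are checked by evaluation.

   On the cycles, the symmetrized Seifert form is a sum of two hyperbolic planes: up
   to a multiple of the square of d it is N(u, a) - N(u', a'), where N is the form of
   the figure-eight knot, the primed variables belong to the right half and
   d = u' - u.  Thus the signature is 0. *)
From Stdlib Require Import ZArith.
From HB Require Import structures.
From mathcomp Require Import all_boot all_order all_algebra.
From mathcomp Require Import ssrZ zify ring lra.
Require Import Defs.

Set Implicit Arguments.
Unset Strict Implicit.
Unset Printing Implicit Defensive.

Import Order.TTheory GRing.Theory Num.Theory.

Local Open Scope ring_scope.

(** * Based complexes and cones *)

(** The cube of resolutions grows with m, so a finite check can only concern the eight outer
    crossings; the twist region is treated by induction on words that record its smoothings. What
    makes the count come out is (X - Y)(X + Y) = X^2 - Y^2 = 0. The connecting maps of consecutive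
    crossings are alternately X + Y and X - Y, so the two classes that one crossing creates are the
    ones that the next crossing cancels. The sum telescopes: only what the first crossing cancels
    and the last one creates remains, which is why p enters through a shift and two corrections. The
    vertical closure is the diagram of K(0,0). Its homology stands on both sides of the formula and
    is never computed; what is used of it is exactness off two diagonals and two cycles that the
    saddle maps to X + Y and XY. These come from the reverse saddle: followed by the saddle it is
    multiplication by X + Y, so 1 and X yield the two cycles. The iterated cone orders the twist
    crossings before the outer ones, the diagram lists them after; a sign on each generator
    reconciles the two cubes. *)

Section BasedComplexes.
Implicit Types A B : finType.

Definition chain (A : finType) := {ffun A -> rat^o}.

Definition matop (A B : finType) (M : A -> B -> rat) (x : chain A) : chain B :=
  [ffun b => \sum_a x a * M a b].

Fact matop_is_linear A B (M : A -> B -> rat) : linear (@matop A B M).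
Proof.
move=> k x y; apply/ffunP=> b; rewrite !ffunE scaler_sumr -big_split /=.
by apply: eq_bigr => a _; rewrite !ffunE mulrDl -mulrA.
Qed.
HB.instance Definition _ A B M :=
  GRing.isLinear.Build rat (chain A) (chain B) _ (@matop A B M) (matop_is_linear M).

(** A relation instead of a degree function: a basis element may have no bidegree at all and is then
    invisible to [piece] and [hom]. Thus all 26-bit words can serve as a basis although only
    consistent labellings are generators. *)
Definition grading (A : finType) := A -> int -> int -> bool.

Definition homogeneous (A : finType) (g : grading A) (i j : int) (x : chain A) :=
  forall a, x a != 0 -> g a i j.

Definition outside (A : finType) (g : grading A) (i j : int) (x : chain A) : chain A :=
  [ffun a => if g a i j then 0 else x a].

Fact outside_is_linear A (g : grading A) i j : linear (@outside A g i j).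
Proof.
move=> k x y; apply/ffunP=> a; rewrite !ffunE.
by case: ifP => //; rewrite scaler0 add0r.
Qed.
HB.instance Definition _ A g i j :=
  GRing.isLinear.Build rat (chain A) (chain A) _ (@outside A g i j)
    (outside_is_linear g i j).

Definition piece A (g : grading A) i j : {vspace chain A} :=
  lker (linfun (outside g i j)).

Lemma mem_piece A (g : grading A) i j (x : chain A) :
  reflect (homogeneous g i j x) (x \in piece g i j).
Proof.
rewrite memv_ker lfunE /=; apply: (iffP eqP) => [/ffunP x0 a xa|hx].
  by move: (x0 a); rewrite !ffunE; case: (g a i j) => // /eqP; rewrite (negPf xa).
apply/ffunP=> a; rewrite !ffunE; case: ifP => // /negbT nga.
by apply/eqP/negPn/negP => /hx; apply/negP.
Qed.

Lemma dim_chain (A : finType) : \dim {: chain A} = #|A|.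
Proof. by rewrite dimvf /dim /= muln1. Qed.

Lemma dim_piece A (g : grading A) i j :
  \dim (piece g i j) = #|[pred a | g a i j]|.
Proof.
pose B : finType := {a | g a i j}.
pose ext : chain B -> chain A := matop (fun b a => (val b == a)%:R).
pose f : 'Hom(chain B, chain A) := linfun ext.
have fE (x : chain B) b : f x (val b) = x b.
  rewrite lfunE ffunE (bigD1 b) //= eqxx mulr1 big1 ?addr0 // => c /negPf ncb.
  by rewrite (inj_eq val_inj) ncb mulr0.
have f0 (x : chain B) a : ~~ g a i j -> f x a = 0.
  move=> nga; rewrite lfunE ffunE big1 // => c _.
  by case: eqP => [ca|]; rewrite ?mulr0 //; move: nga; rewrite -ca (valP c).
have <- : (f @: fullv)%VS = piece g i j.
  apply/vspaceP=> x; apply/memv_imgP/mem_piece => [[y _ ->] a|hx].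
    by apply: contra_neqT; apply: f0.
  exists [ffun b => x (val b)]; first by rewrite memvf.
  apply/ffunP=> a; have [ga|nga] := boolP (g a i j).
    by rewrite -[a]/(val (Sub a ga : B)) fE ffunE.
  by rewrite f0 //; apply: contraNeq nga; apply: hx.
rewrite limg_dim_eq ?dim_chain ?card_sig //.
apply/eqP; rewrite -subv0; apply/subvP=> x; rewrite memv_cap memv_ker memv0.
move=> /andP[_ /eqP fx]; apply/eqP/ffunP=> b.
by rewrite -fE fx !ffunE.
Qed.

Definition rk (A : finType) (g : grading A) (d : A -> A -> rat) i j :=
  \dim (linfun (matop d) @: piece g i j)%VS.

(** The homology dimension by rank and nullity, kept in [int] so that the contributions of a cone
    can be moved freely between the sides of an equation. *)
Definition hom A (g : grading A) (d : A -> A -> rat) (i j : int) : int :=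
  #|[pred a | g a i j]|%:Z - (rk g d i j)%:Z - (rk g d (i - 1) j)%:Z.

Definition cycles A (g : grading A) (d : A -> A -> rat) i j : {vspace chain A} :=
  (piece g i j :&: lker (linfun (matop d)))%VS.

Lemma mem_cycles A (g : grading A) d i j x :
  reflect (homogeneous g i j x /\ matop d x = 0) (x \in cycles g d i j).
Proof.
rewrite memv_cap memv_ker lfunE /=; apply: (iffP andP).
  by case=> /mem_piece ? /eqP.
by case=> /mem_piece ? ->.
Qed.

Lemma dim_cycles A (g : grading A) d i j :
  (\dim (cycles g d i j) + rk g d i j)%N = #|[pred a | g a i j]|.
Proof. by rewrite limg_ker_dim dim_piece. Qed.

(* R identifies the homology of (g, d) with a subspace of M. *)
Definition detects A (g : grading A) (d : A -> A -> rat) (M : vectType rat) (R : 'Hom(chain A,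
  M)) :=
  forall i j x, homogeneous g i j x -> matop d x = 0 ->
    (R x = 0 <-> exists2 y, homogeneous g (i - 1) j y & x = matop d y).

(** On the cycles the kernel of [R] is exactly the space of boundaries, so its image is a copy of
    the homology. *)
Lemma hom_detected A (g : grading A) d (M : vectType rat) (R : 'Hom(chain A, M)) i j :
  detects g d R ->
  (forall i j y, homogeneous g i j y -> homogeneous g (i + 1) j (matop d y)) ->
  (forall y, matop d (matop d y) = 0) ->
  hom g d i j = (\dim (R @: cycles g d i j)%VS)%:Z.
Proof.
move=> Rh dg dd; rewrite /hom -(dim_cycles g d) -(limg_ker_dim R (cycles g d i j)).
suff -> : (cycles g d i j :&: lker R)%VS = (linfun (matop d) @: piece g (i - 1) j)%VS.
  by rewrite -/(rk g d (i - 1) j) !PoszD; ring.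
apply/vspaceP=> x; rewrite memv_cap memv_ker; apply/andP/memv_imgP.
  case=> /mem_cycles[hx dx] /eqP Rx; have [/(_ Rx)[y hy ->] _] := Rh i j x hx dx.
  by exists y; rewrite ?lfunE //; apply/mem_piece.
case=> y /mem_piece hy ->; rewrite lfunE /=.
have hdy : homogeneous g i j (matop d y) by rewrite -(subrK 1 i); apply: dg.
split; first by apply/mem_cycles.
by apply/eqP; have [_ ->] // := Rh i j (matop d y) hdy (dd y); exists y.
Qed.

Definition cat_chain A B (x : chain A) (y : chain B) : chain (A + B)%type :=
  [ffun c => match c with inl a => x a | inr b => y b end].
Definition lft A B (x : chain (A + B)%type) : chain A := [ffun a => x (inl a)].
Definition rgt A B (x : chain (A + B)%type) : chain B := [ffun a => x (inr a)].

Lemma catK A B (x : chain (A + B)%type) : cat_chain (lft x) (rgt x) = x.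
Proof. by apply/ffunP=> -[a|b]; rewrite !ffunE. Qed.

Lemma lft_cat A B (x : chain A) (y : chain B) : lft (cat_chain x y) = x.
Proof. by apply/ffunP=> a; rewrite !ffunE. Qed.
Lemma rgt_cat A B (x : chain A) (y : chain B) : rgt (cat_chain x y) = y.
Proof. by apply/ffunP=> a; rewrite !ffunE. Qed.

Fact lft_is_linear A B : linear (@lft A B).
Proof. by move=> k x y; apply/ffunP=> a; rewrite !ffunE. Qed.
HB.instance Definition _ A B :=
  GRing.isLinear.Build rat (chain (A + B)%type) (chain A) _ (@lft A B) (@lft_is_linear A B).
Fact rgt_is_linear A B : linear (@rgt A B).
Proof. by move=> k x y; apply/ffunP=> a; rewrite !ffunE. Qed.
HB.instance Definition _ A B :=
  GRing.isLinear.Build rat (chain (A + B)%type) (chain B) _ (@rgt A B) (@rgt_is_linear A B).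
Fact inrc_is_linear A B : linear (@cat_chain A B 0).
Proof.
move=> k x y; apply/ffunP=> -[a|b]; rewrite !ffunE //.
by rewrite scaler0 addr0.
Qed.
HB.instance Definition _ A B :=
  GRing.isLinear.Build rat (chain B) (chain (A + B)%type) _ (@cat_chain A B 0) (@inrc_is_linear
    A B).

Definition sum_grading A B (g : grading A) (h : grading B) : grading (A + B)%type :=
  fun c => match c with inl a => g a | inr b => h b end.

Lemma homogeneous_cat A B (g : grading A) (h : grading B) i j x y :
  homogeneous (sum_grading g h) i j (cat_chain x y) <->
  homogeneous g i j x /\ homogeneous h i j y.
Proof.
split=> [hxy|[hx hy] [a|b]].
- by split=> c xc; [have := hxy (inl c)|have := hxy (inr c)]; rewrite ffunE; apply.
- by rewrite ffunE; apply: hx.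
- by rewrite ffunE; apply: hy.
Qed.

(** No shift is applied to the second summand: its grading is understood to include the shift
    already, so that [phi] raises the homological degree by one just like [d] and [e]. *)
Definition cone A B (d : A -> A -> rat) (phi : A -> B -> rat) (e : B -> B -> rat)
    (x y : A + B) : rat :=
  match x, y with
  | inl a, inl a' => d a a'
  | inl a, inr b => phi a b
  | inr b, inr b' => - e b b'
  | inr _, inl _ => 0
  end.

Lemma matop_cone A B d phi e (x : chain A) (y : chain B) :
  matop (cone d phi e) (cat_chain x y) =
  cat_chain (matop d x) (matop phi x - matop e y).
Proof.
apply/ffunP=> -[a|b]; rewrite !ffunE big_sumType /=.
  rewrite [X in _ + X]big1 ?addr0 => [|c _]; last by rewrite mulr0.
  by apply: eq_bigr => c _; rewrite ffunE.
rewrite -sumrN; congr (_ + _); apply: eq_bigr => c _; rewrite ffunE //.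
by rewrite mulrN.
Qed.

(** * The long exact sequence of a cone, in dimensions *)

Section ConeHomology.
Variables (A B : finType) (g : grading A) (h : grading B).
Variables (d : A -> A -> rat) (phi : A -> B -> rat) (e : B -> B -> rat).
Variables (M : vectType rat) (R : 'Hom(chain B, M)).
Hypothesis Rdet : detects h e R.
Hypothesis phi_hom : forall i j x,
  homogeneous g i j x -> homogeneous h (i + 1) j (matop phi x).
Hypothesis e_hom : forall i j x,
  homogeneous h i j x -> homogeneous h (i + 1) j (matop e x).
Hypothesis ee : forall x, matop e (matop e x) = 0.
Hypothesis phid : forall x, matop phi (matop d x) = matop e (matop phi x).

Definition connecting i j := (R @: (linfun (matop phi) @: cycles g d i j))%VS.

(** The image of the cone differential projects onto the image of [d]. The kernel of this projection
    consists of the image of [e] and of [phi] applied to the cycles of [d]; modulo the image of [e],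
    which [R] divides out, the latter is the image of the connecting map. *)
Lemma rk_cone i j :
  rk (sum_grading g h) (cone d phi e) i j =
  (rk g d i j + rk h e i j + \dim (connecting i j))%N.
Proof.
rewrite {1}/rk; set W := (_ @: piece _ i j)%VS.
pose p : 'Hom(chain (A + B)%type, chain A) := linfun (@lft A B).
pose q : 'Hom(chain B, chain (A + B)%type) := linfun (@cat_chain A B 0).
rewrite -(limg_ker_dim p W).
have WP x : x \in W -> exists u v, [/\ homogeneous g i j u, homogeneous h i j v &
    x = cat_chain (matop d u) (matop phi u - matop e v)].
  case/memv_imgP=> z /mem_piece; rewrite -(catK z) homogeneous_cat lfunE /=.
  by rewrite matop_cone => -[hu hv] ->; exists (lft z), (rgt z).
have WP' u v : homogeneous g i j u -> homogeneous h i j v ->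
    cat_chain (matop d u) (matop phi u - matop e v) \in W.
  move=> hu hv; rewrite -matop_cone -[matop _ _]lfunE memv_img //.
  by apply/mem_piece/homogeneous_cat.
have hom0 (C : finType) (k : grading C) i' j' : homogeneous k i' j' 0.
  by move=> c; rewrite ffunE eqxx.
have -> : (p @: W)%VS = (linfun (matop d) @: piece g i j)%VS.
  apply/vspaceP=> x; apply/memv_imgP/memv_imgP => [[z /WP[u [v [hu hv ->]]] ->]|].
    by exists u; rewrite ?lfunE /= ?lft_cat //; apply/mem_piece.
  case=> u /mem_piece hu ->; exists (cat_chain (matop d u) (matop phi u - matop e 0)).
    by apply: WP' => //; apply: hom0.
  by rewrite !lfunE /= lft_cat.
rewrite addnC -addnA; congr (_ + _)%N.
pose U := (linfun (matop e) @: piece h i j + linfun (matop phi) @: cycles g d i j)%VS.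
have -> : (W :&: lker p)%VS = (q @: U)%VS.
  apply/vspaceP=> x; rewrite memv_cap memv_ker; apply/andP/memv_imgP.
    case=> /WP[u [v [hu hv ->]]]; rewrite lfunE /= lft_cat => /eqP du.
    exists (matop phi u - matop e v); last by rewrite lfunE /= du.
    rewrite addrC memv_add //.
      rewrite -(linearN (matop e)) -[matop e]/(GRing.Linear.sort _).
      rewrite -lfunE memv_img //; apply/mem_piece => b.
      by rewrite ffunE oppr_eq0; apply: hv.
    rewrite -[matop phi]/(GRing.Linear.sort _) -lfunE memv_img //.
    by apply/mem_cycles.
  case=> y /memv_addP[_ /memv_imgP[v /mem_piece hv ->]
    [_ /memv_imgP[u /mem_cycles[hu du] ->] ->]] ->; rewrite !lfunE /= lft_cat eqxx.
  split=> //; rewrite addrC -[v]opprK (linearN (matop e)) -du; apply: WP' => //.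
  by move=> b; rewrite ffunE oppr_eq0; exact: hv.
rewrite limg_dim_eq; last first.
  apply/eqP; rewrite -subv0; apply/subvP=> x; rewrite memv_cap memv_ker memv0.
  move=> /andP[_ /eqP]; rewrite lfunE /= => /(congr1 (@rgt A B)).
  by rewrite rgt_cat linear0 => ->.
rewrite -(limg_ker_dim R U) /rk.
have Ucyc x : x \in U -> homogeneous h (i + 1) j x /\ matop e x = 0.
  case/memv_addP=> _ /memv_imgP[v /mem_piece hv ->]
    [_ /memv_imgP[u /mem_cycles[hu du] ->] ->]; rewrite !lfunE /=; split.
    apply/mem_piece/memvD; apply/mem_piece; [exact: e_hom|exact: phi_hom].
  by rewrite linearD /= ee -phid du linear0 addr0.
have -> : (U :&: lker R)%VS = (linfun (matop e) @: piece h i j)%VS.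
  apply/vspaceP=> x; rewrite memv_cap memv_ker; apply/andP/idP.
    case=> /Ucyc[hx ex] /eqP Rx; have [/(_ Rx)[y]] := Rdet hx ex.
    rewrite addrK => hy -> _; rewrite -[matop e _]lfunE memv_img //.
    exact/mem_piece.
  move=> ex; have xU : x \in U by rewrite -[x]addr0 memv_add ?mem0v.
  split=> //; have [hx ex0] := Ucyc _ xU; apply/eqP; apply/(Rdet hx ex0).
  by case/memv_imgP: ex => y /mem_piece hy ->; exists y; rewrite ?lfunE ?addrK.
congr (_ + \dim _)%N; rewrite limgD /connecting.
suff -> : (R @: (linfun (matop e) @: piece h i j))%VS = 0%VS by rewrite add0v.
apply/eqP; rewrite -lkerE; apply/subvP=> x /memv_imgP[y /mem_piece hy ->].
rewrite memv_ker lfunE /=; apply/eqP/(Rdet (e_hom hy) (ee y)).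
by exists y; rewrite ?addrK.
Qed.

(** The connecting map out of degree i kills classes of the first complex, the one out of degree i -
    1 kills classes of the second. *)
Lemma hom_cone i j :
  hom (sum_grading g h) (cone d phi e) i j =
  hom g d i j + (\dim (R @: cycles h e i j)%VS)%:Z
  - (\dim (connecting i j))%:Z - (\dim (connecting (i - 1) j))%:Z.
Proof.
rewrite -(hom_detected _ _ Rdet e_hom ee) /hom !rk_cone.
have -> : #|[pred c | sum_grading g h c i j]| =
    (#|[pred a | g a i j]| + #|[pred b | h b i j]|)%N.
  by rewrite -!sum1_card big_sumType.
by rewrite !PoszD; ring.
Qed.

End ConeHomology.

End BasedComplexes.

Definition dlt (A : finType) (a : A) : chain A := [ffun b => (a == b)%:R].

Lemma chain_dlt (A : finType) (x : chain A) : x = \sum_a x a *: dlt a.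
Proof.
apply/ffunP=> b; rewrite sum_ffunE (bigD1 b) //= !ffunE eqxx big1 ?addr0.
  by rewrite -[_ *: _]/(_ * _) mulr1.
by move=> a /negPf nab; rewrite !ffunE nab scaler0.
Qed.

Lemma piece_sub (A : finType) (g : grading A) i j (W : {vspace chain A}) :
  (forall a, g a i j -> dlt a \in W) -> (piece g i j <= W)%VS.
Proof.
move=> gW; apply/subvP=> x /mem_piece hx; rewrite [x]chain_dlt.
apply: rpred_sum => a _; have [->|/hx ga] := eqVneq (x a) 0; first by rewrite scale0r mem0v.
by rewrite rpredZ ?gW.
Qed.

Lemma matop_id (A : finType) (x : chain A) : matop (fun u v => (u == v)%:R) x = x.
Proof.
apply/ffunP=> a; rewrite ffunE (bigD1 a) //= eqxx mulr1 big1 ?addr0 //.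
by move=> b /negPf ->; rewrite mulr0.
Qed.

Lemma homogeneous0 (A : finType) (g : grading A) i j : homogeneous g i j 0.
Proof. by move=> a; rewrite ffunE eqxx. Qed.

Lemma homogeneousB (A : finType) (g : grading A) i j x y :
  homogeneous g i j x -> homogeneous g i j y -> homogeneous g i j (x - y).
Proof. by move=> /mem_piece hx /mem_piece hy; apply/mem_piece/memvB. Qed.

Lemma homogeneousZ (A : finType) (g : grading A) i j k x :
  homogeneous g i j x -> homogeneous g i j (k *: x).
Proof. by move=> /mem_piece hx; apply/mem_piece/memvZ. Qed.

Lemma cat_chain0 (A B : finType) : cat_chain 0 0 = 0 :> chain (A + B)%type.
Proof. by apply/ffunP=> -[a|b]; rewrite !ffunE. Qed.

Lemma cat_chain_eq0 (A B : finType) (x : chain A) (y : chain B) :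
  cat_chain x y = 0 -> x = 0 /\ y = 0.
Proof.
move=> xy; rewrite -(lft_cat x y) -{2}(rgt_cat x y) xy.
by split; rewrite linear0.
Qed.

(** * Twist regions *)

(* Q[X, Y]/(X^2, Y^2); the index (k, l) stands for X^k Y^l. *)
Definition two_circles := chain (bool * bool)%type.
Definition mulX (u v : bool * bool) : rat := (~~ u.1 && (v == (true, u.2)))%:R.
Definition mulY (u v : bool * bool) : rat := (~~ u.2 && (v == (u.1, true)))%:R.
(** Degrees before the normalization by the signs of the crossings. The unit of the two-component
    unlink sits at (5, 7): four outer crossings and the horizontal smoothing contribute 5 to the
    weight, and two circles labelled v+ contribute 2 more to the quantum degree. *)
Definition two_circles_grading : grading (bool * bool)%type :=
  fun u i j => (i == 5) && (j == 7 - 2 * (u.1 + u.2)%N%:Z).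

Lemma mulXE (x : two_circles) k l :
  matop mulX x (k, l) = if k then x (false, l) else 0.
Proof.
rewrite ffunE /mulX; case: k; last first.
  by apply: big1 => u _; rewrite /= xpair_eqE /= andbF mulr0.
rewrite (bigD1 (false, l)) //= eqxx mulr1 big1 ?addr0 //.
move=> [k' l'] /=; rewrite !xpair_eqE /= eq_sym => nu.
suff -> : ~~ k' && (l == l') = false by rewrite mulr0.
by case: k' nu => //=; rewrite eq_sym => /negPf.
Qed.

Lemma mulYE (x : two_circles) k l :
  matop mulY x (k, l) = if l then x (k, false) else 0.
Proof.
rewrite ffunE /mulY; case: l; last first.
  by apply: big1 => u _; rewrite /= xpair_eqE /= !andbF mulr0.
rewrite (bigD1 (k, false)) //= eqxx mulr1 big1 ?addr0 //.
move=> [k' l'] /=; rewrite !xpair_eqE /= => nu.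
suff -> : ~~ l' && ((k == k') && true) = false by rewrite mulr0.
by case: l' nu; rewrite ?andbT //= eq_sym => /negPf.
Qed.

Section TwistRegion.
Variables (L : finType) (g0 g1 : grading L) (d0 d1 sigma xa xb : L -> L -> rat).

(* d0 and d1 are the differentials of the outer crossings, with the twist region
   filled by a vertical and by a horizontal smoothing; sigma is the saddle between
   the two fillings, xa and xb are the multiplications by X at the bottom and the
   top arc of the horizontal one. *)

(* n crossings above a horizontally smoothed one: the lowest of them is smoothed
   vertically, or horizontally, which cuts off a small circle labelled v- (first
   summand) or v+. *)
Fixpoint curl n : finType :=
  if n is n'.+1 then (curl n' + (curl n' + curl n'))%type else L.

(** A horizontal smoothing raises both degrees by one, and its small circle adds -1 (v-) or +1 (v+)
    to the quantum degree; hence the quantum shifts 0 and 2. *)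
Fixpoint grG n : grading (curl n) :=
  match n with
  | 0 => g1
  | n'.+1 => sum_grading (@grG n')
      (sum_grading (fun w i j => grG w (i - 1) j)
                   (fun w i j => grG w (i - 1) (j - 2)))
  end.

(** Multiplication by X at the arc just above the horizontally smoothed base. The arc continues
    upwards through vertical smoothings; below a horizontal one it is the small circle, on which X
    turns v+ into v-. *)
Fixpoint lowX n : curl n -> curl n -> rat :=
  match n with
  | 0 => xb
  | n'.+1 => fun x y =>
      match x, y with
      | inl u, inl v => lowX u v
      | inr (inr u), inr (inl v) => (u == v)%:R
      | _, _ => 0
      end
  end.

Fixpoint botX n : curl n -> curl n -> rat :=
  match n with
  | 0 => xa
  | n'.+1 => fun x y =>
      match x, y with
      | inl u, inl v => botX u v
      | inr (inl u), inr (inl v) => botX u v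
      | inr (inr u), inr (inr v) => botX u v
      | _, _ => 0
      end
  end.

Definition direct_sum (A : finType) (d : A -> A -> rat) (x y : A + A) : rat :=
  match x, y with
  | inl u, inl v => d u v
  | inr u, inr v => d u v
  | _, _ => 0
  end.

(** The map inside the cone is the comultiplication that cuts off the small circle: x goes to x with
    the circle labelled v-, plus X x with the circle labelled v+. *)
Fixpoint dG n : curl n -> curl n -> rat :=
  match n with
  | 0 => d1
  | n'.+1 => cone (@dG n')
      (fun u v => match v with inl v' => (u == v')%:R | inr v' => lowX u v' end)
      (direct_sum (@dG n'))
  end.

(* The lowest crossing is smoothed vertically or horizontally. *)
Fixpoint twist_word m : finType :=
  if m is m'.+1 then (twist_word m' + curl m')%type else L.

Fixpoint grC m : grading (twist_word m) :=
  match m with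
  | 0 => g0
  | m'.+1 => sum_grading (@grC m') (@grG m')
  end.

(** The saddle at a new crossing below m others. If all of them are smoothed vertically it is
    [sigma]; otherwise it pinches a small circle off the bottom arc, by the same comultiplication as
    in [dG]. *)
Fixpoint phi m : twist_word m -> curl m -> rat :=
  match m with
  | 0 => sigma
  | m'.+1 => fun x y =>
      match x, y with
      | inl c, inl u => phi c u
      | inr g, inr (inl u) => (g == u)%:R
      | inr g, inr (inr u) => botX g u
      | _, _ => 0
      end
  end.

Fixpoint dC m : twist_word m -> twist_word m -> rat :=
  match m with
  | 0 => d0
  | m'.+1 => cone (@dC m') (@phi m') (@dG m')
  end.

(* Up to homotopy, n Reidemeister moves of type I undo the curls. *)
Fixpoint ret n : chain (curl n) -> chain L :=
  match n with
  | 0 => id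
  | n'.+1 => fun x => ret (rgt (rgt x) - matop (@lowX n') (lft (rgt x)))
  end.

Fixpoint emb n (v : chain L) : chain (curl n) :=
  match n with
  | 0 => v
  | n'.+1 => cat_chain 0 (cat_chain 0 (emb n' v))
  end.

Fact ret_is_linear n : linear (@ret n).
Proof.
elim: n => [|n IHn] k x y //=; rewrite -IHn; congr ret.
by rewrite !linearD !linearZ /= addrACA.
Qed.
HB.instance Definition _ n :=
  GRing.isLinear.Build rat (chain (curl n)) (chain L) _ (@ret n) (@ret_is_linear n).

Let sum_mul0 (A : finType) (f : A -> rat) : \sum_a f a * 0 = 0.
Proof. by apply: big1 => a _; rewrite mulr0. Qed.

Lemma dG_cat n x0 xm xp :
  matop (@dG n.+1) (cat_chain x0 (cat_chain xm xp)) =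
  cat_chain (matop (@dG n) x0)
    (cat_chain (x0 - matop (@dG n) xm) (matop (@lowX n) x0 - matop (@dG n) xp)).
Proof.
rewrite /= matop_cone; congr cat_chain.
apply/ffunP=> -[b|b]; rewrite !ffunE big_sumType /= sum_mul0 ?addr0 ?add0r;
  congr (_ - _); last by apply: eq_bigr => c _; rewrite ffunE.
  by rewrite -[x0 in RHS]matop_id ffunE.
by apply: eq_bigr => c _; rewrite ffunE.
Qed.

Lemma lowX_cat n x0 xm xp :
  matop (@lowX n.+1) (cat_chain x0 (cat_chain xm xp)) =
  cat_chain (matop (@lowX n) x0) (cat_chain xp 0).
Proof.
apply/ffunP=> -[b|[b|b]]; rewrite !ffunE !big_sumType /= !sum_mul0 ?addr0 ?add0r //.
  by apply: eq_bigr => c _; rewrite ffunE.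
by rewrite -[xp in RHS]matop_id ffunE; apply: eq_bigr => c _; rewrite !ffunE.
Qed.

Lemma botX_cat n x0 xm xp :
  matop (@botX n.+1) (cat_chain x0 (cat_chain xm xp)) =
  cat_chain (matop (@botX n) x0) (cat_chain (matop (@botX n) xm) (matop (@botX n) xp)).
Proof.
apply/ffunP=> -[b|[b|b]]; rewrite !ffunE !big_sumType /= !sum_mul0 ?addr0 ?add0r;
  by apply: eq_bigr => c _; rewrite !ffunE.
Qed.

Lemma phi_cat m c g :
  matop (@phi m.+1) (cat_chain c g) =
  cat_chain (matop (@phi m) c) (cat_chain g (matop (@botX m) g)).
Proof.
apply/ffunP=> -[b|[b|b]]; rewrite !ffunE !big_sumType /= !sum_mul0 ?addr0 ?add0r;
  try by apply: eq_bigr => u _; rewrite !ffunE.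
by rewrite -[g in RHS]matop_id ffunE; apply: eq_bigr => u _; rewrite !ffunE.
Qed.

Lemma dC_cat m c g :
  matop (@dC m.+1) (cat_chain c g) =
  cat_chain (matop (@dC m) c) (matop (@phi m) c - matop (@dG m) g).
Proof. exact: matop_cone. Qed.

Lemma ret_cat n x0 xm xp :
  @ret n.+1 (cat_chain x0 (cat_chain xm xp)) = ret (xp - matop (@lowX n) xm).
Proof. by rewrite /= !rgt_cat lft_cat. Qed.

Lemma homG_cat n i j x0 xm xp :
  homogeneous (@grG n.+1) i j (cat_chain x0 (cat_chain xm xp)) <->
  [/\ homogeneous (@grG n) i j x0, homogeneous (@grG n) (i - 1) j xm &
      homogeneous (@grG n) (i - 1) (j - 2) xp].
Proof.
split; first by case/homogeneous_cat=> h0 /homogeneous_cat[hm hp]; split.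
by case=> h0 hm hp; apply/homogeneous_cat; split=> //; apply/homogeneous_cat; split.
Qed.

Lemma curl_case n (P : chain (curl n.+1) -> Prop) :
  (forall x0 xm xp, P (cat_chain x0 (cat_chain xm xp))) -> forall x, P x.
Proof. by move=> Pc x; rewrite -(catK x) -(catK (rgt x)). Qed.

Hypothesis d1d1 : forall x, matop d1 (matop d1 x) = 0.
Hypothesis d0d0 : forall x, matop d0 (matop d0 x) = 0.
Hypothesis sigma_d : forall x, matop sigma (matop d0 x) = matop d1 (matop sigma x).
Hypothesis xa_d : forall x, matop xa (matop d1 x) = matop d1 (matop xa x).
Hypothesis xb_d : forall x, matop xb (matop d1 x) = matop d1 (matop xb x).
Hypothesis xaxa : forall x, matop xa (matop xa x) = 0.
Hypothesis xbxb : forall x, matop xb (matop xb x) = 0.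
Hypothesis xaxb : forall x, matop xa (matop xb x) = matop xb (matop xa x).
Hypothesis xa_sigma : forall x, matop xa (matop sigma x) = matop xb (matop sigma x).
Hypothesis d0_hom : forall i j x,
  homogeneous g0 i j x -> homogeneous g0 (i + 1) j (matop d0 x).
Hypothesis d1_hom : forall i j x,
  homogeneous g1 i j x -> homogeneous g1 (i + 1) j (matop d1 x).
Hypothesis sigma_hom : forall i j x,
  homogeneous g0 i j x -> homogeneous g1 (i + 1) j (matop sigma x).
Hypothesis xa_hom : forall i j x,
  homogeneous g1 i j x -> homogeneous g1 i (j - 2) (matop xa x).
Hypothesis xb_hom : forall i j x,
  homogeneous g1 i j x -> homogeneous g1 i (j - 2) (matop xb x).

Lemma lowX_lowX n x : matop (@lowX n) (matop (@lowX n) x) = 0.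
Proof.
elim: n x => [|n IHn] x; first exact: xbxb.
by move: x; apply: curl_case => x0 xm xp; rewrite !lowX_cat IHn !cat_chain0.
Qed.

Lemma lowX_dG n x : matop (@lowX n) (matop (@dG n) x) = matop (@dG n) (matop (@lowX n) x).
Proof.
elim: n x => [|n IHn] x; first exact: xb_d.
move: x; apply: curl_case => x0 xm xp.
by rewrite dG_cat !lowX_cat dG_cat IHn lowX_lowX linear0 subr0.
Qed.

Lemma botX_lowX n x :
  matop (@botX n) (matop (@lowX n) x) = matop (@lowX n) (matop (@botX n) x).
Proof.
elim: n x => [|n IHn] x; first exact: xaxb.
by move: x; apply: curl_case => x0 xm xp; rewrite lowX_cat !botX_cat lowX_cat IHn linear0.
Qed.

Lemma botX_dG n x : matop (@botX n) (matop (@dG n) x) = matop (@dG n) (matop (@botX n) x).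
Proof.
elim: n x => [|n IHn] x; first exact: xa_d.
move: x; apply: curl_case => x0 xm xp.
by rewrite dG_cat !botX_cat dG_cat !linearB /= !IHn botX_lowX.
Qed.

Lemma dG_dG n x : matop (@dG n) (matop (@dG n) x) = 0.
Proof.
elim: n x => [|n IHn] x; first exact: d1d1.
move: x; apply: curl_case => x0 xm xp; rewrite !dG_cat IHn !linearB /= !IHn lowX_dG.
by rewrite oppr0 !subr0 !subrr !cat_chain0.
Qed.

(** The v- component of the comultiplication is the identity, so its cone is equivalent to its
    cokernel, in which the pair (xm, xp) becomes xp - X xm; this is [ret]. Each cone contributes one
    sign, from the minus on its target. *)
Lemma ret_dG n x : ret (matop (@dG n) x) = (-1) ^+ n *: matop d1 (ret x).
Proof.
elim: n x => [|n IHn] x; first by rewrite scale1r.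
move: x; apply: curl_case => x0 xm xp; rewrite dG_cat !ret_cat.
rewrite exprS mulN1r scaleNr -IHn -(linearN (@ret n)) /=.
by rewrite !linearB /= lowX_dG !linearN addrACA subrr add0r.
Qed.

(** Sliding X past a crossing changes its sign. This is usually a statement up to homotopy; after
    [ret] it holds on chains, because [xb] squares to zero. *)
Lemma ret_lowX n x : ret (matop (@lowX n) x) = (-1) ^+ n *: matop xb (ret x).
Proof.
elim: n x => [|n IHn] x; first by rewrite scale1r.
move: x; apply: curl_case => x0 xm xp; rewrite lowX_cat !ret_cat sub0r linearN /= IHn.
rewrite exprS mulN1r scaleNr; congr (- (_ *: _)).
by rewrite !linearB /= IHn linearZ /= xbxb scaler0 subr0.
Qed.

Lemma ret_botX n x : ret (matop (@botX n) x) = matop xa (ret x).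
Proof.
elim: n x => [|n IHn] x //; move: x; apply: curl_case => x0 xm xp.
by rewrite botX_cat !ret_cat -IHn (linearB (matop (@botX n))) /= botX_lowX.
Qed.

Lemma dG_emb n v : matop (@dG n) (emb n v) = (-1) ^+ n *: emb n (matop d1 v).
Proof.
elim: n => [|n IHn]; first by rewrite scale1r.
rewrite [emb _ _]/= dG_cat !linear0 !sub0r ?oppr0 IHn exprS mulN1r scaleNr.
apply/ffunP=> -[b|[b|b]]; rewrite !ffunE /= ?ffunE /= ?ffunE ?scaler0 ?oppr0 //.
Qed.

Lemma ret_emb n v : ret (emb n v) = v.
Proof. by elim: n => // n IHn; rewrite [emb _ _]/= ret_cat linear0 subr0. Qed.

Lemma lowX_hom n i j x :
  homogeneous (@grG n) i j x -> homogeneous (@grG n) i (j - 2) (matop (@lowX n) x).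
Proof.
elim: n i j x => [|n IHn] i j x; first exact: xb_hom.
move: x; apply: curl_case => x0 xm xp /homG_cat[h0 hm hp]; rewrite lowX_cat.
by apply/homG_cat; split; [exact: IHn| |exact: homogeneous0].
Qed.

Lemma botX_hom n i j x :
  homogeneous (@grG n) i j x -> homogeneous (@grG n) i (j - 2) (matop (@botX n) x).
Proof.
elim: n i j x => [|n IHn] i j x; first exact: xa_hom.
move: x; apply: curl_case => x0 xm xp /homG_cat[h0 hm hp]; rewrite botX_cat.
by apply/homG_cat; split; apply: IHn.
Qed.

Lemma dG_hom n i j x :
  homogeneous (@grG n) i j x -> homogeneous (@grG n) (i + 1) j (matop (@dG n) x).
Proof.
elim: n i j x => [|n IHn] i j x; first exact: d1_hom.
move: x; apply: curl_case => x0 xm xp /homG_cat[h0 hm hp]; rewrite dG_cat.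
apply/homG_cat; rewrite addrK; split; first exact: IHn.
  by apply: homogeneousB => //; rewrite -(subrK 1 i); apply: IHn.
apply: homogeneousB; first exact: lowX_hom.
by rewrite -(subrK 1 i); apply: IHn.
Qed.

Lemma phi_hom m i j x :
  homogeneous (@grC m) i j x -> homogeneous (@grG m) (i + 1) j (matop (@phi m) x).
Proof.
elim: m i j x => [|m IHm] i j x; first exact: sigma_hom.
rewrite -(catK x) => /homogeneous_cat[hc hg]; rewrite phi_cat.
apply/homG_cat; rewrite addrK; split; [exact: IHm|by []|exact: botX_hom].
Qed.

Lemma dC_hom m i j x :
  homogeneous (@grC m) i j x -> homogeneous (@grC m) (i + 1) j (matop (@dC m) x).
Proof.
elim: m i j x => [|m IHm] i j x; first exact: d0_hom.
rewrite -(catK x) => /homogeneous_cat[hc hg]; rewrite /= matop_cone.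
apply/homogeneous_cat; split; first exact: IHm.
by apply: homogeneousB; [exact: phi_hom|exact: dG_hom].
Qed.

Lemma ret_hom n i j x :
  homogeneous (@grG n) i j x -> homogeneous g1 (i - n%:Z) (j - 2 * n%:Z) (ret x).
Proof.
elim: n i j x => [|n IHn] i j x; first by rewrite mulr0 !subr0.
move: x; apply: curl_case => x0 xm xp /homG_cat[h0 hm hp]; rewrite ret_cat.
have -> : i - n.+1%:Z = (i - 1) - n%:Z by lia.
have -> : j - 2 * n.+1%:Z = (j - 2) - 2 * n%:Z by lia.
by apply: IHn; apply: homogeneousB => //; apply: lowX_hom.
Qed.

Lemma emb_hom n i j v :
  homogeneous g1 i j v -> homogeneous (@grG n) (i + n%:Z) (j + 2 * n%:Z) (emb n v).
Proof.
elim: n => [|n IHn] hv; first by rewrite mulr0 !addr0.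
apply/homG_cat; split; try exact: homogeneous0.
have -> : i + n.+1%:Z - 1 = i + n%:Z by lia.
have -> : j + 2 * n.+1%:Z - 2 = j + 2 * n%:Z by lia.
exact: IHn.
Qed.

(** The arcs below and above the new crossing are joined before the saddle by the vertical
    smoothing, so X acts alike on both. *)
Lemma botX_phi m x : matop (@botX m) (matop (@phi m) x) = matop (@lowX m) (matop (@phi m) x).
Proof.
elim: m x => [|m IHm] x; first exact: xa_sigma.
rewrite -(catK x) phi_cat botX_cat lowX_cat IHm; congr (cat_chain _ (cat_chain _ _)).
elim: m {IHm x} (rgt x) => [|m IHm] g; first exact: xaxa.
by move: g; apply: curl_case => x0 xm xp; rewrite !botX_cat !IHm !cat_chain0.
Qed.

Lemma phi_dC m x : matop (@phi m) (matop (@dC m) x) = matop (@dG m) (matop (@phi m) x).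
Proof.
elim: m x => [|m IHm] x; first exact: sigma_d.
rewrite -(catK x) dC_cat !phi_cat dG_cat IHm !linearB /=; congr cat_chain.
by congr cat_chain; rewrite botX_phi botX_dG.
Qed.

Lemma dC_dC m x : matop (@dC m) (matop (@dC m) x) = 0.
Proof.
elim: m x => [|m IHm] x; first exact: d0d0.
rewrite -(catK x) !dC_cat IHm phi_dC (linearB (matop (@dG m))) /= dG_dG.
by rewrite subr0 subrr cat_chain0.
Qed.

(** [ret] discards the words in which the next crossing is smoothed vertically, so in homology the
    connecting map sees only the part [g] added by the previous crossing. *)
Lemma ret_phi m c g :
  ret (matop (@phi m.+1) (cat_chain c g)) =
  matop xa (ret g) - (-1) ^+ m *: matop xb (ret g).
Proof. by rewrite phi_cat ret_cat linearB /= ret_botX ret_lowX. Qed.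

(** * The connecting maps and the count of classes *)

Variable R : {linear chain L -> two_circles}.
Hypothesis R_d1 : forall x, R (matop d1 x) = 0.
Hypothesis R_hom : forall i j x,
  homogeneous g1 i j x -> homogeneous two_circles_grading i j (R x).
Hypothesis R_exact : forall i j z, homogeneous g1 i j z -> matop d1 z = 0 ->
  R z = 0 -> exists2 y, homogeneous g1 (i - 1) j y & z = matop d1 y.
Hypothesis R_xa : forall i j z, homogeneous g1 i j z -> matop d1 z = 0 ->
  R (matop xa z) = matop mulX (R z).
Hypothesis R_xb : forall i j z, homogeneous g1 i j z -> matop d1 z = 0 ->
  R (matop xb z) = matop mulY (R z).
Variable v : chain L.
Hypothesis v_hom : homogeneous g1 5 7 v.
Hypothesis v_cyc : matop d1 v = 0.
Hypothesis R_v : R v = dlt (false, false).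
Variables y1 y2 : chain L.
Hypothesis y1_hom : homogeneous g0 4 5 y1.
Hypothesis y2_hom : homogeneous g0 4 3 y2.
Hypothesis y1_cyc : matop d0 y1 = 0.
Hypothesis y2_cyc : matop d0 y2 = 0.
Hypothesis sigma_y1 : matop sigma y1 = matop xa v + matop xb v.
Hypothesis sigma_y2 : matop sigma y2 = matop xa (matop xb v).

Definition retR n : 'Hom(chain (curl n), two_circles) := linfun (R \o @ret n).

Lemma retRE n x : retR n x = R (ret x). Proof. by rewrite lfunE. Qed.

(** For a cycle (z0, zm, zp), [zm] is a primitive of [z0]. Subtracting its boundary leaves the cycle
    zp - X zm of a shorter curl, to which the induction hypothesis applies. *)
Lemma dG_exact n i j z :
  homogeneous (@grG n) i j z -> matop (@dG n) z = 0 -> R (ret z) = 0 ->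
  exists2 y, homogeneous (@grG n) (i - 1) j y & z = matop (@dG n) y.
Proof.
elim: n i j z => [|n IHn] i j z; first exact: R_exact.
move: z; apply: curl_case => z0 zm zp /homG_cat[h0 hm hp]; rewrite dG_cat ret_cat.
move=> /cat_chain_eq0[_ /cat_chain_eq0[/eqP + /eqP]].
rewrite !subr_eq0 => /eqP dzm /eqP dzp Rz.
have hu : homogeneous (@grG n) (i - 1) (j - 2) (zp - matop (@lowX n) zm).
  by apply: homogeneousB => //; apply: lowX_hom.
have du : matop (@dG n) (zp - matop (@lowX n) zm) = 0.
  by rewrite linearB /= -lowX_dG -dzm dzp subrr.
have [y hy zy] := IHn _ _ _ hu du Rz.
exists (cat_chain zm (cat_chain 0 (- y))).
  apply/homG_cat; split; [exact: hm|exact: homogeneous0|].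
  by rewrite -scaleN1r; apply: homogeneousZ.
rewrite dG_cat linear0 subr0 -dzm; congr cat_chain; congr cat_chain.
by rewrite linearN /= opprK -zy addrC subrK.
Qed.

Lemma retR_detects n : detects (@grG n) (@dG n) (retR n).
Proof.
move=> i j x hx dx; rewrite retRE; split=> [|[y _ ->]]; first exact: dG_exact.
by rewrite ret_dG linearZ /= R_d1 scaler0.
Qed.

Lemma d1_xa x : matop d1 x = 0 -> matop d1 (matop xa x) = 0.
Proof. by move=> dx; rewrite -xa_d dx linear0. Qed.
Lemma d1_xb x : matop d1 x = 0 -> matop d1 (matop xb x) = 0.
Proof. by move=> dx; rewrite -xb_d dx linear0. Qed.

Definition basis_cycle (u : bool * bool) : chain L :=
  let w := if u.2 then matop xb v else v in if u.1 then matop xa w else w.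

Lemma basis_cycleP u i j : two_circles_grading u i j ->
  [/\ homogeneous g1 i j (basis_cycle u), matop d1 (basis_cycle u) = 0 &
      R (basis_cycle u) = dlt u].
Proof.
move=> /andP[/eqP -> /eqP ->].
have mX k l : matop mulX (dlt (false, l)) (k, l) = k%:R.
  by rewrite mulXE ffunE; case: k; rewrite ?eqxx.
have Xd l : matop mulX (dlt (false, l)) = dlt (true, l).
  by apply/ffunP=> -[k' l']; rewrite mulXE !ffunE; case: k'.
have Yd k : matop mulY (dlt (k, false)) = dlt (k, true).
  by apply/ffunP=> -[k' l']; rewrite mulYE !ffunE; case: l'; rewrite ?xpair_eqE ?andbF.
have hb := xb_hom v_hom; have db := d1_xb v_cyc.
have Rb : R (matop xb v) = dlt (false, true) by rewrite (R_xb v_hom v_cyc) R_v Yd.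
case: u => -[] [] /=.
- split; [exact: (xa_hom hb)|exact: d1_xa|by rewrite (R_xa hb db) Rb Xd].
- split; [exact: (xa_hom v_hom)|exact: d1_xa|by rewrite (R_xa v_hom v_cyc) R_v Xd].
- by split.
- by split.
Qed.

Lemma retR_cycles n i j :
  (retR n @: cycles (@grG n) (@dG n) i j)%VS =
  piece two_circles_grading (i - n%:Z) (j - 2 * n%:Z).
Proof.
apply/eqP; rewrite eqEsubv; apply/andP; split.
  apply/subvP=> x /memv_imgP[z /mem_cycles[hz dz] ->]; rewrite retRE.
  by apply/mem_piece/R_hom/ret_hom.
apply: piece_sub => u /basis_cycleP[hu du Ru].
have -> : dlt u = retR n (emb n (basis_cycle u)) by rewrite retRE ret_emb.
apply: memv_img; apply/mem_cycles; split.
  by have := @emb_hom n _ _ _ hu; rewrite !subrK.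
rewrite dG_emb du; apply/eqP; rewrite scaler_eq0; apply/orP; right.
by elim: n {i j hu} => [|n IHn] //=; rewrite (eqP IHn) !cat_chain0.
Qed.

Lemma dim_two_circles_piece i j :
  \dim (piece two_circles_grading i j) =
  ((i == 5) * ((j == 7) + 2 * (j == 5) + (j == 3)))%N.
Proof.
rewrite dim_piece.
transitivity (\sum_(k : bool) \sum_(l : bool) (two_circles_grading (k, l) i j : nat))%N.
  rewrite pair_bigA -sum1_card big_mkcond; apply: eq_bigr => -[k l] _.
  by rewrite inE; case: ifP.
rewrite !big_bool /two_circles_grading /=; lia.
Qed.

(** With e = (-1)^m the values are multiples of X + eY by [ret_phi] if m > 0, and (X - eY)(X + eY) =
    X^2 - Y^2 = 0. For m = 0 the relation is [xa_sigma]. *)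
Lemma connectingP m i j x :
  x \in connecting (@grC m) (@dC m) (@phi m) (retR m) i j ->
  homogeneous two_circles_grading (i + 1 - m%:Z) (j - 2 * m%:Z) x /\
  matop mulX x = (-1) ^+ m *: matop mulY x.
Proof.
case/memv_imgP=> _ /memv_imgP[c /mem_cycles[hc dc] ->] ->.
rewrite retRE lfunE /=; set w := ret _.
have hw : homogeneous g1 (i + 1 - m%:Z) (j - 2 * m%:Z) w.
  by apply/ret_hom/phi_hom.
have dw : matop d1 w = 0.
  have /eqP := ret_dG (matop (@phi m) c).
  by rewrite -phi_dC dc !linear0 eq_sym scaler_eq0 signr_eq0 => /eqP.
split; first exact: R_hom.
rewrite -(R_xa hw dw) -(R_xb hw dw) -linearZ /=; congr (R _).
rewrite /w; case: m {hw dw w} c hc dc => [|m] c _ _; first by rewrite scale1r xa_sigma.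
rewrite -(catK c) ret_phi !linearB !linearZ /= xaxa xbxb xaxb.
by rewrite oppr0 !scaler0 addr0 add0r exprS mulN1r scaleNr scalerN.
Qed.

Lemma mem_connecting m i j c :
    homogeneous (@grC m) i j c -> matop (@dC m) c = 0 ->
  R (ret (matop (@phi m) c)) \in connecting (@grC m) (@dC m) (@phi m) (retR m) i j.
Proof.
move=> hc dc; rewrite -retRE -[matop _ c]lfunE; do 2! apply: memv_img.
exact/mem_cycles.
Qed.

(** For m = 0 the classes come from the given cycles [y1] and [y2] of the vertical closure. Later
    they come from the classes 1 and X in the part added by the previous crossing, which the
    connecting map X + eY sends to X + eY and eXY. *)
Lemma connecting_spec m (e := (-1) ^+ m : rat) :
  (dlt (true, false) + e *: dlt (false, true) : two_circles)
    \in connecting (@grC m) (@dC m) (@phi m) (retR m) (4 + m%:Z) (5 + 2 * m%:Z) /\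
  (dlt (true, true) : two_circles)
    \in connecting (@grC m) (@dC m) (@phi m) (retR m) (4 + m%:Z) (3 + 2 * m%:Z).
Proof.
have Rb u i j : two_circles_grading u i j -> R (basis_cycle u) = dlt u.
  by case/basis_cycleP.
have R10 := Rb (true, false) 5 5 isT; have R01 := Rb (false, true) 5 5 isT.
have R11 := Rb (true, true) 5 3 isT; rewrite /basis_cycle /= in R10 R01 R11.
rewrite /e; case: m {e} => [|m].
  rewrite !mulr0 !addr0 scale1r -R10 -R01 -R11 -linearD -sigma_y1 -sigma_y2.
  by split; apply: (@mem_connecting 0).
have hc u i j : homogeneous g1 i j u ->
    homogeneous (@grC m.+1) (i + m%:Z) (j + 2 * m%:Z) (cat_chain 0 (emb m u)).
  by move=> hu; apply/homogeneous_cat; split; [exact: homogeneous0|exact: emb_hom].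
have emb0 : emb m 0 = 0 by elim: (m) => [|n IHn] //=; rewrite IHn !cat_chain0.
have dc u : matop d1 u = 0 -> matop (@dC m.+1) (cat_chain 0 (emb m u)) = 0.
  by move=> du; rewrite dC_cat !linear0 dG_emb du emb0 scaler0 subr0 cat_chain0.
have Rc u : R (ret (matop (@phi m.+1) (cat_chain 0 (emb m u)))) =
    R (matop xa u) + (-1) ^+ m.+1 *: R (matop xb u).
  by rewrite ret_phi ret_emb linearB linearZ exprS mulN1r scaleNr.
have -> : 4 + m.+1%:Z = 5 + m%:Z by lia.
have -> : 5 + 2 * m.+1%:Z = 7 + 2 * m%:Z by lia.
have -> : 3 + 2 * m.+1%:Z = (7 - 2) + 2 * m%:Z by lia.
split.
  by rewrite -R10 -R01 -Rc; apply: (@mem_connecting m.+1); [exact: hc|exact: dc].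
have := @mem_connecting m.+1 _ _ _ (hc _ _ _ (xa_hom v_hom)) (dc _ (d1_xa v_cyc)).
by rewrite Rc xaxa linear0 add0r -xaxb R11 rpredZsign.
Qed.

Lemma dim_connecting m i j :
  \dim (connecting (@grC m) (@dC m) (@phi m) (retR m) i j) =
  ((i == 4 + m%:Z) && ((j == 5 + 2 * m%:Z) || (j == 3 + 2 * m%:Z))).
Proof.
set W := connecting _ _ _ _ _ _; have WP := @connectingP m i j.
have [mem1 mem2] := connecting_spec m.
have W0 x : x \in W -> forall k l, x (k, l) != 0 ->
    i + 1 - m%:Z = 5 /\ j - 2 * m%:Z = 7 - 2 * (k + l)%N%:Z.
  by move=> /WP[hx _] k l /hx /andP[/eqP ? /eqP].
have Wff x : x \in W -> x (false, false) = 0.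
  move=> /WP[_ /ffunP/(_ (true, false))].
  by rewrite [RHS]ffunE mulXE mulYE scaler0.
have Wtf x : x \in W -> x (false, true) = (-1) ^+ m * x (true, false).
  by move=> /WP[_ /ffunP/(_ (true, true))]; rewrite [RHS]ffunE mulXE mulYE.
have [/andP[/eqP ei /orP[/eqP ej|/eqP ej]]|/negP nij] := boolP (_ && _).
- suff -> : W = <[(dlt (true, false) + (-1) ^+ m *: dlt (false, true) : two_circles)]>%VS.
    rewrite dim_vline; case: eqP => // /ffunP/(_ (true, false)) /eqP.
    by rewrite !ffunE /= scaler0 addr0 oner_eq0.
  apply/eqP; rewrite eqEsubv -memvE {2}/W ei ej mem1 andbT.
  apply/subvP=> x xW; apply/vlineP; exists (x (true, false)).
  apply/ffunP=> -[k l]; rewrite !ffunE /=.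
  have xtt : x (true, true) = 0.
    by apply/eqP/negPn/negP => /(W0 _ xW)[_]; rewrite ej; lia.
  by case: k; case: l; rewrite ?xtt ?Wff ?Wtf //= ?scaler0 ?addr0 ?add0r ?scaler0
    -?[_ *: _]/(_ * _) ?mulr1 // mulrC.
- suff -> : W = <[(dlt (true, true) : two_circles)]>%VS.
    rewrite dim_vline; case: eqP => // /ffunP/(_ (true, true)) /eqP.
    by rewrite !ffunE eqxx oner_eq0.
  apply/eqP; rewrite eqEsubv -memvE {2}/W ei ej mem2 andbT.
  apply/subvP=> x xW; apply/vlineP; exists (x (true, true)).
  apply/ffunP=> -[k l]; rewrite !ffunE /=.
  have xtf : x (true, false) = 0.
    by apply/eqP/negPn/negP => /(W0 _ xW)[_]; rewrite ej; lia.
  by case: k; case: l; rewrite ?xtf ?Wff ?Wtf ?xtf //= ?scaler0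
    -?[_ *: _]/(_ * _) ?mulr1 ?mulr0.
suff -> : W = 0%VS by rewrite dimv0.
apply/eqP; rewrite -subv0; apply/subvP=> x xW; rewrite memv0; apply/eqP/ffunP=> -[k l].
rewrite [RHS]ffunE; apply/eqP/negPn/negP => xkl; apply: nij.
have [e1 e2] := W0 _ xW _ _ xkl.
case: k l xkl e2 => -[] xkl e2; last by rewrite Wff ?eqxx in xkl.
all: by apply/andP; split; [|apply/orP]; lia.
Qed.

(** The step from m to m + 1 adds four classes in homological degree 5 + m, in quantum degrees 7, 5,
    5, 3 plus 2m. The connecting map cancels one of those at 5 and the one at 3 against the classes
    in degree 4 + m that the correction term for m records; the survivors at 7 and 5 form the
    correction term for m + 1. *)
Theorem hom_twist m i j :
  hom (@grC m) (@dC m) i j + ((i == 4) && ((j == 5) || (j == 3)))%:Z =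
  hom g0 d0 i j + ((i == 4 + m%:Z) && ((j == 5 + 2 * m%:Z) || (j == 3 + 2 * m%:Z)))%:Z.
Proof.
elim: m => [|m IHm]; first by rewrite !mulr0 !addr0.
rewrite [hom _ _ i j in LHS](hom_cone (@retR_detects m) (@phi_hom m) (@dG_hom m)
  (@dG_dG m) (@phi_dC m)).
rewrite retR_cycles dim_two_circles_piece !dim_connecting.
have -> : (i - m%:Z == 5) = (i == 4 + m.+1%:Z) by lia.
have -> : (i - 1 == 4 + m%:Z) = (i == 4 + m.+1%:Z) by lia.
have -> : (j - 2 * m%:Z == 7) = (j == 5 + 2 * m.+1%:Z) by lia.
have -> : (j - 2 * m%:Z == 5) = (j == 5 + 2 * m%:Z) by lia.
have -> : (j - 2 * m%:Z == 3) = (j == 3 + 2 * m%:Z) by lia.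
have -> : (j == 3 + 2 * m.+1%:Z) = (j == 5 + 2 * m%:Z) by lia.
have : ~~ ((j == 5 + 2 * m.+1%:Z) && ((j == 5 + 2 * m%:Z) || (j == 3 + 2 * m%:Z))) by lia.
have : ~~ ((j == 5 + 2 * m%:Z) && (j == 3 + 2 * m%:Z)) by lia.
move: IHm; move: (hom _ _ i j) (hom _ _ i j) (_ && _ : bool) => h h0 b.
case: (i == 4 + m%:Z); case: (i == 4 + m.+1%:Z);
  case: (j == 5 + 2 * m.+1%:Z); case: (j == 5 + 2 * m%:Z); case: (j == 3 + 2 * m%:Z) => //= + _ _;
  clear; lia.
Qed.

End TwistRegion.

(** * Khovanov homology as the homology of a based complex *)

(** Passes from ranks of matrices, in which [kh_dim] is stated, to dimensions of images, in which
    [rk] is. *)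
Lemma dim_limg_mulmxr n m (M : 'M[rat]_(n, m)) :
  \dim (limg (linfun (mulmxr M : 'rV_n -> 'rV_m))) = \rank M.
Proof.
have -> : limg (linfun (mulmxr M : 'rV_n -> 'rV_m)) =
    limg (linfun (mulmxr (row_base M) : 'rV_(\rank M) -> 'rV_m)).
  apply/vspaceP=> x; apply/memv_imgP/memv_imgP => -[u _ ->]; rewrite lfunE /=.
    have /submxP[w Mw] : (u *m M <= row_base M)%MS by rewrite eq_row_base submxMl.
    by exists w; rewrite ?memvf // lfunE /= -Mw.
  have /submxP[w Mw] : (u *m row_base M <= M)%MS.
    by rewrite -(eq_row_base M) submxMl.
  by exists w; rewrite ?memvf // lfunE /= -Mw.
rewrite limg_dim_eq; first by rewrite dimvf /dim /= mul1n.
apply/eqP; rewrite -subv0; apply/subvP=> x; rewrite memv_cap memvf memv_ker memv0 lfunE /=.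
move=> /eqP x0; apply/eqP.
have /row_free_inj : row_free (row_base M) by rewrite /row_free eq_row_base.
by apply; rewrite x0 mul0mx.
Qed.

Section Transport.
Variables (D : diagram) (A : finType) (g : grading A) (inc : A -> A -> rat).
Variables (a b : int) (word : labelled D -> A) (eps : labelled D -> rat).
Hypothesis eps_neq0 : forall S, eps S != 0.
Hypothesis word_gr : forall S i j, is_gen S ->
  g (word S) (i + a) (j + b) = (hdeg S == i) && (qdeg S == j).
Hypothesis word_inj : forall S T, is_gen S -> is_gen T -> word S = word T -> S = T.
Hypothesis word_surj : forall w i j, g w i j -> exists2 S, is_gen S & word S = w.
Hypothesis word_inc : forall S T, is_gen S -> is_gen T ->
  eps S * inc (word S) (word T) = incidence S T * eps T.
Hypothesis inc_hom : forall i j x,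
  homogeneous g i j x -> homogeneous g (i + 1) j (matop inc x).
Hypothesis inc_inc : forall x, matop inc (matop inc x) = 0.

Section Piece.
Variables i j : int.
Local Notation N := (#|kh_gen D i j|).

Let gen (r : 'I_N) : labelled D := val (enum_val r).

Let genP r : [/\ is_gen (gen r), hdeg (gen r) = i & qdeg (gen r) = j].
Proof. by have /and3P[? /eqP ? /eqP] := valP (enum_val r). Qed.

(** The generators are rescaled by [eps], which turns the sign convention of the cube into that of
    [inc]. *)
Definition realize (u : 'rV[rat]_N) : chain A :=
  \sum_r (u 0 r * eps (val (enum_val r))) *: dlt (word (val (enum_val r))).

Fact realize_is_linear : linear realize.
Proof.
move=> k u v; rewrite /realize scaler_sumr -big_split /=; apply: eq_bigr => r _.
by rewrite !mxE mulrDl scalerDl scalerA mulrA.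
Qed.
HB.instance Definition _ :=
  GRing.isLinear.Build rat 'rV[rat]_N (chain A) _ realize realize_is_linear.

Let gen_inj r s : word (gen r) = word (gen s) -> r = s.
Proof.
have [[gr _ _] [gs _ _]] := (genP r, genP s) => /(word_inj gr gs) /val_inj.
exact: enum_val_inj.
Qed.

Lemma realizeE u r : realize u (word (gen r)) = u 0 r * eps (gen r).
Proof.
rewrite sum_ffunE (bigD1 r) //= big1 ?addr0 => [|s nsr]; rewrite !ffunE.
  by rewrite eqxx -[_ *: _]/(_ * _) mulr1.
case: eqP => [/gen_inj sr|_]; last by rewrite scaler0.
by rewrite sr eqxx in nsr.
Qed.

Lemma realize_inj u : realize u = 0 -> u = 0.
Proof.
move=> u0; apply/rowP=> r; rewrite mxE; apply/eqP.
have /eqP := realizeE u r; rewrite u0 ffunE eq_sym mulf_eq0.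
by rewrite (negPf (eps_neq0 _)) orbF.
Qed.

Lemma limg_realize : limg (linfun realize) = piece g (i + a) (j + b).
Proof.
have gr r : g (word (gen r)) (i + a) (j + b).
  by have [gr hr qr] := genP r; rewrite word_gr // hr qr !eqxx.
apply/eqP; rewrite eqEsubv; apply/andP; split.
  apply/subvP=> x /memv_imgP[u _ ->]; rewrite lfunE /=.
  apply: rpred_sum => r _; apply: rpredZ; apply/mem_piece => w; rewrite ffunE.
  by rewrite pnatr_eq0 eqb0 negbK => /eqP <-; apply: gr.
apply: piece_sub => w gw; have [S gS Sw] := word_surj gw.
move: gw; rewrite -Sw word_gr // => /andP[/eqP hS /eqP qS].
have SP : [&& is_gen S, hdeg S == i & qdeg S == j] by rewrite gS hS qS !eqxx.
pose r : 'I_N := enum_rank (Sub S SP : kh_gen D i j).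
have Sr : gen r = S by rewrite /gen enum_rankK.
have -> : dlt (word S) = (eps S)^-1 *: realize (delta_mx 0 r).
  rewrite /realize (bigD1 r) //= big1 ?addr0 => [|s nsr].
    by rewrite -/(gen r) Sr mxE !eqxx mul1r scalerA mulVf // scale1r.
  by rewrite mxE eqxx (negPf nsr) mul0r scale0r.
by rewrite memvZ // -[realize _]lfunE memv_img ?memvf.
Qed.

Lemma card_kh_gen : N = #|[pred w | g w (i + a) (j + b)]|.
Proof.
rewrite -dim_piece -limg_realize limg_dim_eq; first by rewrite dimvf /dim /= mul1n.
apply/eqP; rewrite -subv0; apply/subvP=> x; rewrite memv_cap memv_ker memv0 lfunE /=.
by case/andP=> _ /eqP /realize_inj ->.
Qed.

End Piece.

Lemma realize_diff i i' j u : i' = i + 1 ->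
  matop inc (@realize i j u) = realize (u *m kh_diff D i i' j).
Proof.
move=> i'E.
have hx : homogeneous g (i' + a) (j + b) (matop inc (realize u)).
  rewrite i'E addrAC; apply/inc_hom/mem_piece.
  by rewrite -limg_realize -[realize u]lfunE memv_img ?memvf.
have /mem_piece := hx; rewrite -limg_realize => /memv_imgP[w _].
rewrite lfunE /= => xw; rewrite xw; congr realize; apply/rowP=> s.
apply: (mulIf (eps_neq0 (val (enum_val s)))).
rewrite -realizeE -xw ffunE mxE mulr_suml.
have gP k l (r : 'I_#|kh_gen D k l|) : is_gen (val (enum_val r)).
  by have /and3P[] := valP (enum_val r).
rewrite [LHS](eq_bigr (fun c => \sum_r (u 0 r * eps (val (enum_val r)))
   * (dlt (word (val (enum_val r))) c * inc c (word (val (enum_val s)))))); last first.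
  move=> c _; rewrite sum_ffunE mulr_suml; apply: eq_bigr => r _.
  by rewrite ffunE; apply/esym/mulrA.
rewrite exchange_big /=; apply: eq_bigr => r _.
rewrite -mulr_sumr (bigD1 (word (val (enum_val r)))) //= big1 ?addr0 => [|c nc].
  by rewrite ffunE eqxx mul1r mxE -[LHS]mulrA (word_inc (gP _ _ r) (gP _ _ s)) [LHS]mulrA.
by rewrite ffunE eq_sym (negPf nc) mul0r.
Qed.

Lemma rank_kh_diff i i' j : i' = i + 1 ->
  \rank (kh_diff D i i' j) = rk g inc (i + a) (j + b).
Proof.
move=> i'E; rewrite -dim_limg_mulmxr /rk -limg_realize.
rewrite -(@limg_dim_eq _ _ _ (linfun (@realize i' j))); last first.
  apply/eqP; rewrite -subv0; apply/subvP=> x; rewrite memv_cap memv_ker memv0 lfunE /=.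
  by case/andP=> _ /eqP /realize_inj ->.
rewrite -!limg_comp; congr (\dim (lfun_img _ _)); apply/lfunP=> u.
by rewrite !comp_lfunE !lfunE /= (realize_diff u i'E).
Qed.

Lemma kh_dim_hom i j : (kh_dim D i j)%:Z = hom g inc (i + a) (j + b).
Proof.
have e1 : i = i - 1 + 1 by rewrite subrK.
(* That consecutive Khovanov differentials compose to zero is pulled back from [inc] along the
   injective map [realize]. *)
have BM : kh_diff D (i - 1) i j *m kh_diff D i (i + 1) j = 0.
  apply/row_matrixP=> r; rewrite row0 rowE mulmxA; apply: (@realize_inj (i + 1) j).
  by rewrite -realize_diff // -realize_diff.
have sub : (kh_diff D (i - 1) i j <= kermx (kh_diff D i (i + 1) j))%MS.
  exact/sub_kermxP.
rewrite /kh_dim /hom -card_kh_gen.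
have -> : i + a - 1 = (i - 1) + a by lia.
rewrite -(@rank_kh_diff i (i + 1) j) // -(@rank_kh_diff (i - 1) i j) //.
have := mxrank_cap_compl (kermx (kh_diff D i (i + 1) j)) (kh_diff D (i - 1) i j).
rewrite (capmx_idPr sub) mxrank_ker => rankE.
have := rank_leq_row (kh_diff D i (i + 1) j); lia.
Qed.

End Transport.

(** * The circles of a resolution *)

Local Close Scope ring_scope.

Lemma connect_invariant (T : finType) (C : eqType) (e : rel T) (f : T -> C) x y :
  (forall u v, e u v -> f u = f v) -> connect e x y -> f x = f y.
Proof.
move=> ef /connectP[p + ->]; elim: p x => //= z p IHp x /andP[/ef -> ].
exact: IHp.
Qed.

(** [f] is a complete invariant of the components and [l] lists the values that it takes on [a]; the
    last hypothesis makes [a] a union of components. *)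
Lemma n_comp_image (T : finType) (C : eqType) (e : rel T) (f : T -> C) (a : {pred T})
    (l : seq C) :
    (forall x y, connect e x y = (f x == f y)) -> uniq l ->
    (forall x, x \in a -> f x \in l) -> (forall c, c \in l -> exists2 x, x \in a & f x = c) ->
    (forall x y, f x = f y -> (x \in a) = (y \in a)) ->
  n_comp e a = size l.
Proof.
move=> ef ul al la af.
have sym : connect_sym e by move=> x y; rewrite !ef eq_sym.
have fr x : f (fingraph.root e x) = f x by apply/esym/eqP; rewrite -ef connect_root.
rewrite /n_comp_mem cardE -(size_map f); apply/perm_size/uniq_perm => //.
  rewrite map_inj_in_uniq ?enum_uniq // => x y.
  rewrite !mem_enum !inE => /andP[/eqP rx _] /andP[/eqP ry _] fxy.
  by rewrite -rx -ry; apply/eqP; rewrite root_connect // ef fxy.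
move=> c; apply/mapP/idP => [[x]|/la[x ax <-]].
  by rewrite mem_enum inE => /andP[_ /al ? ->].
exists (fingraph.root e x); last by rewrite fr.
by rewrite mem_enum !inE roots_root // (af _ x (fr x)).
Qed.

Definition quad := (nat * nat * nat * nat)%type.

Definition quad_pairs (b : bool) (t : quad) : seq (nat * nat) :=
  let: (x0, x1, x2, x3) := t in
  if b then [:: (x1, x2); (x3, x0)] else [:: (x0, x1); (x2, x3)].

(* The outer edges are numbered as follows: 0-4 and 5-9 the inner edges of the
   two halves, 10 and 11 the edges along ca, 12 and 13 (14 and 15) the left and
   right edge at the bottom (top) of the twist region, 16 and 17 the edges ab.
   The last quadruple is a single crossing filling the twist region. *)
Definition kan_quads : seq quad :=
  [:: (0, 1, 10, 16); (2, 0, 16, 12); (3, 4, 14, 11); (4, 3, 1, 2);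
      (5, 17, 10, 6); (7, 13, 17, 5); (8, 11, 15, 9); (9, 7, 6, 8);
      (13, 15, 14, 12)]%N.

Definition joins (bs : seq bool) : seq (nat * nat) :=
  flatten [seq quad_pairs p.1 p.2 | p <- zip bs kan_quads].

(** The smaller representative wins, so a representative never exceeds the members of its class; the
    enumeration of labellings in increasing order of edges depends on this. *)
Definition merge (r : seq nat) (p : nat * nat) : seq nat :=
  let a := nth 0 r p.1 in let b := nth 0 r p.2 in
  [seq if z == maxn a b then minn a b else z | z <- r].

Definition reps (bs : seq bool) : seq nat := foldl merge (iota 0 18) (joins bs).

Lemma size_merge r l : size (foldl merge r l) = size r.
Proof. by elim: l r => //= p l IHl r; rewrite IHl size_map. Qed.

Lemma size_reps bs : size (reps bs) = 18.
Proof. by rewrite size_merge size_iota. Qed.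

Lemma nth_merge r p x : x < size r ->
  nth 0 (merge r p) x = if nth 0 r x == maxn (nth 0 r p.1) (nth 0 r p.2)
    then minn (nth 0 r p.1) (nth 0 r p.2) else nth 0 r x.
Proof. by move=> xr; rewrite (nth_map 0). Qed.

Lemma merge_eq r p : p.1 < size r -> p.2 < size r ->
  nth 0 (merge r p) p.1 = nth 0 (merge r p) p.2.
Proof.
move=> h1 h2; rewrite !nth_merge //.
by case: leqP => _; rewrite eqxx; case: eqP.
Qed.

Lemma merge_mono r p x y : x < size r -> y < size r ->
  nth 0 r x = nth 0 r y -> nth 0 (merge r p) x = nth 0 (merge r p) y.
Proof. by move=> hx hy xy; rewrite !nth_merge // xy. Qed.

Lemma foldl_merge_eq l r p : all (fun p => (p.1 < size r) && (p.2 < size r)) l ->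
  p \in l -> nth 0 (foldl merge r l) p.1 = nth 0 (foldl merge r l) p.2.
Proof.
have mono l' r' x y : x < size r' -> y < size r' -> nth 0 r' x = nth 0 r' y ->
    nth 0 (foldl merge r' l') x = nth 0 (foldl merge r' l') y.
  elim: l' r' => //= q l' IHl r' hx hy xy; apply: IHl; rewrite ?size_map //.
  exact: merge_mono.
elim: l r => //= q l IHl r /andP[/andP[h1 h2] hl]; rewrite inE => /predU1P[->|pl].
  by apply: mono; rewrite ?size_map ?merge_eq.
by apply: IHl; rewrite ?size_map.
Qed.

Lemma foldl_merge_rel (e : rel nat) l r x : (forall u, e u u) ->
    (forall u v w, e u v -> e v w -> e u w) -> (forall u v, e u v -> e v u) ->
    all (fun p => [&& p.1 < size r, p.2 < size r & e p.1 p.2]) l ->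
    (forall u, u < size r -> e u (nth 0 r u)) ->
  x < size r -> e x (nth 0 (foldl merge r l) x).
Proof.
move=> refl tr sym; elim: l r => [|p l IHl] r /=; first by move=> _ hr /hr.
move=> /andP[/and3P[h1 h2 ep] hl] hr hx; apply: IHl; rewrite ?size_map //.
move=> u hu; rewrite nth_merge //.
have e12 : e (nth 0 r p.1) (nth 0 r p.2).
  exact: tr (tr _ _ _ (sym _ _ (hr _ h1)) ep) (hr _ h2).
have eu := hr _ hu; have eu1 := tr _ _ _ _ e12; have e21 := sym _ _ e12.
case: eqP => [|_]; last exact: eu.
by case: leqP => _ E; move: eu; rewrite E => eu //; apply: tr eu _.
Qed.

Lemma joins_lt bs : all (fun p => (p.1 < 18) && (p.2 < 18)) (joins bs).
Proof.
rewrite /joins; have : all (fun t : quad => all (fun x => x < 18)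
  [:: t.1.1.1; t.1.1.2; t.1.2; t.2]) kan_quads by [].
elim: kan_quads bs => [|[[[x0 x1] x2] x3] q IHq] [|b bs] //= /andP[].
case/and5P=> h0 h1 h2 h3 _ hq; rewrite all_cat IHq // andbT.
by case: b; rewrite /= ?h0 ?h1 ?h2 ?h3.
Qed.

Lemma reps_joins bs p : p \in joins bs -> nth 0 (reps bs) p.1 = nth 0 (reps bs) p.2.
Proof. by apply: foldl_merge_eq; rewrite size_iota; apply: joins_lt. Qed.

(** Every equivalence relation containing the joins relates an edge to its representative. Choosing
    the relation gives in turn the range of the representatives, their idempotence and the
    comparison with circles. *)
Lemma reps_rel (e : rel nat) bs x : (forall u, e u u) ->
    (forall u v w, e u v -> e v w -> e u w) -> (forall u v, e u v -> e v u) ->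
    (forall p, p \in joins bs -> e p.1 p.2) ->
  x < 18 -> e x (nth 0 (reps bs) x).
Proof.
move=> erefl etrans esym ej hx.
apply: foldl_merge_rel; rewrite ?size_iota //; last by move=> u hu; rewrite nth_iota.
by apply/allP=> p pj; rewrite ej // andbT; have /allP/(_ p pj) := joins_lt bs.
Qed.

Lemma reps_lt bs x : x < 18 -> nth 0 (reps bs) x < 18.
Proof.
move=> hx; suff /eqP <- : (x < 18) == (nth 0 (reps bs) x < 18) by [].
apply: (@reps_rel (fun u v => (u < 18) == (v < 18))) => //.
- by move=> u v w /eqP -> /eqP ->.
- by move=> u v; rewrite eq_sym.
- by move=> p pj; have /allP/(_ p pj)/andP[-> ->] := joins_lt bs.
Qed.

Lemma reps_idem bs x : x < 18 -> nth 0 (reps bs) (nth 0 (reps bs) x) = nth 0 (reps bs) x.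
Proof.
move=> hx; apply/eqP; rewrite eq_sym.
apply: (@reps_rel (fun u v => nth 0 (reps bs) u == nth 0 (reps bs) v)) => //.
- by move=> u v w /eqP -> /eqP ->.
- by move=> u v; rewrite eq_sym.
- by move=> p /reps_joins ->.
Qed.

(* Generators of the complexes of the two closures of the outer tangle, in which
   the twist region is filled with a vertical (t = false) or a horizontal
   (t = true) smoothing: 8 bits for the resolution, then the labels of the outer
   edges. *)
Definition state : finType := 26.-tuple bool.

Section States.
Implicit Types (t : bool) (o : seq bool).

Definition lab o x := nth false o (8 + x).
Definition rp t o : seq nat := reps (rcons (take 8 o) t).

Definition valid t o :=
  (size o == 26) && all (fun x => lab o x == lab o (nth 0 (rp t o) x)) (iota 0 18).

Definition outer_circles t o b :=
  count (fun x => (nth 0 (rp t o) x == x) && (lab o x == b)) (iota 0 18).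

(** The horizontal filling counts as a 1-smoothing, so that the saddle has homological degree
    one. *)
Definition state_weight t o := count id (take 8 o) + t.

Definition quad0 : quad := (0, 0, 0, 0).

Definition agree t o (o' : seq bool) a b :=
  all (fun x => [|| nth 0 (rp t o) x == nth 0 (rp t o) a,
    nth 0 (rp t o) x == nth 0 (rp t o) b | lab o x == lab o' x]) (iota 0 18).

(* The coefficient of o' in the image of o under the change of smoothing at the
   crossing k; k = 8 is the saddle from the vertical to the horizontal one. *)
Definition surgery k t o o' : bool :=
  let q := nth quad0 kan_quads k in
  let a := q.1.1.1 in let b := q.1.2 in
  [&& ~~ nth false (take 8 o) k,
      take 8 o' == take 8 (set_nth false (take 8 o) k true),
      agree t o o' a b
    & if nth 0 (rp t o) a == nth 0 (rp t o) b
      then comult_coef (lab o a) (lab o' a) (lab o' b)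
      else mult_coef (lab o a) (lab o b) (lab o' a)].

Definition lowered x o o' : bool :=
  [&& take 8 o' == take 8 o, lab o x, ~~ lab o' x & agree true o o' x x].

End States.

Local Open Scope ring_scope.

Definition state_grading (t : bool) : grading state := fun o i j =>
  [&& valid t o, i == (state_weight t o)%:Z &
      j == (outer_circles t o true)%:Z - (outer_circles t o false)%:Z
           + (state_weight t o)%:Z].

Definition state_diff (t : bool) (o o' : state) : rat :=
  (valid t o && valid t o')%:R *
  \sum_(k < 8) (-1) ^+ count id (take k o) * (surgery k t o o')%:R.

Definition saddle (o o' : state) : rat :=
  [&& valid false o, valid true o' & surgery 8 false o o']%:R.

(** Multiplication by X on the circle through the edge [x]. *)
Definition dot (x : nat) (o o' : state) : rat :=
  [&& valid true o, valid true o' & lowered x o o']%:R.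

(** * The diagrams of K(-m, 0) *)

Local Close Scope ring_scope.

Section DiagramLists.
Variable D : diagram.
Local Notation n := (ncross D).

Definition bits (s : resolution D) : seq bool := [seq s k | k <- enum 'I_n].

Lemma size_bits s : size (bits s) = n.
Proof. by rewrite size_map size_enum_ord. Qed.

Lemma nth_bits s (k : 'I_n) : nth false (bits s) k = s k.
Proof. by rewrite (nth_map k) ?size_enum_ord ?ltn_ord // nth_ord_enum. Qed.

Lemma bits_inj : injective bits.
Proof. by move=> s t st; apply/ffunP=> k; rewrite -!nth_bits st. Qed.

Lemma bits_surj (l : seq bool) : size l = n ->
  bits [ffun k => nth false l (nat_of_ord k)] = l.
Proof.
move=> sl; apply: (@eq_from_nth _ false); rewrite size_bits // => k hk.
by rewrite -[k]/(nat_of_ord (Ordinal hk)) nth_bits ffunE.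
Qed.

Lemma card_take_bits (s : resolution D) (k : nat) :
  #|[pred l : 'I_n | (l < k)%N && s l]| = count id (take k (bits s)).
Proof.
rewrite -sum1_card big_mkcond /= -sum1_count.
rewrite (eq_bigl (fun b => id b)) // [RHS]big_mkcond /=.
rewrite (big_nth false) size_take size_bits.
have -> : (if k < n then k else n) = minn k n by [].
rewrite [LHS](eq_bigr (fun l : 'I_n => if (l < k) && nth false (bits s) l then 1 else 0));
  last by move=> l _; rewrite inE nth_bits.
rewrite -(big_mkord xpredT (fun l => if (l < k) && nth false (bits s) l then 1 else 0)).
rewrite (big_cat_nat (n := minn k n)) ?geq_minr //= [X in _ + X = _]big_nat_cond.
rewrite [X in _ + X = _]big1 ?addn0 => [|l /andP[/andP[h1 h2] _]]; last first.
  by move: h1; rewrite geq_min leqNgt [n <= l]leqNgt h2 orbF => /negPf ->.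
rewrite !big_nat; apply: eq_bigr => l /andP[_]; rewrite leq_min => /andP[hl _].
by rewrite hl nth_take.
Qed.

Lemma weight_bits (s : resolution D) : weight s = count id (bits s).
Proof.
have := card_take_bits s n; rewrite take_oversize ?size_bits // => <-.
by apply: eq_card => k; rewrite !inE ltn_ord.
Qed.

Lemma card_xing (P : pred (crossing (edge D))) :
  #|[pred k | P (@xing D k)]| = count P (crossings D).
Proof.
rewrite -sum1_card -sum1_count (big_tnth _ _ (crossings D)).
by apply: eq_bigl => k; rewrite inE.
Qed.

End DiagramLists.

Section Kanenobu0.
Variable m : nat.

Definition kan : diagram := Diagram (@kan_crossings m 0 false false).

Local Notation E := (edge kan).
Local Notation col := (@col_bc m 0).

(** Not injective for m = 0, where bottom and top of the twist region coincide. This is consistent,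
    because the filling is then vertical and identifies 12 with 14 and 13 with 15. *)
Definition outer (x : nat) : E :=
  nth (ca_at_a m 0)
    [:: inner m 0 false 0; inner m 0 false 1; inner m 0 false 2; inner m 0 false 3;
        inner m 0 false 4; inner m 0 true 0; inner m 0 true 1; inner m 0 true 2;
        inner m 0 true 3; inner m 0 true 4; ca_at_a m 0; ca_at_c m 0;
        col false 0; col true 0; col false m; col true m;
        col_ab m 0 false 0; col_ab m 0 true 0] x.

Lemma size_crossings : ncross kan = 8 + m.
Proof. by rewrite /ncross /= !size_cat size_map size_iota addn0. Qed.

Definition ends (x : crossing E) := (c0 x, c1 x, c2 x, c3 x).

Definition ends_of (t : quad) := (outer t.1.1.1, outer t.1.1.2, outer t.1.2, outer t.2).

Lemma ends_xing_outer (k : 'I_(ncross kan)) : k < 8 ->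
  ends (xing k) = ends_of (nth quad0 kan_quads k).
Proof.
rewrite /xing /tnth; set x0 := tnth_default _ _; move: x0.
by case: k => [[|[|[|[|[|[|[|[|k]]]]]]]] hk] x0 //= _.
Qed.

Lemma ends_xing_twist (k : 'I_(ncross kan)) j : k = 8 + j :> nat ->
  ends (xing k) = (col true j, col true j.+1, col false j.+1, col false j).
Proof.
move=> kj; rewrite /xing /tnth kj; set x0 := tnth_default _ _ => /=.
have hj : j < m by have := leq_trans (ltn_ord k) (eq_leq size_crossings); lia.
rewrite nth_cat size_map size_iota hj (nth_map 0) ?size_iota // nth_iota //.
Qed.

(** A crossing of the left half and its mirror image have opposite signs whatever the parity of m,
    so the outer crossings contribute four of each sign. *)
Lemma n_minus_kan : n_minus kan = 4 + m.
Proof.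
rewrite /n_minus (card_xing (fun x => ~~ positive x)) /= !count_cat /= /positive /=.
rewrite /fwd_bdc /fwd_ba /= count_map (eq_count (a2 := predT)) => [|k]; last first.
  by rewrite /= addbb.
by rewrite count_predT size_iota; case: (odd _) => /=; lia.
Qed.

Lemma n_plus_kan : n_plus kan = 4.
Proof.
rewrite /n_plus (card_xing (fun x => positive x)) /= !count_cat /= /positive /=.
rewrite /fwd_bdc /fwd_ba /= count_map (eq_count (a2 := pred0)) => [|k]; last first.
  by rewrite /= addbb.
by rewrite count_pred0; case: (odd _) => /=; lia.
Qed.

Lemma joinedP (s : resolution kan) e f :
  reflect (exists k, joined_at (xing k) (s k) e f) (joined s e f).
Proof. exact: existsP. Qed.

End Kanenobu0.

(* The number of the circle of a resolution through the edge at height k of the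
   twist region: small circles get the numbers 18, 19, ... from bottom to top. *)
Definition col_circle (tb : seq bool) (r : seq nat) (h : bool) (k : nat) : nat :=
  let n1 := count id (take k tb) in
  if n1 == 0 then nth 0 r (12 + h)
  else if count id (drop k tb) == 0 then nth 0 r (14 + h)
  else 17 + n1.

Section Circles.
Variable m : nat.
Local Notation D := (kan m).
Local Notation E := (edge D).
Local Notation col := (@col_bc m 0).

Definition circle (tb : seq bool) (r : seq nat) (e : E) : nat :=
  match e with
  | inl (inl (inl (h, k))) => nth 0 r (if h then 5 + k else k)
  | inl (inl (inr b)) => nth 0 r (10 + b)
  | inl (inr (h, k)) => col_circle tb r h k
  | inr (h, _) => nth 0 r (16 + h)
  end.

Lemma circle_col tb r h k : k <= m -> circle tb r (col h k) = col_circle tb r h k.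
Proof. by move=> km; rewrite /= inordK. Qed.

Lemma edge_cases (P : E -> Prop) :
  (forall x, x < 18 -> P (outer m x)) -> (forall h k, k <= m -> P (col h k)) ->
  forall e, P e.
Proof.
move=> Po Pc [[[[h k]|b]|[h k]]|[h k]].
- have <- : inner m 0 h k = inl (inl (inl (h, k))) by rewrite /inner inord_val.
  case: h; case: k => -[|[|[|[|[|k]]]]] // hk.
  + exact: (Po 5). + exact: (Po 6). + exact: (Po 7). + exact: (Po 8).
  + exact: (Po 9). + exact: (Po 0). + exact: (Po 1). + exact: (Po 2).
  + exact: (Po 3). + exact: (Po 4).
- case: b; [exact: (Po 11)|exact: (Po 10)].
- have <- : col h k = inl (inr (h, k)) by rewrite /col_bc inord_val.
  by apply: Pc; rewrite -ltnS.
- have <- : col_ab m 0 h 0 = inr (h, k) by rewrite /col_ab [k]ord1; congr (inr (_, _));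
  apply/val_inj; rewrite /= inordK.
  case: h; [exact: (Po 17)|exact: (Po 16)].
Qed.

Variable s : resolution D.

Definition outer_bits := take 8 (bits s).
Definition twist_bits := drop 8 (bits s).
Local Notation tb := twist_bits.
(** One horizontal smoothing suffices to make the twist region act on the outer edges like the
    horizontal filling; the others only add small circles. *)
Definition cut := has id tb.
Definition reps_of := reps (rcons outer_bits cut).
Local Notation r := reps_of.

Lemma size_tb : size tb = m.
Proof. by rewrite size_drop size_bits size_crossings addKn. Qed.

Lemma size_ob : size outer_bits = 8.
Proof. by rewrite size_takel // size_bits size_crossings. Qed.

Lemma nth_tb j (k : 'I_(ncross D)) : k = 8 + j :> nat -> nth false tb j = s k.
Proof. by move=> kj; rewrite nth_drop -kj nth_bits. Qed.

Lemma nth_ob (k : 'I_(ncross D)) : k < 8 -> nth false outer_bits k = s k.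
Proof. by move=> kj; rewrite nth_take // nth_bits. Qed.

Lemma count_tb : (count id tb == 0) = ~~ cut.
Proof. by rewrite /cut has_count -eqn0Ngt. Qed.

Let kan_quadsE : kan_quads = rcons (take 8 kan_quads) (13, 15, 14, 12). Proof. by []. Qed.

Lemma joins_mem p : p \in joins (rcons outer_bits cut) <->
  (exists2 k, k < 8 & p \in quad_pairs (nth false outer_bits k) (nth quad0 kan_quads k))
  \/ p \in quad_pairs cut (13, 15, 14, 12).
Proof.
rewrite /joins kan_quadsE zip_rcons ?size_ob // map_rcons flatten_rcons mem_cat orbC.
split=> [/orP[|/flattenP[_ /mapP[[b t] bt ->]]] pt|]; first by right.
  case/(nthP (false, quad0)): bt => k; rewrite size_zip size_ob minnn => k8.
  rewrite nth_zip ?size_ob // => -[eb et]; left; exists k => //.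
  by rewrite -kan_quadsE eb -[nth quad0 kan_quads k](@nth_take 8) // et.
case=> [[k k8]|->//]; rewrite -kan_quadsE => pk; apply/orP; right.
apply/flattenP; exists (quad_pairs (nth false outer_bits k) (nth quad0 kan_quads k)) => //.
rewrite -[nth quad0 kan_quads k](@nth_take 8) //.
apply: (map_f (fun p => quad_pairs p.1 p.2) (x := (_, _))).
by rewrite -nth_zip ?size_ob // mem_nth // size_zip size_ob.
Qed.

Lemma reps_cut : if cut then nth 0 r 12 = nth 0 r 13 /\ nth 0 r 14 = nth 0 r 15
  else nth 0 r 12 = nth 0 r 14 /\ nth 0 r 13 = nth 0 r 15.
Proof.
have eqr p : p \in quad_pairs cut (13, 15, 14, 12) -> nth 0 r p.1 = nth 0 r p.2.
  by move=> pc; apply/reps_joins/joins_mem; right.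
case: (cut) eqr => eqr; split.
- by rewrite -(eqr (12, 13)) //.
- by rewrite (eqr (15, 14)).
- by rewrite -(eqr (14, 12)).
- by rewrite (eqr (13, 15)).
Qed.

Lemma circle_outer x : x < 18 -> circle tb r (outer m x) = nth 0 r x.
Proof.
have cz : count id tb = 0 -> nth 0 r 12 = nth 0 r 14 /\ nth 0 r 13 = nth 0 r 15.
  by move=> c0; have := reps_cut; rewrite -[cut]negbK -count_tb c0.
case: x => [|[|[|[|[|[|[|[|[|[|[|[|[|[|[|[|[|[|x]]]]]]]]]]]]]]]]]] // _;
  rewrite /outer [nth _ _ _]/= ?circle_col ?leqnn //;
  try by rewrite /= ?inordK.
- by rewrite /col_circle take0.
- by rewrite /col_circle take0.
- by rewrite /col_circle -size_tb take_size drop_size; case: eqP => // /cz[].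
- by rewrite /col_circle -size_tb take_size drop_size; case: eqP => // /cz[].
Qed.

Lemma tb_split j : j < m ->
  (count id (take j.+1 tb) = count id (take j tb) + nth false tb j) /\
  (count id (drop j tb) = nth false tb j + count id (drop j.+1 tb)).
Proof.
move=> jm; rewrite (take_nth false) ?size_tb // -cats1 count_cat /= addn0.
by rewrite (drop_nth false) ?size_tb.
Qed.

Lemma circle_twist j : j < m ->
  if nth false tb j then
    (forall h, col_circle tb r h j = col_circle tb r false j) /\
    (forall h, col_circle tb r h j.+1 = col_circle tb r false j.+1)
  else forall h, col_circle tb r h j.+1 = col_circle tb r h j.
Proof.
move=> jm; have [tj dj] := tb_split jm; rewrite /col_circle.
case: ifP => tbj; last by move=> h; rewrite tj dj tbj addn0.
have ct : cut by apply/(has_nthP false); exists j; rewrite ?size_tb.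
have := reps_cut; rewrite ct => -[e12 e14].
split=> -[] //; first by rewrite dj tbj; case: eqP.
by rewrite tj tbj addn1 /=; case: eqP.
Qed.

Lemma circle_joined e f : joined s e f -> circle tb r e = circle tb r f.
Proof.
case/joinedP=> k; have [k8|k8] := ltnP k 8.
  have := ends_xing_outer k8; rewrite /ends /ends_of /joined_at /smoothing -nth_ob //.
  have lt4 : let t := nth quad0 kan_quads k in
      [&& t.1.1.1 < 18, t.1.1.2 < 18, t.1.2 < 18 & t.2 < 18].
    by case: (nat_of_ord k) k8 => [|[|[|[|[|[|[|[|]]]]]]]].
  have eqr p : p \in quad_pairs (nth false outer_bits k) (nth quad0 kan_quads k) ->
      nth 0 r p.1 = nth 0 r p.2.
    by move=> pc; apply/reps_joins/joins_mem; left; exists (nat_of_ord k).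
  case: (nth quad0 kan_quads k) lt4 eqr => [[[x0 x1] x2] x3] /= /and4P[h0 h1 h2 h3] eqr.
  case=> -> -> -> ->; case: (nth false _ _) eqr => eqr;
    rewrite !inE -!orbA => /or4P[] /eqP[-> ->]; rewrite !circle_outer //;
    by [apply: (eqr (_, _)); rewrite !inE eqxx ?orbT
      |symmetry; apply: (eqr (_, _)); rewrite !inE eqxx ?orbT].
have kj : k = 8 + (k - 8) :> nat by rewrite subnKC.
have jm : k - 8 < m by have := leq_trans (ltn_ord k) (eq_leq (size_crossings m)); lia.
have := ends_xing_twist kj; rewrite /ends /joined_at /smoothing -(nth_tb kj).
case=> -> -> -> ->; have := circle_twist jm.
case: (nth false tb _) => [[e1 e2]|e1];
  rewrite !inE -!orbA => /or4P[] /eqP[-> ->]; rewrite !circle_col ?(ltnW jm) //;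
  by rewrite ?e1 ?e2.
Qed.

Local Notation conn := (connect (joined s)).

Let conn_sym : connect_sym (joined s).
Proof.
apply: sym_connect_sym => e f.
by apply: eq_existsb => k; rewrite /joined_at orbC.
Qed.

Lemma conn_twist j : j < m ->
  if nth false tb j then conn (col false j) (col true j) /\
    conn (col false j.+1) (col true j.+1)
  else forall h, conn (col h j) (col h j.+1).
Proof.
move=> jm; have hk : 8 + j < ncross D by rewrite size_crossings ltn_add2l.
pose k := Ordinal hk; have kj : k = 8 + j :> nat by [].
have := ends_xing_twist kj; rewrite (nth_tb kj) => -[e0 e1 e2 e3].
have jk e f : joined_at (xing k) (s k) e f -> conn e f.
  by move=> ef; apply/connect1/joinedP; exists k.
case: (s k) jk => jk.
  by split; apply: jk; rewrite /joined_at /= !inE e0 e1 e2 e3 eqxx ?orbT.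
by case; apply: jk; rewrite /joined_at /= !inE e0 e1 e2 e3 eqxx ?orbT.
Qed.

Lemma conn_vertical h j k : j <= k -> k <= m ->
  count id (take j tb) = count id (take k tb) -> conn (col h j) (col h k).
Proof.
elim: k => [|k IHk]; first by rewrite leqn0 => /eqP ->.
rewrite leq_eqVlt => /predU1P[->//|jk] km ck; have [tk _] := tb_split km.
have mono : count id (take j tb) <= count id (take k tb).
  by rewrite -(cat_take_drop j (take k tb)) take_takel // count_cat leq_addr.
have /connect_trans -> // : conn (col h j) (col h k) by apply: IHk; lia.
by have := conn_twist km; case: (nth _ _ _) tk ck mono => [|_ _ _]; [lia|apply].
Qed.

Lemma conn_horizontal k : k <= m -> count id (take k tb) != 0 ->
  conn (col false k) (col true k).
Proof.
elim: k => [|k IHk] km; first by rewrite take0.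
have [tk _] := tb_split km; rewrite tk; have := conn_twist km.
case: (nth _ _ _) => [[]//|v]; rewrite addn0 => ck.
apply: connect_trans (v true); apply: connect_trans (IHk (ltnW km) ck).
by rewrite conn_sym.
Qed.

Lemma conn_reps x : x < 18 -> conn (outer m x) (outer m (nth 0 r x)).
Proof.
apply: (@reps_rel (fun u v => conn (outer m u) (outer m v))) => //.
- by move=> u v w; apply: connect_trans.
- by move=> u v; rewrite conn_sym.
move=> p /joins_mem[[k k8]|].
  have hk : k < ncross D by rewrite size_crossings (leq_trans k8) // leq_addr.
  have := @ends_xing_outer m (Ordinal hk) k8; rewrite /ends /ends_of /=.
  have jk e f : joined_at (xing (Ordinal hk)) (s (Ordinal hk)) e f -> conn e f.
    by move=> ef; apply/connect1/joinedP; exists (Ordinal hk).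
  rewrite -(nth_ob (k := Ordinal hk)) // in jk.
  case: (nth quad0 kan_quads k) => [[[x0 x1] x2] x3] /= [e0 e1 e2 e3].
  case: (nth false _ _) jk => jk /=; rewrite !inE => /orP[] /eqP ->; apply: jk;
    by rewrite /joined_at /= !inE ?e0 ?e1 ?e2 ?e3 eqxx ?orbT.
have [ct|/negbTE ct] := boolP cut; rewrite /= !inE /=.
  have ctb : count id tb != 0 by rewrite count_tb ct.
  have c14 : conn (col false m) (col true m).
    by apply: conn_horizontal; rewrite // take_oversize ?size_tb.
  (* The lowest horizontal smoothing joins the two columns, and below it both columns are
     uninterrupted. *)
  have c12 : conn (col false 0) (col true 0).
    have hj : find id tb < m by rewrite -size_tb -has_find.
    have cj : count id (take 0 tb) = count id (take (find id tb) tb).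
      rewrite take0; apply/esym/eqP; rewrite -leqn0 leqNgt -has_count.
      by rewrite has_take_leq ?ltnn ?size_tb 1?ltnW.
    have v h := conn_vertical h (leq0n _) (ltnW hj) cj.
    have := conn_twist hj; rewrite (nth_find false ct : nth _ _ _ = true) => -[c _].
    apply: connect_trans (v false) _; apply: connect_trans c _.
    by rewrite conn_sym.
  by case/orP => /eqP -> /=; [rewrite conn_sym|].
have v h : conn (col h 0) (col h m).
  apply: conn_vertical => //; rewrite take0 take_oversize ?size_tb //.
  by apply/esym/eqP; rewrite count_tb ct.
by case/orP => /eqP -> /=; rewrite ?v // conn_sym v.
Qed.

(** Every edge is connected either to an outer edge or to a left edge of a small circle. The numbers
    of the former are below 18, those of the latter are not, and within each kind the number
    determines the circle. *)
Lemma conn_circle e f : circle tb r e = circle tb r f -> conn e f.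
Proof.
have canon e' : (exists2 x, x < 18 & conn e' (outer m x) /\ circle tb r e' = nth 0 r x) \/
    (exists2 k, k <= m & [/\ conn e' (col false k), count id (take k tb) != 0 &
       circle tb r e' = 17 + count id (take k tb)]).
  move: e'; apply: edge_cases => [x x18|h k km].
    by left; exists x => //; rewrite circle_outer.
  rewrite circle_col // /col_circle; have [t0|t0] := eqVneq (count id (take k tb)) 0.
    left; exists (12 + h); first by case: (h).
    split=> //; rewrite conn_sym; have <- : col h 0 = outer m (12 + h) by case: (h).
    by apply: conn_vertical; rewrite // take0 t0.
  have [d0|d0] := eqVneq (count id (drop k tb)) 0.
    left; exists (14 + h); first by case: (h).
    split=> //; have <- : col h m = outer m (14 + h) by case: (h).
    apply: conn_vertical; rewrite // [in RHS]take_oversize ?size_tb //.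
    by rewrite -[in RHS](cat_take_drop k tb) count_cat d0 addn0.
  right; exists k => //; split=> //; case: (h) => //.
  by rewrite conn_sym conn_horizontal.
case: (canon e) => [[x hx [cx ex]]|[k hk [ck nk ek]]];
  case: (canon f) => [[y hy [cy ey]]|[l hl [cl nl el]]]; rewrite ?ex ?ek ?ey ?el => eq.
- apply: connect_trans cx _; rewrite conn_sym; apply: connect_trans cy _.
  apply: connect_trans (conn_reps hy) _; rewrite -eq conn_sym.
  exact: conn_reps.
- by have := reps_lt (rcons outer_bits cut) hx; rewrite -/r eq; lia.
- by have := reps_lt (rcons outer_bits cut) hy; rewrite -/r -eq; lia.
apply: connect_trans ck _; rewrite conn_sym; apply: connect_trans cl _.
have := leq_total k l; have {eq}: count id (take k tb) = count id (take l tb) by lia.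
move=> eq /orP[] kl; [rewrite conn_sym|]; exact: conn_vertical.
Qed.

Lemma same_circleE e f : same_circle s e f = (circle tb r e == circle tb r f).
Proof.
apply/idP/eqP; last exact: conn_circle.
exact: (connect_invariant circle_joined).
Qed.

End Circles.

(** * Generators as words *)

Local Open Scope ring_scope.

Section Words.
Variables (L : finType) (g0 g1 : grading L) (d0 d1 sigma xa xb : L -> L -> rat).

Let sum_recl n (F : nat -> rat) :
  \sum_(j < n.+1) F j = F 0%N + \sum_(j < n) F j.+1.
Proof. by rewrite big_ord_recl; congr (_ + _); apply: eq_bigr => j _; rewrite lift0. Qed.

(* tb lists the bits of the twist crossings and sm the labels of the small circles,
   from bottom to top. *)
Fixpoint curl_word n (tb sm : seq bool) (o : L) : curl L n :=
  match n return curl L n with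
  | 0 => o
  | n'.+1 =>
      if head false tb then
        let w := curl_word n' (behead tb) (behead sm) o in
        if head false sm then inr (inr w) else inr (inl w)
      else inl (curl_word n' (behead tb) sm o)
  end.

Fixpoint make_word m (tb sm : seq bool) (o : L) : twist_word L m :=
  match m return twist_word L m with
  | 0 => o
  | m'.+1 =>
      if head false tb then inr (curl_word m' (behead tb) sm o)
      else inl (make_word m' (behead tb) sm o)
  end.

Local Notation cnt := (count id).

Lemma curl_word_inj n tb sm o tb' sm' o' :
    size tb = n -> size tb' = n -> size sm = cnt tb -> size sm' = cnt tb' ->
  (curl_word n tb sm o == curl_word n tb' sm' o') = [&& tb == tb', sm == sm' & o == o'].
Proof.
elim: n tb sm tb' sm' => [|n IHn] [|c tb] sm [|c' tb'] sm' //=.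
  by move=> _ _ /size0nil -> /size0nil ->.
move=> [st] [st']; rewrite eqseq_cons; case: c; case: c'; rewrite ?add0n ?add1n.
- case: sm sm' => [|x sm] [|x' sm'] //= [ss] [ss'].
  by rewrite eqseq_cons -(andbA (x == x')); case: x; case: x';
    rewrite ?andbF // -(IHn tb sm tb' sm').
- by case: sm => [|[] sm].
- by case: sm' => [|[] sm'].
by move=> ss ss'; rewrite -(IHn tb sm tb' sm').
Qed.

Lemma make_word_inj m tb sm o tb' sm' o' :
    size tb = m -> size tb' = m -> size sm = (cnt tb).-1 -> size sm' = (cnt tb').-1 ->
  (make_word m tb sm o == make_word m tb' sm' o') = [&& tb == tb', sm == sm' & o == o'].
Proof.
elim: m tb tb' => [|m IHm] [|c tb] [|c' tb'] //=.
  by move=> _ _ /size0nil -> /size0nil ->.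
move=> [st] [st']; rewrite eqseq_cons; case: c; case: c' => //; rewrite ?add0n ?add1n /=.
  by move=> ss ss'; rewrite -(@curl_word_inj m).
by move=> ss ss'; rewrite -IHm.
Qed.

Lemma grG_word n tb sm o i j : size tb = n -> size sm = cnt tb ->
  @grG L g1 n (curl_word n tb sm o) i j = g1 o (i - (cnt tb)%:Z) (j - 2 * (cnt sm)%:Z).
Proof.
elim: n tb sm i j => [|n IHn] [|c tb] sm i j //=.
  by move=> _ /size0nil ->; rewrite mulr0 !subr0.
case=> st; case: c; rewrite ?add0n ?add1n; last exact: IHn.
case: sm => [|x sm] //= [ss].
by case: x => /=; rewrite IHn //; congr (g1 o _ _); lia.
Qed.

Lemma grC_word m tb sm o i j : size tb = m -> size sm = (cnt tb).-1 ->
  @grC L g0 g1 m (make_word m tb sm o) i j =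
  (if has id tb then g1 o (i - (cnt tb).-1%:Z) (j - 2 * (cnt sm)%:Z) else g0 o i j).
Proof.
elim: m tb => [|m IHm] [|c tb] //= [st].
case: c; rewrite ?add1n ?add0n => ss /=; first exact: grG_word.
exact: IHm.
Qed.

Lemma lowX_word n tb sm o tb' sm' o' :
    size tb = n -> size tb' = n -> size sm = cnt tb -> size sm' = cnt tb' ->
  @lowX L xb n (curl_word n tb sm o) (curl_word n tb' sm' o') =
  (tb == tb')%:R * (if cnt tb == 0%N then xb o o'
    else [&& head false sm, ~~ head true sm', behead sm == behead sm' & o == o']%:R).
Proof.
elim: n tb sm tb' sm' => [|n IHn] [|c tb] sm [|c' tb'] sm' //=.
  by rewrite mul1r.
move=> [st] [st']; rewrite eqseq_cons.
case: c; case: c'; rewrite ?add0n ?add1n /= ?mul0r.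
- case: sm sm' => [|x sm] [|x' sm'] //= [ss] [ss'].
  case: x; case: x' => /=; rewrite ?mulr0 //.
  by rewrite curl_word_inj // -natrM mulnb.
- by case: sm => [|[] sm].
- by case: sm' => [|[] sm'].
exact: IHn.
Qed.

Lemma botX_word n tb sm o tb' sm' o' :
    size tb = n -> size tb' = n -> size sm = cnt tb -> size sm' = cnt tb' ->
  @botX L xa n (curl_word n tb sm o) (curl_word n tb' sm' o') =
  ((tb == tb') && (sm == sm'))%:R * xa o o'.
Proof.
elim: n tb sm tb' sm' => [|n IHn] [|c tb] sm [|c' tb'] sm' //=.
  by move=> _ _ /size0nil -> /size0nil ->; rewrite mul1r.
move=> [st] [st']; rewrite eqseq_cons.
case: c; case: c'; rewrite ?add0n ?add1n /= ?mul0r.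
- case: sm sm' => [|x sm] [|x' sm'] //= [ss] [ss']; rewrite eqseq_cons.
  by case: x; case: x' => /=; rewrite ?andbF ?mul0r ?IHn.
- by case: sm => [|[] sm].
- by case: sm' => [|[] sm'].
exact: IHn.
Qed.

Lemma phi_word m tb sm o tb' sm' o' :
    size tb = m -> size tb' = m -> size sm = (cnt tb).-1 -> size sm' = cnt tb' ->
  @phi L sigma xa m (make_word m tb sm o) (curl_word m tb' sm' o') =
  (tb == tb')%:R * (if cnt tb == 0%N then sigma o o'
    else (sm == behead sm')%:R * (if head false sm' then xa o o' else (o == o')%:R)).
Proof.
elim: m tb tb' sm' => [|m IHm] [|c tb] [|c' tb'] sm' //=.
  by rewrite mul1r.
move=> [st] [st']; rewrite eqseq_cons.
case: c; case: c'; rewrite ?add0n ?add1n /= ?mul0r.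
- case: sm' => [|x' sm'] //= ss [ss'].
  case: x' => /=; first by rewrite botX_word // -mulnb natrM mulrA.
  by rewrite curl_word_inj // -!mulnb !natrM mulrA.
- by [].
- by case: sm' => [|[] sm'].
exact: IHm.
Qed.

(* Matrix coefficient of the flip of the j-th bit above a horizontal smoothing;
   the small circle at this height has index p. *)
Definition flip_coef (p : nat) (rest : bool) (sm sm' : seq bool) (o o' : L) : rat :=
  if rest then
    [&& take p sm == take p sm', drop p.+1 sm == drop p.+2 sm',
        comult_coef (nth false sm p) (nth false sm' p) (nth false sm' p.+1) & o == o']%:R
  else (sm == take p sm')%:R * (if nth false sm' p then xb o o' else (o == o')%:R).

Definition flips (tb tb' : seq bool) j := ~~ nth false tb j && (tb' == set_nth false tb j true).

Definition curl_flip (tb tb' sm sm' : seq bool) (o o' : L) j : rat :=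
  (-1) ^+ cnt (take j tb) * ((flips tb tb' j)%:R *
    flip_coef (cnt (take j tb)) (has id (drop j tb)) sm sm' o o').

Lemma dG_word n tb sm o tb' sm' o' :
    size tb = n -> size tb' = n -> size sm = cnt tb -> size sm' = cnt tb' ->
  @dG L d1 xb n (curl_word n tb sm o) (curl_word n tb' sm' o') =
  (-1) ^+ cnt tb * ((tb == tb') && (sm == sm'))%:R * d1 o o' +
  \sum_(j < n) curl_flip tb tb' sm sm' o o' j.
Proof.
elim: n tb sm tb' sm' => [|n IHn] [|c tb] sm [|c' tb'] sm' //=.
  by move=> _ _ /size0nil -> /size0nil ->; rewrite big_ord0 addr0 expr0 !mul1r.
move=> [st] [st']; rewrite sum_recl eqseq_cons {1}/curl_flip /= expr0 mul1r /flips /=.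
rewrite eqseq_cons.
case: c; case: c'; rewrite ?add0n ?add1n /= ?mul0r ?add0r.
- case: sm sm' => [|x sm] [|x' sm'] //= [ss] [ss']; rewrite eqseq_cons.
  have flipS (j : 'I_n) : curl_flip (true :: tb) (true :: tb') (x :: sm) (x' :: sm') o o' j.+1
      = - (x == x')%:R * curl_flip tb tb' sm sm' o o' j.
    have fc p rest : flip_coef p.+1 rest (x :: sm) (x' :: sm') o o' =
        (x == x')%:R * flip_coef p rest sm sm' o o'.
      rewrite /flip_coef /= !eqseq_cons.
      by case: rest; case: (x == x'); rewrite ?mul0r ?mul1r ?andbF.
    rewrite /curl_flip /flips /= eqseq_cons /= add1n exprS fc.
    ring.
  rewrite (eq_bigr _ (fun j _ => flipS j)) -mulr_sumr exprS mulN1r.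
  case: x {flipS}; case: x' => /=; rewrite ?oppr0 ?mul0r ?andbF ?mulr0 ?mul0r ?addr0 //;
    by rewrite IHn // mulN1r opprD !mulNr.
- move=> ss ss'; rewrite big1 => [|j _]; last first.
    by rewrite /curl_flip /flips /= eqseq_cons /= andbF mul0r mulr0.
  by rewrite mulr0 mul0r addr0; case: sm ss => [|[] sm].
- move=> ss; case: sm' => [|x' sm'] //= [ss'].
  rewrite [\sum_(j < n) _]big1 => [|j _]; last first.
    by rewrite /curl_flip /flips /= eqseq_cons /= andbF mul0r mulr0.
  rewrite mulr0 mul0r add0r addr0 [tb' == tb]eq_sym /flip_coef /= has_count.
  case: x' => /=.
    rewrite lowX_word // lt0n; have [t0|t0] := eqVneq (cnt tb) 0%N => /=.
      by move: ss; rewrite t0 => /size0nil ->; rewrite eqxx mul1r.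
    case: sm ss => [|x sm]; first by move=> /esym/eqP; rewrite (negPf t0).
    case: sm' ss' => [|x' sm'] ss' _ /=; last first.
      clear ss'; rewrite drop0 /comult_coef; congr (_ * _%:R).
      by rewrite !drop0; case: x; case: x'; rewrite ?andbF.
    case: eqP => [tt|_]; rewrite ?mul0r //.
    by move: t0; rewrite tt -ss'.
  rewrite curl_word_inj // lt0n; have [t0|t0] := eqVneq (cnt tb) 0%N => /=.
    move: ss; rewrite t0 => /size0nil ->; rewrite -!mulnb !natrM.
    case: eqP => [tt|_]; rewrite ?mul0r //; rewrite eq_sym.
    by move: ss'; rewrite -tt t0 => /size0nil ->; rewrite eqxx.
  case: sm ss => [|x sm]; first by move=> /esym/eqP; rewrite (negPf t0).
  case: sm' ss' => [|x' sm'] ss' _ /=.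
    case: eqP => [tt|_]; rewrite ?mul0r //.
    by move: t0; rewrite tt -ss'.
  clear ss'; rewrite !drop0 eqseq_cons -mulnb natrM; congr (_ * _%:R).
  by rewrite /comult_coef; case: x; case: x'; rewrite ?andbF.
move=> ss ss'; rewrite IHn // add0r; congr (_ + _); apply: eq_bigr => j _.
Qed.

(** Three cases: above another horizontal smoothing the flip acts as in a curl; below the lowest one
    it cuts the bottom arc; in a region without any it is the saddle of the outer tangle. *)
Definition twist_flip (tb tb' sm sm' : seq bool) (o o' : L) j : rat :=
  let p := cnt (take j tb) in let rest := has id (drop j tb) in
  (-1) ^+ p * ((flips tb tb' j)%:R *
    (if p is p'.+1 then flip_coef p' rest sm sm' o o'
     else if rest then (sm == behead sm')%:R *
       (if head false sm' then xa o o' else (o == o')%:R)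
     else sigma o o')).

(** The minus signs of the nested cones add up to the usual signs of a cube in which the twist
    crossings, from bottom to top, precede the outer ones. *)
Lemma dC_word m tb sm o tb' sm' o' :
    size tb = m -> size tb' = m -> size sm = (cnt tb).-1 -> size sm' = (cnt tb').-1 ->
  @dC L d0 d1 sigma xa xb m (make_word m tb sm o) (make_word m tb' sm' o') =
  (-1) ^+ cnt tb * ((tb == tb') && (sm == sm'))%:R * (if has id tb then d1 o o' else d0 o o') +
  \sum_(j < m) twist_flip tb tb' sm sm' o o' j.
Proof.
elim: m tb tb' => [|m IHm] [|c tb] [|c' tb'] //=.
  by move=> _ _ /size0nil -> /size0nil ->; rewrite big_ord0 addr0 expr0 !mul1r.
move=> [st] [st']; rewrite sum_recl eqseq_cons {1}/twist_flip /= expr0 mul1r /flips /=.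
rewrite eqseq_cons; case: c; case: c'; rewrite ?add0n ?add1n /= ?mul0r ?add0r => ss ss'.
- rewrite dG_word // opprD exprS mulN1r !mulNr; congr (_ + _).
  rewrite -sumrN; apply: eq_bigr => j _.
  rewrite /twist_flip /curl_flip /flips /= eqseq_cons /= add1n.
  by rewrite exprS mulN1r mulNr.
- rewrite mulr0 mul0r add0r big1 // => j _.
  by rewrite /twist_flip /flips /= eqseq_cons /= andbF mul0r mulr0.
- rewrite mulr0 mul0r add0r big1 ?addr0 => [|j _]; last first.
    by rewrite /twist_flip /flips /= eqseq_cons /= andbF mul0r mulr0.
  by rewrite phi_word // [tb' == tb]eq_sym has_count lt0n; case: (cnt tb == 0%N).
rewrite IHm //; congr (_ + _); apply: eq_bigr => j _.
Qed.

End Words.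

Local Close Scope ring_scope.

Local Notation cnt := (count id).

Lemma nth_mask_count tb ls l : size ls = size tb -> nth false tb l ->
  nth false (mask tb ls) (cnt (take l tb)) = nth false ls l.
Proof.
elim: tb ls l => [|c tb IHtb] [|x ls] [|l] //=; first by case: c.
by case=> ss tl; case: c; rewrite /= ?add1n ?add0n IHtb.
Qed.

Lemma count_take_ex (tb : seq bool) n : n < cnt tb ->
  exists l, [/\ l < size tb, nth false tb l & cnt (take l tb) = n].
Proof.
elim: tb n => [|c tb IHtb] n //=; case: c; rewrite ?add1n ?add0n.
  case: n => [|n]; first by exists 0.
  rewrite ltnS => /IHtb[l [h1 h2 h3]]; exists l.+1; split=> //=.
  by rewrite add1n h3.
by case/IHtb=> l [h1 h2 h3]; exists l.+1; split.
Qed.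

Lemma count_take_le (tb : seq bool) j k : j <= k -> cnt (take j tb) <= cnt (take k tb).
Proof.
by move=> jk; rewrite -(cat_take_drop j (take k tb)) take_takel // count_cat leq_addr.
Qed.

Lemma count_take_drop (tb : seq bool) j : cnt (take j tb) + cnt (drop j tb) = cnt tb.
Proof. by rewrite -count_cat cat_take_drop. Qed.

Lemma count_take_set (tb : seq bool) j k : j < size tb -> nth false tb j = false ->
  cnt (take k (set_nth false tb j true)) = cnt (take k tb) + (j < k).
Proof.
elim: tb j k => [|c tb IHtb] [|j] [|k] //=; first by move=> _ ->; rewrite addnC.
by move=> hj tj; rewrite IHtb // addnA.
Qed.

Lemma count_drop_set (tb : seq bool) j k : j < size tb -> nth false tb j = false ->
  cnt (drop k (set_nth false tb j true)) = cnt (drop k tb) + (k <= j).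
Proof.
elim: tb j k => [|c tb IHtb] [|j] [|k] //=.
- by move=> _ ->; rewrite addnC.
- by rewrite addn0.
- by move=> hj tj; have := IHtb j 0 hj tj; rewrite !drop0 leq0n => ->; rewrite addnA.
by move=> hj tj; rewrite IHtb.
Qed.

(** * The word of a labelled resolution *)

Section Labels.
Variable m : nat.
Local Notation D := (kan m).
Local Notation col := (@col_bc m 0).
Local Notation outer := (outer m).

Section OneGenerator.
Variable S : labelled D.
Hypothesis genS : is_gen S.

Local Notation s := S.1.
Local Notation tb := (twist_bits s).

Definition state_seq : seq bool := outer_bits s ++ [seq S.2 (outer x) | x <- iota 0 18].

Lemma size_state_seq : size state_seq == 26.
Proof. by rewrite size_cat size_ob size_map size_iota. Qed.

Definition state_of : state := Tuple size_state_seq.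

(** A small circle lies between two consecutive horizontal smoothings, and its label is read just
    below the upper one. The edge below the lowest horizontal smoothing belongs to an outer circle,
    whence [behead]. *)
Definition small_labels : seq bool :=
  behead (mask tb [seq S.2 (col false k) | k <- iota 0 m]).

Lemma take_state : take 8 state_of = outer_bits s.
Proof. by rewrite take_size_cat ?size_ob. Qed.

Lemma lab_state x : x < 18 -> lab state_of x = S.2 (outer x).
Proof.
move=> hx; rewrite /lab nth_cat size_ob ltnNge leq_addr addKn.
by rewrite (nth_map 0) ?size_iota // nth_iota.
Qed.

Lemma rp_state : rp (cut s) state_of = reps_of s.
Proof. by rewrite /rp take_state. Qed.

Lemma size_small : size small_labels = (cnt tb).-1.
Proof. by rewrite size_behead size_mask // size_map size_iota size_tb. Qed.

Lemma label_circle e f : circle tb (reps_of s) e = circle tb (reps_of s) f -> S.2 e = S.2 f.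
Proof.
move=> ef; have /forallP/(_ e)/forallP/(_ f)/implyP := genS.
by rewrite same_circleE ef eqxx => /(_ isT)/eqP.
Qed.

Lemma lab_rep x : x < 18 -> lab state_of (nth 0 (reps_of s) x) = lab state_of x.
Proof.
move=> hx; have hr := reps_lt (rcons (outer_bits s) (cut s)) hx.
rewrite !lab_state //; apply: label_circle; rewrite !circle_outer //.
exact: reps_idem.
Qed.

Lemma lab_eq_rep x y : x < 18 -> y < 18 ->
  nth 0 (reps_of s) x = nth 0 (reps_of s) y -> lab state_of x = lab state_of y.
Proof. by move=> hx hy xy; rewrite -lab_rep // xy lab_rep. Qed.

Lemma valid_state : valid (cut s) state_of.
Proof.
rewrite /valid size_tuple eqxx; apply/allP=> x; rewrite mem_iota => /andP[_ hx].
by rewrite rp_state lab_rep.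
Qed.

Lemma label_col h k : k <= m ->
  S.2 (col h k) = if cnt (take k tb) == 0 then lab state_of (12 + h)
    else if cnt (drop k tb) == 0 then lab state_of (14 + h)
    else nth false small_labels (cnt (take k tb)).-1.
Proof.
move=> km; case: ifPn => t0.
  rewrite lab_state; last by case: (h).
  apply: label_circle; rewrite circle_col // circle_outer; last by case: (h).
  by rewrite /col_circle t0.
case: ifPn => d0.
  rewrite lab_state; last by case: (h).
  apply: label_circle; rewrite circle_col // circle_outer; last by case: (h).
  by rewrite /col_circle (negPf t0) d0.
(* The first horizontally smoothed crossing at or above height [k]: the place where the label of
   this small circle is sampled. *)
pose l := k + find id (drop k tb).
have fd : find id (drop k tb) < size (drop k tb) by rewrite -has_find has_count lt0n.
have lm : l < m by rewrite size_drop size_tb in fd; rewrite /l; lia.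
have tl : nth false tb l.
  by rewrite /l -nth_drop; apply: (@nth_find _ false id); rewrite has_find.
have ctl : cnt (take l tb) = cnt (take k tb).
  rewrite /l takeD count_cat; apply/eqP; rewrite -{2}[cnt (take k tb)]addn0 eqn_add2l.
  by rewrite -leqn0 leqNgt -has_count has_take_leq ?ltnn // ltnW.
have -> : S.2 (col h k) = S.2 (col false l).
  apply: label_circle; rewrite !circle_col ?(ltnW lm) // /col_circle ctl (negPf t0) (negPf d0).
  case: eqP => // dl; exfalso; move: tl; rewrite -[l]addn0 -nth_drop.
  by case: (drop l tb) dl => [|[]].
rewrite nth_behead prednK ?lt0n // -ctl nth_mask_count ?size_map ?size_iota ?size_tb //.
by rewrite (nth_map 0) ?size_iota // nth_iota.
Qed.

Lemma small_position i : i < size small_labels ->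
  exists l, [/\ l < m, nth false tb l, cnt (take l tb) = i.+1 & cnt (drop l tb) != 0].
Proof.
rewrite size_small => hi; have /count_take_ex[l] : i.+1 < cnt tb by lia.
rewrite size_tb => -[hl tl ctl]; exists l; split=> //.
rewrite -lt0n -has_count; apply/(has_nthP false); exists 0.
  by rewrite size_drop size_tb subn_gt0.
by rewrite nth_drop addn0.
Qed.

Lemma circlesE b : circles S b =
  outer_circles (cut s) state_of b + count (pred1 b) small_labels.
Proof.
pose l := [seq x <- iota 0 18 | (nth 0 (rp (cut s) state_of) x == x) && (lab state_of x == b)]
  ++ [seq 18 + i | i <- iota 0 (size small_labels) & nth false small_labels i == b].
have -> : outer_circles (cut s) state_of b + count (pred1 b) small_labels = size l.
  rewrite /l size_cat size_filter size_map size_filter; congr (_ + _).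
  by rewrite -{1}(mkseq_nth false small_labels) count_map.
apply: (n_comp_image (f := circle tb (reps_of s))).
- by move=> e f; rewrite -same_circleE.
- rewrite cat_uniq; apply/and3P; split; first exact/filter_uniq/iota_uniq.
    apply/hasPn=> _ /mapP[i _ ->]; rewrite mem_filter mem_iota.
    by rewrite [_ < _]ltnNge add0n leq_addr !andbF.
  rewrite map_inj_uniq; first exact/filter_uniq/iota_uniq.
  exact: addnI.
- apply: edge_cases => [x x18|h k km]; rewrite inE.
    rewrite circle_outer // -lab_state // => /eqP labx; rewrite /l mem_cat mem_filter.
    by rewrite rp_state reps_idem // eqxx lab_rep // labx eqxx mem_iota add0n reps_lt.
  rewrite circle_col // label_col // /col_circle; case: ifP => t0.
    have hx : 12 + h < 18 by case: (h).
    move=> /eqP labx; rewrite /l mem_cat mem_filter.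
    by rewrite rp_state reps_idem // eqxx lab_rep // labx eqxx mem_iota add0n reps_lt.
  case: ifP => d0.
    have hx : 14 + h < 18 by case: (h).
    move=> /eqP labx; rewrite /l mem_cat mem_filter.
    by rewrite rp_state reps_idem // eqxx lab_rep // labx eqxx mem_iota add0n reps_lt.
  move=> labx; rewrite /l mem_cat; apply/orP; right; apply/mapP.
  exists (cnt (take k tb)).-1; last by lia.
  rewrite mem_filter labx mem_iota size_small /=.
  move: t0 d0 (count_take_drop tb k); case: (cnt (take k tb)) => // x;
    case: (cnt (drop k tb)) => // y _ _ <-.
  by rewrite add0n addSn addnS /= ltnS leq_addr.
- move=> c; rewrite /l mem_cat mem_filter mem_iota => /orP[/and3P[/andP[/eqP rc lc] _ hc]|].
    exists (outer c); first by rewrite inE -lab_state.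
    by rewrite circle_outer // -rp_state.
  case/mapP=> i; rewrite mem_filter mem_iota => /andP[/eqP si /andP[_ hi]] ->.
  have [k [km tk ctk dk]] := small_position hi.
  exists (col false k); first by rewrite inE label_col ?(ltnW km) // ctk (negPf dk) si.
  by rewrite circle_col ?(ltnW km) // /col_circle ctk (negPf dk) addnS.
by move=> e f ef; rewrite !inE (label_circle ef).
Qed.

End OneGenerator.

Definition word_of (S : labelled D) : twist_word state m :=
  make_word m (twist_bits S.1) (small_labels S) (state_of S).

Lemma word_of_inj S T : is_gen S -> is_gen T -> word_of S = word_of T -> S = T.
Proof.
move=> gS gT /eqP; rewrite make_word_inj ?size_tb ?size_small // => /and3P[/eqP et /eqP es /eqP eo].
have e1 : S.1 = T.1.
  apply: bits_inj; rewrite -(cat_take_drop 8 (bits S.1)) -(cat_take_drop 8 (bits T.1)).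
  by rewrite -!/(outer_bits _) -!take_state eo -!/(twist_bits _) et.
have e2 : S.2 = T.2.
  apply/ffunP; apply: edge_cases => [x hx|h k hk]; first by rewrite -!lab_state // eo.
  by rewrite !label_col // et es eo.
by case: (S) (T) e1 e2 => [s1 s2] [t1 t2] /= -> ->.
Qed.

Lemma make_word_surj n (w : twist_word state n) :
  exists tb sm o, [/\ size tb = n, size sm = (cnt tb).-1 & w = make_word n tb sm o].
Proof.
have curl_surj k (v : curl state k) :
    exists tb sm o, [/\ size tb = k, size sm = cnt tb & v = curl_word k tb sm o].
  elim: k v => [|k IHk] /=; first by move=> o; exists [::], [::], o.
  case=> [v|[v|v]]; have [tb [sm [o [st ss ->]]]] := IHk v.
  - by exists (false :: tb), sm, o; rewrite /= st.
  - by exists (true :: tb), (false :: sm), o; rewrite /= st ss.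
  - by exists (true :: tb), (true :: sm), o; rewrite /= st ss.
elim: n w => [|n IHn] /=; first by move=> o; exists [::], [::], o.
case=> w; first have [tb [sm [o [st ss ->]]]] := IHn w.
  by exists (false :: tb), sm, o; rewrite /= st.
have [tb [sm [o [st ss ->]]]] := curl_surj n w.
by exists (true :: tb), sm, o; rewrite /= st.
Qed.

Lemma gen_surj tb sm (o : state) : size tb = m -> size sm = (cnt tb).-1 ->
  valid (has id tb) o ->
  exists2 S, is_gen S & [/\ twist_bits S.1 = tb, small_labels S = sm & state_of S = o].
Proof.
move=> st ss /andP[_ /allP vo].
pose s : resolution D := [ffun k => nth false (take 8 o ++ tb) (nat_of_ord k)].
have bs : bits s = take 8 o ++ tb.
  by rewrite bits_surj // size_cat size_takel ?size_tuple // st size_crossings.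
have eo : outer_bits s = take 8 o by rewrite /outer_bits bs take_size_cat // size_takel ?size_tuple.
have et : twist_bits s = tb by rewrite /twist_bits bs drop_size_cat // size_takel ?size_tuple.
(* Outer circles have numbers below 18 and small circles are numbered from 18 on, so the outer
   labels followed by the small ones form one list indexed by circle numbers. *)
pose S : labelled D := (s, [ffun e => nth false (drop 8 o ++ sm) (circle tb (reps_of s) e)]).
have gS : is_gen S.
  apply/forallP=> e; apply/forallP=> f; apply/implyP.
  by rewrite same_circleE et !ffunE => /eqP ->.
have rE : reps_of s = rp (has id tb) o by rewrite /reps_of /cut et eo.
exists S => //; have oS : state_of S = o.
  apply/val_inj; rewrite -[val (state_of S)]/(state_seq S) /state_seq eo.
  rewrite -[RHS](cat_take_drop 8); congr (_ ++ _).
  apply: (@eq_from_nth _ false) => [|x]; rewrite size_map size_iota ?size_drop ?size_tuple // => hx.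
  rewrite (nth_map 0) ?size_iota // nth_iota // ffunE -et circle_outer // nth_cat.
  rewrite size_drop size_tuple (reps_lt (rcons (outer_bits s) (cut s)) hx) nth_drop.
  have /vo/eqP : x \in iota 0 18 by rewrite mem_iota.
  by rewrite /lab -rE nth_drop => ->.
split=> //; apply: (@eq_from_nth _ false); first by rewrite size_small /= et.
move=> i hi; have [l [lm tl ctl dl]] := small_position gS hi.
have := @label_col S gS false l (ltnW lm); rewrite ctl (negPf dl) /= => <-.
rewrite -[twist_bits S.1]/(twist_bits s) et in ctl dl.
rewrite ffunE circle_col ?(ltnW lm) // /col_circle ctl (negPf dl) nth_cat.
rewrite size_drop size_tuple (_ : 26 - 8 = 18) // (_ : 17 + i.+1 = 18 + i) ?addnS //.
by rewrite ltnNge leq_addr addKn.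
Qed.

End Labels.

Lemma set_nth_cat (x y : bool) (s1 s2 : seq bool) n :
  set_nth x (s1 ++ s2) n y =
  if n < size s1 then set_nth x s1 n y ++ s2 else s1 ++ set_nth x s2 (n - size s1) y.
Proof.
elim: s1 n => [|z s1 IHs] [|n] //=.
by rewrite IHs subSS ltnS; case: ifP.
Qed.

Local Opaque state_of.
Local Opaque iota.

Lemma all_nth_eq (s s' : seq bool) : size s = size s' ->
  all (fun i => nth false s i == nth false s' i) (iota 0 (size s)) = (s == s').
Proof.
move=> ss; apply/allP/eqP => [H|-> //]; apply: (@eq_from_nth _ false) => // i hi.
by apply/eqP/H; rewrite mem_iota.
Qed.

(** Describes the splitting of the small circle [p]: the entry at [p] becomes two, and the later
    ones move up by one place. *)
Lemma all_nth_eq_except (s s' : seq bool) p : p < size s -> size s' = (size s).+1 ->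
  all (fun i => (i == p) || (nth false s i == nth false s' (i + (p < i.+1))))
    (iota 0 (size s)) = (take p s == take p s') && (drop p.+1 s == drop p.+2 s').
Proof.
move=> hp ss; apply/allP/andP => [H|[/eqP Ht /eqP Hd] i].
  split; apply/eqP/(@eq_from_nth _ false).
  - by rewrite !size_take ss hp ltnS (ltnW hp).
  - move=> i; rewrite size_take hp => hi; rewrite !nth_take //.
    have /H : i \in iota 0 (size s) by rewrite mem_iota /= (ltn_trans hi).
    by rewrite (ltn_eqF hi) ltnS leqNgt hi addn0 => /eqP.
  - by rewrite !size_drop ss subSS.
  move=> i; rewrite size_drop => hi; rewrite !nth_drop.
  have /H : p.+1 + i \in iota 0 (size s) by rewrite mem_iota /= -ltn_subRL.
  have -> : (p.+1 + i == p) = false by apply: gtn_eqF; rewrite addSn ltnS leq_addr.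
  have -> : (p < (p.+1 + i).+1) = true by rewrite addSn !ltnS -addnS leq_addr.
  by rewrite addn1 => /eqP ->.
rewrite mem_iota /= => hi; have [ip|pi|//] := ltngtP i p.
  by rewrite ltnS leqNgt ip addn0 -(nth_take false ip) Ht nth_take ?eqxx.

have -> : (p < i.+1) = true by rewrite ltnS ltnW.
by rewrite addn1 -(subnKC pi) -addSn -!nth_drop Hd eqxx.
Qed.

Lemma take_set_nth_size (s : seq bool) n : size s = n ->
  take n (set_nth false s n true) = s.
Proof. by move=> <-; elim: s => //= x s {1}->. Qed.

Lemma state_eqE (o o' : state) : take 8 o' = take 8 o ->
  (o == o') = all (fun x => lab o x == lab o' x) (iota 0 18).
Proof.
move=> t8; apply/eqP/allP => [-> //|H]; apply/val_inj.
apply: (@eq_from_nth _ false); rewrite ?size_tuple // => i hi.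
have [i8|i8] := ltnP i 8; first by rewrite -[LHS](nth_take false i8) -t8 nth_take.
rewrite -(subnKC i8); apply/eqP/H; rewrite mem_iota /= add0n.
by rewrite -(ltn_add2l 8) subnKC.
Qed.

(** * The cube differential in terms of words *)

Section Incidence.
Variable m : nat.
Local Notation D := (kan m).
Local Notation col := (@col_bc m 0).
Local Notation outer := (outer m).
Variables S T : labelled D.
Hypotheses (genS : is_gen S) (genT : is_gen T).

Local Notation tb := (twist_bits S.1).
Local Notation tb' := (twist_bits T.1).
Local Notation sm := (small_labels S).
Local Notation sm' := (small_labels T).
Local Notation o := (state_of S).
Local Notation o' := (state_of T).
Local Notation r := (reps_of S.1).

Lemma set_bits (k : 'I_(ncross D)) :
  (T.1 == [ffun l => (l == k) || S.1 l]) = (bits T.1 == set_nth false (bits S.1) k true).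
Proof.
have -> : set_nth false (bits S.1) k true = bits [ffun l => (l == k) || S.1 l].
  apply: (@eq_from_nth _ false).
    by rewrite size_set_nth !size_bits; apply/maxn_idPr/ltn_ord.
  move=> l; rewrite size_set_nth !size_bits (maxn_idPr (ltn_ord k)) => hl.
  rewrite nth_set_nth /= -[l]/(nat_of_ord (Ordinal hl)) !nth_bits ffunE.
  by rewrite -val_eqE /=; case: eqP.
by rewrite (inj_eq (@bits_inj D)).
Qed.

Lemma bits_split (s : resolution D) : bits s = outer_bits s ++ twist_bits s.
Proof. by rewrite cat_take_drop. Qed.

Lemma set_bits_outer (k : 'I_(ncross D)) : k < 8 ->
  (T.1 == [ffun l => (l == k) || S.1 l]) =
  (tb == tb') && (take 8 o' == take 8 (set_nth false (take 8 o) k true)).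
Proof.
move=> k8; rewrite set_bits !take_state !bits_split.
rewrite [take 8 (set_nth _ _ _ _)]take_oversize; last first.
  by rewrite size_set_nth size_ob geq_max k8.
have -> : set_nth false (outer_bits S.1 ++ tb) k true =
    set_nth false (outer_bits S.1) k true ++ tb.
  by rewrite set_nth_cat size_ob k8.
by rewrite eqseq_cat ?size_set_nth ?size_ob ?(maxn_idPr k8) // andbC [tb' == tb]eq_sym.
Qed.

Lemma set_bits_twist (k : 'I_(ncross D)) j : k = 8 + j :> nat ->
  (T.1 == [ffun l => (l == k) || S.1 l]) =
  (take 8 o' == take 8 o) && (tb' == set_nth false tb j true).
Proof.
move=> kj; rewrite set_bits !take_state !bits_split kj.
have -> : set_nth false (outer_bits S.1 ++ tb) (8 + j) true =
    outer_bits S.1 ++ set_nth false tb j true.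
  by rewrite set_nth_cat size_ob ltnNge leq_addr addKn.
by rewrite eqseq_cat ?size_ob.
Qed.

Lemma forall_outer a b : a < 18 -> b < 18 -> tb = tb' ->
  [forall e, [|| same_circle S.1 (outer a) e, same_circle S.1 (outer b) e | S.2 e == T.2 e]] =
  agree (cut S.1) o o' a b && (sm == sm').
Proof.
move=> ha hb tt; apply/forallP/andP => [H|[/allP Ho /eqP Hs]].
  split.
    apply/allP=> x; rewrite mem_iota => /andP[_ hx]; have := H (outer x).
    by rewrite !same_circleE !circle_outer // rp_state !lab_state // ![_ == nth 0 r x]eq_sym.
  apply/eqP/(@eq_from_nth _ false); first by rewrite !size_small tt.
  move=> i hi; have [l [lm tl ctl dl]] := small_position genS hi; have := H (col false l).
  rewrite !same_circleE !circle_outer // circle_col ?(ltnW lm) // /col_circle ctl (negPf dl) /=.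
  rewrite !label_col ?(ltnW lm) // -tt ctl (negPf dl) /=.
  have := reps_lt (rcons (outer_bits S.1) (cut S.1)) ha.
  have := reps_lt (rcons (outer_bits S.1) (cut S.1)) hb; rewrite -/r => h1 h2.
  by rewrite !ltn_eqF ?(leq_trans h1) ?(leq_trans h2) // => /eqP.
have Ho' x : x < 18 -> [|| nth 0 r a == nth 0 r x, nth 0 r b == nth 0 r x | lab o x == lab o' x].
  move=> hx; have := Ho x; rewrite mem_iota => /(_ hx).
  by rewrite rp_state ![_ == nth 0 r x]eq_sym.
apply: edge_cases => [x hx|h k hk].
  by rewrite !same_circleE !circle_outer // -!lab_state // Ho'.
rewrite !same_circleE !circle_outer // circle_col // !label_col // /col_circle -tt Hs.
by case: ifP => _; [|case: ifP => _]; rewrite ?eqxx ?orbT // Ho' //; case: (h).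
Qed.

Let quad_lt k : let q := nth quad0 kan_quads k in (q.1.1.1 < 18) && (q.1.2 < 18).
Proof. by case: k => [|[|[|[|[|[|[|[|[|k]]]]]]]]] //=; rewrite nth_nil. Qed.

Lemma edge_coef_outer (k : 'I_(ncross D)) : k < 8 ->
  edge_coef k S T = [&& tb == tb', sm == sm' & surgery k (cut S.1) o o'].
Proof.
move=> k8; have [e0 _ e2 _] := ends_xing_outer k8.
rewrite /edge_coef (set_bits_outer k8) e0 e2 /surgery rp_state !take_state (nth_ob S.1 k8).
have /andP[ha hb] := quad_lt k; set a := _.1.1.1 in ha *; set b := _.1.2 in hb *.
case: eqP => [tt|_]; last by rewrite !andbF.
rewrite forall_outer // same_circleE !circle_outer // -!lab_state //=.
by case: (sm == sm'); rewrite ?andbF // andbT.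
Qed.

Lemma edge_sign_outer (k : 'I_(ncross D)) : k < 8 ->
  edge_sign k S.1 = ((-1) ^+ cnt (take k o))%R.
Proof.
move=> k8; rewrite /edge_sign card_take_bits; congr (_ ^+ cnt _)%R.
by rewrite -[RHS](@take_takel _ _ 8) ?(ltnW k8) // take_state take_takel // ltnW.
Qed.

Lemma edge_sign_twist (k : 'I_(ncross D)) j : k = 8 + j :> nat ->
  edge_sign k S.1 = ((-1) ^+ (cnt (take 8 o) + cnt (take j tb)))%R.
Proof.
move=> kj; rewrite /edge_sign card_take_bits kj takeD count_cat.
by rewrite take_state.
Qed.

Section Twist.
Variables (j : nat).
Hypothesis jm : j < m.
Hypothesis tbj : nth false tb j = false.
Hypothesis tbE : tb' = set_nth false tb j true.
Hypothesis take8 : take 8 o' = take 8 o.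

Local Notation p := (cnt (take j tb)).
Local Notation rest := (has id (drop j tb)).

Let take_tb' k : cnt (take k tb') = cnt (take k tb) + (j < k).
Proof. by rewrite tbE count_take_set ?size_tb. Qed.

Let drop_tb' k : cnt (drop k tb') = cnt (drop k tb) + (k <= j).
Proof. by rewrite tbE count_drop_set ?size_tb. Qed.

Let cutT : cut T.1.
Proof. by rewrite /cut has_count -(count_take_drop _ j) drop_tb' leqnn addn1 addnS. Qed.

Let rest0 : rest = (cnt (drop j tb) != 0).
Proof. by rewrite has_count lt0n. Qed.

Let takeS : cnt (take j.+1 tb) = p.
Proof. by rewrite (take_nth false) ?size_tb // tbj -cats1 count_cat /= addn0 addn0. Qed.

Let dropS : cnt (drop j.+1 tb) = cnt (drop j tb).
Proof. by rewrite [drop j tb](drop_nth false) ?size_tb // tbj. Qed.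

Let size_smS : size sm = (p + cnt (drop j tb)).-1.
Proof. by rewrite size_small count_take_drop. Qed.

Let size_smT : size sm' = p + cnt (drop j tb).
Proof. by rewrite size_small -(count_take_drop _ j) take_tb' drop_tb' ltnn leqnn; lia. Qed.

Let labels_top : S.2 (col true j) = (if p == 0 then lab o 13
   else if rest then nth false sm p.-1 else lab o 15).
Proof. by rewrite label_col ?(ltnW jm) // rest0; case: (p == 0); case: (cnt (drop j tb)). Qed.

Let labelT_a : T.2 (col true j) = if p == 0 then lab o' 13 else nth false sm' p.-1.
Proof.
rewrite label_col ?(ltnW jm) // take_tb' ltnn addn0 drop_tb' leqnn addn_eq0 andbF.
by case: (p == 0).
Qed.

Let labelT_b : T.2 (col false j.+1) = if rest then nth false sm' p else lab o' 14.
Proof.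
by rewrite label_col // take_tb' ltnSn addn1 takeS drop_tb' dropS ltnn addn0 rest0 /=;
  case: (cnt (drop j tb)).
Qed.

(** The flip inserts one small circle, so the circles above the crossing are renumbered: this is the
    offset [p <= i.+1], the circle of index i having i + 1 horizontal smoothings below it. The
    circle [c] that is cut is exempt from the comparison. *)
Lemma forall_twist : cut S.1 ->
  let c := col_circle tb r true j in
  [forall e, [|| same_circle S.1 (col true j) e, same_circle S.1 (col false j.+1) e
               | S.2 e == T.2 e]] =
  all (fun x => (nth 0 r x == c) || (lab o x == lab o' x)) (iota 0 18) &&
  all (fun i => (18 + i == c) || (nth false sm i == nth false sm' (i + (p <= i.+1))))
      (iota 0 (size sm)).
Proof.
move=> ct c; have [r12 r14] : nth 0 r 12 = nth 0 r 13 /\ nth 0 r 14 = nth 0 r 15.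
  by have := reps_cut S.1; rewrite ct.
have cE : c = if p == 0 then nth 0 r 12 else if rest then 17 + p else nth 0 r 14.
  by rewrite /c /col_circle rest0 r12 r14; case: (p == 0); case: (cnt (drop j tb)).
have ca : circle tb r (col true j) = c by rewrite circle_col // ltnW.
have cb : circle tb r (col false j.+1) = c.
  rewrite circle_col // cE /col_circle takeS dropS rest0.
  by case: (p == 0); case: (cnt (drop j tb)).
apply/forallP/andP => [H|[/allP Ho /allP Hs]].
  split; apply/allP=> x; rewrite mem_iota => /andP[_ hx].
    have := H (outer x); rewrite !same_circleE ca cb circle_outer // !lab_state //.
    by rewrite ![c == _]eq_sym; case: (_ == c).
  have [l [lm tl ctl dl]] := small_position genS hx; have := H (col false l).
  rewrite !same_circleE ca cb circle_col ?(ltnW lm) // /col_circle ctl (negPf dl) /=.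
  rewrite !label_col ?(ltnW lm) // take_tb' drop_tb' ctl (negPf dl) /= addn_eq0 (negPf dl) /=.
  rewrite ![c == _]eq_sym -[17 + x.+1]/(18 + x); case: (_ == c) => //=.
  suff -> : (j < l) = (p <= x.+1) by [].
  rewrite -ctl; apply/idP/idP => [jl|]; first exact/count_take_le/ltnW.
  have {}tl : cnt (take l.+1 tb) = (cnt (take l tb)).+1.
    by rewrite (take_nth false) ?size_tb // -cats1 count_cat tl /= addn0 addn1.
  apply: contraLR; rewrite -leqNgt -ltnNge leq_eqVlt => /predU1P[lj|lj].
    by move: tl; rewrite lj takeS => /eqP; rewrite -{1}[p]addn0 -addn1 eqn_add2l.
  by rewrite -tl; apply: count_take_le.
have Ho' x : x < 18 -> (nth 0 r x == c) || (lab o x == lab o' x).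
  by move=> hx; apply: Ho; rewrite mem_iota.
apply: edge_cases => [x hx|h k hk].
  rewrite !same_circleE ca cb circle_outer // -!lab_state // ![c == _]eq_sym.
  by case/orP: (Ho' x hx) => ->; rewrite ?orbT.
rewrite !same_circleE ca cb circle_col // !label_col // ![c == _]eq_sym /col_circle.
rewrite take_tb' drop_tb'; have ho12 : 12 + h < 18 by case: (h).
have ho14 : 14 + h < 18 by case: (h).
have [k0|k0] := eqVneq (cnt (take k tb)) 0.
  have [kj|jk] := leqP k j.
    by rewrite k0 /=; case/orP: (Ho' _ ho12) => ->; rewrite ?orbT.
  have p0 : p = 0 by apply/eqP; rewrite -leqn0 -k0 count_take_le // ltnW.
  by rewrite cE p0 /=; case: (h); rewrite /= ?r12 eqxx.
have [d0|d0] := eqVneq (cnt (drop k tb)) 0.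
  have [kj|jk] := leqP k j.
    have dj : cnt (drop j tb) = 0.
      apply/eqP; rewrite -leqn0 -(leq_add2l p) addn0 count_take_drop.
      by rewrite -(count_take_drop tb k) d0 addn0 count_take_le.
    have pk : p != 0 by rewrite -lt0n (leq_trans _ (count_take_le tb kj)) ?lt0n.
    by rewrite cE (negPf pk) rest0 dj /=; case: (h); rewrite /= ?r14 eqxx.
  by rewrite addn_eq0 (negPf k0) d0 /=; case/orP: (Ho' _ ho14) => ->; rewrite ?orbT.
rewrite !addn_eq0 (negPf k0) (negPf d0) /=.
set i := (cnt (take k tb)).-1; have ki : cnt (take k tb) = i.+1 by rewrite /i prednK ?lt0n.
have : i \in iota 0 (size sm).
  rewrite mem_iota add0n size_small -(count_take_drop tb k) ki addSn /=.
  by rewrite -[X in X < _]addn0 ltn_add2l lt0n.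
move=> /Hs; rewrite ki -[17 + i.+1]/(18 + i).
have [//|nc /=] := eqVneq (18 + i) c.
suff -> : (j < k) = (p <= i.+1) by [].
rewrite -ki; apply/idP/idP => [jk|]; first exact/count_take_le/ltnW.
apply: contraLR; rewrite -leqNgt -ltnNge => kj.
have := count_take_le tb kj; rewrite leq_eqVlt => /predU1P[pk|//].
have dj : cnt (drop j tb) = cnt (drop k tb).
  by apply/eqP; rewrite -(eqn_add2l p) -{2}pk !count_take_drop.
by case/eqP: nc; rewrite cE -pk ki /= rest0 dj d0.
Qed.

Let reps_T : cut S.1 -> reps_of T.1 = r.
Proof. by move=> ct; rewrite /reps_of -!take_state take8 ct cutT. Qed.

Let agree_eq x0 : x0 < 18 -> cut S.1 ->
  agree true o o' x0 x0 && (lab o x0 == lab o' x0) = (o == o').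
Proof.
move=> hx0 ct; rewrite state_eqE //; have rS : rp true o = r by rewrite -ct rp_state.
apply/andP/allP => [[/allP H /eqP l0] x xi|H]; last first.
  by split; [apply/allP=> x /H ->; rewrite !orbT|apply: H; rewrite mem_iota].
have hx : x < 18 by rewrite mem_iota in xi.
have := H x xi; rewrite rS orbA orbb => /orP[/eqP rx|//].
rewrite (lab_eq_rep genS hx hx0 rx) l0; apply/eqP/esym.
by apply: (lab_eq_rep genT) => //; rewrite reps_T.
Qed.

Let validS : cut S.1 -> valid true o.
Proof. by move=> ct; have := valid_state genS; rewrite ct. Qed.

Let validT : valid true o'.
Proof. by have := valid_state genT; rewrite cutT. Qed.

Let rlt x : x < 18 -> nth 0 r x < 18.
Proof. exact: reps_lt. Qed.

(** Once the region contains a horizontal smoothing, both arcs at any other crossing of it lie on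
    the same circle, so a flip is a comultiplication. Only the first cut of the region can merge
    circles, and this one is the saddle. *)
Lemma twist_coef :
  ([forall e, [|| same_circle S.1 (col true j) e, same_circle S.1 (col false j.+1) e
     | S.2 e == T.2 e]] &&
   (if same_circle S.1 (col true j) (col false j.+1)
    then comult_coef (S.2 (col true j)) (T.2 (col true j)) (T.2 (col false j.+1))
    else mult_coef (S.2 (col true j)) (S.2 (col false j.+1)) (T.2 (col true j))))%:R%R =
  (if p is p'.+1 then flip_coef (dot 14) p' rest sm sm' o o'
   else if rest then (sm == behead sm')%:R * (if head false sm' then dot 13 o o' else (o == o')%:R)
   else saddle o o')%R.
Proof.
have circ_a : circle tb r (col true j) = if p == 0 then nth 0 r 13
    else if rest then 17 + p else nth 0 r 15.
  by rewrite circle_col ?(ltnW jm) // /col_circle rest0; case: (p == 0); case: (cnt (drop j tb)).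
have circ_b : circle tb r (col false j.+1) = if p == 0 then nth 0 r 12
    else if rest then 17 + p else nth 0 r 14.
  by rewrite circle_col // /col_circle takeS dropS rest0; case: (p == 0); case: (cnt (drop j tb)).
have labelS_b : S.2 (col false j.+1) = if p == 0 then lab o 12
    else if rest then nth false sm p.-1 else lab o 14.
  by rewrite label_col // takeS dropS rest0; case: (p == 0); case: (cnt (drop j tb)).
have cutE : cut S.1 = (p != 0) || rest.
  by rewrite /cut has_count -(count_take_drop tb j) rest0 lt0n addn_eq0 negb_and.
have [ct|nct] := boolP (cut S.1); last first.
  move: nct; rewrite cutE negb_or negbK => /andP[/eqP p0 /negbTE r0].
  have [r12 r13] : nth 0 r 12 = nth 0 r 14 /\ nth 0 r 13 = nth 0 r 15.
    by have := reps_cut S.1; rewrite cutE p0 r0.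
  rewrite !same_circleE circ_a circ_b labels_top labelS_b labelT_a labelT_b p0 r0 /=.
  rewrite /saddle validT /surgery take8 /=.
  have vS : valid false o by have := valid_state genS; rewrite cutE p0 r0.
  have rS : rp false o = r by rewrite -rp_state cutE p0 r0.
  rewrite vS rS [take 8 (set_nth _ _ _ _)](_ : _ = take 8 o); last first.
    by rewrite take_set_nth_size ?size_takel ?size_tuple.
  rewrite eqxx [nth false (take 8 _) 8]nth_default ?size_takel ?size_tuple //= r12.
  have -> : lab o 12 = lab o 14 by apply: (lab_eq_rep genS).
  congr (_ && _)%:R%R; apply/forallP/allP => [H x|H].
    rewrite mem_iota => /andP[_ hx]; have := H (outer x).
    rewrite !same_circleE circ_a circ_b p0 /= circle_outer // !lab_state // rS r12.
    by rewrite ![_ == nth 0 r x]eq_sym.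
  apply: edge_cases => [x hx|h k hk]; rewrite !same_circleE circ_a circ_b p0 eqxx r12.
    have := H x; rewrite mem_iota => /(_ hx); rewrite circle_outer // -!lab_state // rS.
    by rewrite ![_ == nth 0 r x]eq_sym.
  rewrite circle_col // /col_circle.
  have d0 : cnt tb = 0 by rewrite -(count_take_drop tb j) p0; move: r0; rewrite rest0;
    case: (cnt _).
  have -> : cnt (take k tb) = 0.
    by apply/eqP; rewrite -leqn0 -d0 -(count_take_drop tb k) leq_addr.
  by case: h; rewrite /= -?r12 eqxx ?orbT.
have [r12 r14] : nth 0 r 12 = nth 0 r 13 /\ nth 0 r 14 = nth 0 r 15.
  by have := reps_cut S.1; rewrite ct.
have rS : rp true o = r by rewrite -ct rp_state.
rewrite forall_twist // -[col_circle _ _ _ _](@circle_col m) ?(ltnW jm) //.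
rewrite same_circleE circ_a circ_b labels_top labelT_a labelT_b /flip_coef.
have [p0|p0] := eqVneq p 0; rewrite ?p0 /=.
  have r1 : rest by move: ct; rewrite cutE p0.
  rewrite r1 r12 eqxx nth0.
  have -> : all (fun i => (18 + i == nth 0 r 13)
      || (nth false sm i == nth false sm' (i + 1))) (iota 0 (size sm)) = (sm == behead sm').
    rewrite -all_nth_eq; last by rewrite size_behead size_smT size_smS p0.
    apply: eq_all => i; rewrite addn1 nth_behead gtn_eqF //.
    by rewrite (leq_trans (rlt (isT : 13 < 18))) // leq_addr.
  rewrite -(agree_eq (isT : 13 < 18) ct) /dot /lowered (validS ct) validT take8 eqxx.
  have -> : all (fun x => (nth 0 r x == nth 0 r 13) || (lab o x == lab o' x)) (iota 0 18)
      = agree true o o' 13 13.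
    by apply: eq_all => x; rewrite rS orbA orbb.
  case: (head false sm'); case: (lab o 13); case: (lab o' 13); case: (agree _ _ _ _ _);
    by case: (sm == behead sm'); rewrite ?mulr0 ?mulr1 ?mul0r ?mul1r.
have [p' pE] : exists p', p = p'.+1 by case: (p) p0 => // p'; exists p'.
rewrite pE /=; have [r1|r0] := boolP rest.
  have sizes : size sm' = (size sm).+1.
    by rewrite size_smT size_smS pE addSn.
  have hp : p' < size sm.
    by rewrite size_smS pE addSn /= -[X in X < _]addn0 ltn_add2l lt0n -rest0.
  rewrite eqxx state_eqE //.
  have -> : all (fun x => (nth 0 r x == 17 + p'.+1) || (lab o x == lab o' x)) (iota 0 18)
      = all (fun x => lab o x == lab o' x) (iota 0 18).
    apply: eq_in_all => x; rewrite mem_iota => /andP[_ hx].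
    by rewrite ltn_eqF // addnS (leq_trans (rlt hx)) // leq_addr.
  have -> : all (fun i => (18 + i == 17 + p'.+1)
      || (nth false sm i == nth false sm' (i + (p' < i.+1)))) (iota 0 (size sm))
      = (take p' sm == take p' sm') && (drop p'.+1 sm == drop p'.+2 sm').
    by rewrite -all_nth_eq_except.
  by case: (all _ _); rewrite /= ?andbT ?andbF -?andbA.
rewrite -r14 eqxx.
have d0 : cnt (drop j tb) = 0 by move: r0; rewrite rest0; case: (cnt _).
have -> : all (fun i => (18 + i == nth 0 r 14)
    || (nth false sm i == nth false sm' (i + (p' < i.+1)))) (iota 0 (size sm))
    = (sm == take p' sm').
  have sp : size sm = p' by rewrite size_smS pE d0 addn0.
  rewrite -all_nth_eq; last by rewrite size_takel // size_smT pE d0 addn0.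
  apply: eq_in_all => i; rewrite mem_iota sp => /andP[_ hi]; rewrite nth_take // gtn_eqF.
    by rewrite ltnS leqNgt hi addn0.
  by rewrite (leq_trans (rlt (isT : 14 < 18))) // leq_addr.
have -> : all (fun x => (nth 0 r x == nth 0 r 14) || (lab o x == lab o' x)) (iota 0 18)
    = agree true o o' 14 14.
  by apply: eq_all => x; rewrite rS orbA orbb.
rewrite (lab_eq_rep genS (isT : 15 < 18) (isT : 14 < 18)) //.
rewrite -(agree_eq (isT : 14 < 18) ct) /dot /lowered (validS ct) validT take8 eqxx.
case: (nth false sm' p'); case: (lab o 14); case: (lab o' 14); case: (agree _ _ _ _ _);
  by case: (sm == take p' sm'); rewrite ?mulr0 ?mulr1 ?mul0r ?mul1r.
Qed.

End Twist.

Local Notation flip_value j :=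
  (if cnt (take j tb) is p'.+1 then flip_coef (dot 14) p' (has id (drop j tb)) sm sm' o o'
   else if has id (drop j tb) then
     (sm == behead sm')%:R * (if head false sm' then dot 13 o o' else (o == o')%:R)
   else saddle o o')%R.

Lemma flip_value0 j : take 8 o' != take 8 o -> flip_value j = 0%R.
Proof.
move=> t8; have no : (o == o') = false by apply: contraNF t8 => /eqP ->.
have nd x : dot x o o' = 0%R by rewrite /dot /lowered (negPf t8) !andbF.
case: (cnt _) => [|p]; rewrite /flip_coef no ?nd.
  case: ifP => _; first by case: ifP => _; rewrite mulr0.
  rewrite /saddle /surgery take_set_nth_size ?size_takel ?size_tuple //.
  by rewrite (negPf t8) !andbF.
by case: ifP => _; rewrite ?andbF //; case: ifP => _; rewrite mulr0.
Qed.

Lemma edge_coef_twist (k : 'I_(ncross D)) j : k = 8 + j :> nat ->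
  ((edge_coef k S T)%:R = (flips tb tb' j)%:R * flip_value j)%R.
Proof.
move=> kj; have [e0 _ e2 _] := ends_xing_twist kj.
have jm : j < m by have := leq_trans (ltn_ord k) (eq_leq (size_crossings m)); lia.
rewrite /edge_coef (set_bits_twist kj) e0 e2 -(nth_tb S.1 kj) /flips.
case: (boolP (nth false tb j)) => [_|/negbTE tbj]; first by rewrite mul0r.
case: (boolP (tb' == _)) => [/eqP tbE|_]; last by rewrite !andbF mul0r.
case: (boolP (take 8 o' == _)) => [/eqP t8|t8].
  by rewrite mul1r -twist_coef.
by rewrite flip_value0 // mulr0.
Qed.

(** The sign of moving the flipped twist crossings past the flipped outer crossings: the diagram
    lists the outer crossings first, the iterated cone the twist crossings. *)
Definition eps (U : labelled D) : rat :=
  ((-1) ^+ (cnt (take 8 (state_of U)) * cnt (twist_bits U.1)))%R.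

Local Open Scope ring_scope.

Lemma sum_crossings (F : 'I_(ncross D) -> rat) (f g : nat -> rat) :
    (forall k : 'I_(ncross D), (k < 8)%N -> F k = f k) ->
    (forall (k : 'I_(ncross D)) j, k = (8 + j)%N :> nat -> F k = g j) ->
  \sum_k F k = \sum_(k < 8) f k + \sum_(j < m) g j.
Proof.
move=> Ff Fg; pose h := cast_ord (esym (size_crossings m)).
have hbij : bijective h by exists (cast_ord (size_crossings m));
  [exact: cast_ordKV|exact: cast_ordK].
rewrite (reindex h) /=; last exact: onW_bij.
rewrite big_split_ord /=; congr (_ + _); apply: eq_bigr => k _.
  by rewrite Ff //= ltn_ord.
exact: Fg.
Qed.

Lemma incidence_word :
  eps S * dC (state_diff false) (state_diff true) saddle (dot 13) (dot 14)
    (word_of S) (word_of T) = incidence S T * eps T.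
Proof.
rewrite /incidence (sum_crossings
  (f := fun k => (-1) ^+ cnt (take k o) *
     ([&& tb == tb', sm == sm' & surgery k (cut S.1) o o']%:R))
  (g := fun j => (-1) ^+ (cnt (take 8 o) + cnt (take j tb)) *
     ((flips tb tb' j)%:R * flip_value j))).
- rewrite /word_of dC_word ?size_tb ?size_small // mulrDr mulrDl; congr (_ + _).
    have [tt|_] := eqVneq tb tb'; last first.
      rewrite mulr0 mul0r mulr0 big1 ?mul0r // => k _.
      by rewrite mulr0.
    have [ss|_] := eqVneq sm sm'; last first.
      rewrite mulr0 mul0r mulr0 big1 ?mul0r // => k _.
      by rewrite mulr0.
    have -> : (if has id tb then state_diff true o o' else state_diff false o o') =
      state_diff (cut S.1) o o' by rewrite /cut; case: (has id tb).
    have cc : cut T.1 = cut S.1 by rewrite /cut tt.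
    rewrite /state_diff (valid_state genS) -cc (valid_state genT) cc mul1r mulr1.
    rewrite mulrA mulr_sumr mulr_suml; apply: eq_bigr => k _ /=.
    case: (boolP (surgery _ _ _ _)) => [/and4P[nk /eqP tk _ _]|_]; last by rewrite !mulr0 mul0r.
    rewrite !mulr1 mulrC; congr (_ * _); rewrite /eps -exprD -tt.
    have -> : cnt (take 8 o') = (cnt (take 8 o) + 1)%N.
      rewrite tk count_take_set ?size_takel ?size_tuple //; last exact/negbTE.
      by rewrite ltn_ord take_takel.
    by rewrite mulnDl mul1n.
rewrite mulr_sumr mulr_suml; apply: eq_bigr => j _.
rewrite /twist_flip; set v := (if _ is _.+1 then _ else _).
have [t8|t8] := eqVneq (take 8 o') (take 8 o); last by rewrite /v flip_value0 // !mulr0 mul0r.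
have [/andP[/negbTE nj /eqP tbE]|_] := boolP (flips tb tb' j); last by rewrite !mul0r !mulr0 mul0r.
rewrite !mul1r !mulrA [RHS]mulrAC; congr (_ * _).
have -> : eps T = (-1) ^+ (cnt (take 8 o) * cnt tb + cnt (take 8 o)).
  rewrite /eps t8 tbE; congr (_ ^+ _).
  have := @count_drop_set tb j 0; rewrite !drop0 size_tb => -> //.
  by rewrite mulnDr muln1.
rewrite /eps -!exprD -signr_odd -[RHS]signr_odd !oddD; congr (_ ^+ _).
by case: (odd _); case: (odd _); case: (odd _).
- by move=> k k8; rewrite edge_sign_outer // edge_coef_outer.
by move=> k j kj; rewrite (edge_sign_twist kj) (edge_coef_twist kj).
Qed.

End Incidence.

Local Transparent iota.

(** * The signature *)

Local Open Scope ring_scope.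

Section OrthogonalBasis.
Variables (V : vectType rat) (U : {vspace V}) (b : V -> V -> rat) (E : seq V).
Hypothesis b_linear : forall k x x' y, b (k *: x + x') y = k * b x y + b x' y.
Hypothesis b_sym : forall x y, b x y = b y x.
Hypothesis sub_E : {subset E <= U}.
Hypothesis orth_E : forall k l, (k < size E)%N -> (l < size E)%N -> k != l -> b E`_k E`_l = 0.
Hypothesis nonisotropic_E : forall k, (k < size E)%N -> b E`_k E`_k != 0.
Hypothesis radical_E : forall w x, w \in U -> x \in U ->
  (forall k, (k < size E)%N -> b w E`_k = 0) -> b w x = 0.

Let n := size E.
Let dot_E (x : V) : {ffun 'I_n -> rat^o} := [ffun i : 'I_n => b x E`_i].
Let dot_E_linear : linear dot_E.
Proof. by move=> k x y; apply/ffunP=> i; rewrite !ffunE b_linear. Qed.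
HB.instance Definition _ :=
  GRing.isLinear.Build rat V {ffun 'I_n -> rat^o} _ dot_E dot_E_linear.
Let W := (U :&: lker (linfun dot_E))%VS.

Let b_sum (c : 'I_n -> rat) (j : 'I_n) : b (\sum_i c i *: E`_i) E`_j = c j * b E`_j E`_j.
Proof.
have -> : b (\sum_i c i *: E`_i) E`_j = dot_E (\sum_i c i *: E`_i) j by rewrite ffunE.
rewrite linear_sum sum_ffunE (bigD1 j) //= big1 ?addr0 => [|i /negPf nij].
  by rewrite linearZ !ffunE.
by rewrite linearZ !ffunE orth_E ?scaler0 // (inj_eq val_inj) nij.
Qed.

Let mem_W x : (x \in W) = (x \in U) && [forall i : 'I_n, b x E`_i == 0].
Proof.
rewrite memv_cap memv_ker lfunE /=; congr (_ && _).
apply/eqP/forallP => [/ffunP h i|h]; first by have := h i; rewrite !ffunE => ->.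
by apply/ffunP=> i; rewrite !ffunE; apply/eqP.
Qed.

(** [E] is completed by a basis of its orthogonal complement in [U]. By [radical_E] the form
    vanishes against that complement, so the added vectors are orthogonal to everything and count
    zero. *)
Lemma form_signature_orthogonal :
  form_signature (mem U) b (\sum_(x <- E) sgz (b x x)).
Proof.
have freeE : free E.
  rewrite -[E]/(tval (in_tuple E)); apply/freeP=> c c0 i.
  have b0 : b 0 E`_i = 0 by have := congr1 (fun f : {ffun _ -> _} => f i) (linear0 dot_E);
    rewrite !ffunE.
  have := b_sum c i; rewrite c0 b0 => /esym/eqP.
  by rewrite mulf_eq0 (negPf (nonisotropic_E _)) ?orbF // => /eqP.
have dEW : (<<E>> :&: W = 0)%VS.
  apply/eqP; rewrite -subv0; apply/subvP=> x; rewrite memv_cap memv0 mem_W.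
  case/and3P=> xE _ /forallP xW; rewrite (coord_span (X := in_tuple E) xE) big1 // => i _.
  have := b_sum (fun i => coord (in_tuple E) i x) i.
  rewrite -(coord_span (X := in_tuple E) xE) (eqP (xW i)) => /esym/eqP.
  by rewrite mulf_eq0 (negPf (nonisotropic_E _)) ?orbF // => /eqP ->; rewrite scale0r.
have sumEW : (<<E>> + W)%VS = U.
  apply/eqP; rewrite eqEsubv; apply/andP; split.
    by rewrite subv_add capvSl andbT; apply/span_subvP.
  apply/subvP=> x xU; pose y := \sum_(i < n) (b x E`_i / b E`_i E`_i) *: E`_i.
  have yE : y \in <<E>>%VS.
    by apply: memv_suml => i _; apply/memvZ/memv_span/mem_nth.
  rewrite -[x](subrK y) addrC; apply: memv_add => //; rewrite mem_W.
  have yU : y \in U by apply: (subvP _ _ yE); apply/span_subvP.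
  rewrite memvB //=; apply/forallP=> i; apply/eqP.
  rewrite -[x - y]addrC -scaleN1r b_linear b_sum mulfVK ?nonisotropic_E //.
  by rewrite mulN1r addNr.
exists (E ++ vbasis W); split.
- rewrite cat_free freeE (basis_free (vbasisP W)) /= (span_basis (vbasisP W)).
  by rewrite directv_addE /= !directvE /= !eqxx /=; apply/eqP.
- by move=> x; rewrite span_cat (span_basis (vbasisP W)) sumEW.
- have inX k : (k < size (E ++ vbasis W))%N -> (E ++ vbasis W)`_k \in U.
    move=> hk; have := mem_nth 0 hk; rewrite mem_cat => /orP[/sub_E //|/vbasis_mem].
    by rewrite mem_W => /andP[].
  have inW k x : (k < size (E ++ vbasis W))%N -> (size E <= k)%N -> x \in U ->
      b (E ++ vbasis W)`_k x = 0.
    move=> hk kE xU; apply: radical_E (inX _ hk) xU _ => l hl.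
    have : (E ++ vbasis W)`_k \in W.
      rewrite nth_cat ltnNge kE /=; apply: vbasis_mem; apply: mem_nth.
      by rewrite ltn_subLR // -size_cat.
    by rewrite mem_W => /andP[_ /forallP/(_ (Ordinal hl))/eqP].
  move=> k l hk hl nkl; have [kE|/inW->//] := ltnP k (size E); last exact: inX.
  have [lE|lE] := ltnP l (size E); first by rewrite !nth_cat kE lE orth_E.
  by rewrite b_sym inW // inX.
rewrite big_cat /= [X in _ = _ + X]big1_seq ?addr0 // => x /vbasis_mem.
rewrite mem_W => /andP[xU /forallP xE]; rewrite radical_E ?sgz0 // => k hk.
exact: eqP (xE (Ordinal hk)).
Qed.

End OrthogonalBasis.

Section CycleSpace.
Variable D : diagram.

Definition crossing_balance (c : crossing (edge D)) (z : H1vec D) : rat^o :=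
  (z (under_in c) + z (over_in c)) - (z (under_out c) + z (over_out c)).

Fact crossing_balance_linear c : linear (crossing_balance c).
Proof. by move=> k x y; rewrite /crossing_balance !ffunE -!/(_ * _); ring. Qed.
HB.instance Definition _ c :=
  GRing.isLinear.Build rat (H1vec D) rat^o _ (crossing_balance c) (crossing_balance_linear c).

Definition cycle_space : {vspace H1vec D} :=
  (\bigcap_(c <- crossings D) lker (linfun (crossing_balance c)))%VS.

Lemma mem_cycle_space z : (z \in cycle_space) = is_cycle z.
Proof.
rewrite /cycle_space /is_cycle; elim: (crossings D) => [|c l IHl].
  by rewrite big_nil memvf.
by rewrite big_cons memv_cap IHl memv_ker lfunE /= subr_eq0.
Qed.

End CycleSpace.

Section TwoSequences.
Variables (L R : nat -> rat) (d c : rat).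

(** Since L(2k) = R(2k) - d, each pair of consecutive crossings contributes R(2k) - R(2k+2) - d, and
    the sum telescopes. *)
Lemma even_twist_sum n : (forall k, (k <= n.*2)%N -> R k - L k = (-1) ^+ k * d) ->
  \sum_(0 <= k < n.*2) (if odd k then - R k.+1 else L k) * c =
  (L 0 - R n.*2 - (n%:R - 1) * d) * c.
Proof.
elim: n => [|n IHn] RL.
  by rewrite big_nil; have := RL 0%N isT; rewrite expr0 mul1r => <-; ring.
rewrite doubleS !big_nat_recr //= odd_double /= IHn => [|k hk]; last by apply: RL; lia.
have := RL n.*2; rewrite -signr_odd odd_double expr0 mul1r => /(_ _)<-; last by lia.
by rewrite -natr1; ring.
Qed.

Lemma odd_twist_sum n : (forall k, (k <= n.*2.+1)%N -> R k - L k = (-1) ^+ k * d) ->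
  \sum_(0 <= k < n.*2.+1) (if odd k then - L k else R k.+1) * c =
  (R n.*2.+1 - n%:R * d) * c.
Proof.
elim: n => [|n IHn] RL; first by rewrite big_nat1 /=; ring.
rewrite doubleS big_nat_recr // big_nat_recr //= odd_double /= IHn => [|k hk];
  last by apply: RL; lia.
have := RL n.*2.+1; rewrite -signr_odd /= odd_double expr1 => /(_ _) e.
have {e} : L n.*2.+1 = R n.*2.+1 + d by rewrite -[R _](subrK (L n.*2.+1)) e; [ring|lia].
by rewrite -natr1 => ->; ring.
Qed.

End TwoSequences.

(** * The Seifert form on the cycles of the diagram *)

Section SeifertForm.
Variable m : nat.
Local Notation D := (kan m).
Implicit Types x y z : H1vec D.

Local Notation col := (col_bc m 0).
Local Notation A := (ca_at_a m 0).
Local Notation C := (ca_at_c m 0).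
Local Notation ab := (e_ab m 0).
Local Notation ad := (e_ad m 0).
Local Notation bd := (e_bd m 0).
Local Notation e := (e_cd1 m 0).
Local Notation f := (e_cd2 m 0).
Local Notation w h := (col_ab m 0 h 0).

Definition jump z k : rat := z (col true k) - z (col false k).

(** As the strands are antiparallel, the equation at a twist crossing says that [jump] changes sign
    there; its value at the bottom thus governs the whole region. *)
Definition twist_cycle z := all (fun k => jump z k.+1 == - jump z k) (iota 0 m).

Lemma jumpE z k : twist_cycle z -> (k <= m)%N -> jump z k = (-1) ^+ k * jump z 0.
Proof.
move=> /allP tz; elim: k => [|k IHk] hk; first by rewrite mul1r.
have /eqP -> : jump z k.+1 == - jump z k by apply: tz; rewrite mem_iota.
by rewrite IHk ?exprS ?mulN1r ?mulNr // ltnW.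
Qed.

Definition balanced (p q r s : rat) : bool := p + q == r + s.
Arguments balanced : simpl never.

(** The parity of m decides which ends of an outer crossing are incoming, hence the two versions;
    the twist region gives [twist_cycle] in both. *)
Lemma is_cycle_even z : ~~ odd m -> is_cycle z =
  [&& balanced (z (ab false)) (z (ad false)) (z A) (z (w false)),
      balanced (z (w false)) (z (col false 0)) (z (bd false)) (z (ab false)),
      balanced (z (e false)) (z C) (z (col false m)) (z (f false)),
      balanced (z (f false)) (z (bd false)) (z (ad false)) (z (e false)),
      balanced (z A) (z (w true)) (z (ab true)) (z (ad true)),
      balanced (z (bd true)) (z (ab true)) (z (w true)) (z (col true 0)),
      balanced (z (col true m)) (z (f true)) (z (e true)) (z C),
      balanced (z (ad true)) (z (e true)) (z (f true)) (z (bd true))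
    & twist_cycle z].
Proof.
move=> om; rewrite -[LHS]/(all (fun c => balanced (z (under_in c)) (z (over_in c))
  (z (under_out c)) (z (over_out c))) (crossings D)).
rewrite [crossings D]/= /kan_crossings /half_crossings /fwd_ba /fwd_bdc addn0 om.
rewrite !all_cat /= all_map /under_in /under_out /over_in /over_out /= !andbT -!andbA.
rewrite [all _ (iota 0 m) in LHS](eq_all (a2 := fun k => jump z k.+1 == - jump z k)) // => k /=.
by rewrite /balanced /jump; case: (odd k); apply/eqP/eqP => ?; lra.
Qed.

Lemma is_cycle_odd z : odd m -> is_cycle z =
  [&& balanced (z A) (z (ad false)) (z (ab false)) (z (w false)),
      balanced (z (w false)) (z (ab false)) (z (bd false)) (z (col false 0)),
      balanced (z (e false)) (z C) (z (col false m)) (z (f false)),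
      balanced (z (f false)) (z (bd false)) (z (ad false)) (z (e false)),
      balanced (z (ab true)) (z (w true)) (z A) (z (ad true)),
      balanced (z (bd true)) (z (col true 0)) (z (w true)) (z (ab true)),
      balanced (z (col true m)) (z (f true)) (z (e true)) (z C),
      balanced (z (ad true)) (z (e true)) (z (f true)) (z (bd true))
    & twist_cycle z].
Proof.
move=> om; rewrite -[LHS]/(all (fun c => balanced (z (under_in c)) (z (over_in c))
  (z (under_out c)) (z (over_out c))) (crossings D)).
rewrite [crossings D]/= /kan_crossings /half_crossings /fwd_ba /fwd_bdc addn0 om.
rewrite !all_cat /= all_map /under_in /under_out /over_in /over_out /= !andbT -!andbA.
rewrite [all _ (iota 0 m) in LHS](eq_all (a2 := fun k => jump z k.+1 == - jump z k)) // => k /=.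
by rewrite /balanced /jump; case: (odd k); apply/eqP/eqP => ?; lra.
Qed.

Lemma iota_index : iota 0 m = index_iota 0 m.
Proof. by rewrite /index_iota subn0. Qed.

Lemma seifert_form_even n x y : m = n.*2 -> is_cycle x -> is_cycle y ->
  - seifert_form x y =
    x (w false) * (y (ab false) - y (w false)) + x (ab false) * (y (w false) - y (ab false))
  + x C * (y C - y (col false m)) + x (bd false) * (y (bd false) - y (ad false))
  + x (w true) * (y (w true) - y (ab true)) + x (ab true) * (y (ab true) - y (w true))
  + x C * (y (col true m) - y C) + x (bd true) * (y (ad true) - y (bd true))
  + (x (col false 0) - x (col true m) - (n%:R - 1) * jump x 0) * jump y 0.
Proof.
move=> mn; have om : ~~ odd m by rewrite mn odd_double.
rewrite !is_cycle_even // => /and5P[_ _ _ _ /and5P[_ _ _ _ tx]] /and5P[_ _ _ _ /and5P[_ _ _ _ ty]].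
rewrite /seifert_form opprK [crossings D]/= /kan_crossings /half_crossings /fwd_ba /fwd_bdc
  addn0 om.
rewrite !big_cat !big_cons !big_nil /= /left_in /left_out /under_in /under_out /over_in
  /over_out /=.
rewrite big_map iota_index big_nat.
rewrite (eq_bigr (fun k => (if odd k then - x (col true k.+1) else x (col false k)) * jump y
  0)); last first.
  move=> k /= km; rewrite /positive addbb /=; case ok: (odd k) => /=.
    have := jumpE ty km; rewrite -signr_odd /= ok mul1r => <-.
    by rewrite /jump; ring.
  have := jumpE ty (ltnW km); rewrite -signr_odd ok mul1r => <-.
  by rewrite /jump; ring.
have := @even_twist_sum (fun k => x (col false k)) (fun k => x (col true k)) (jump x 0) (jump y
  0) n.
rewrite -mn -big_nat => /= ->; last by move=> k; exact: (jumpE tx).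
by ring.
Qed.

Lemma seifert_form_odd n x y : m = n.*2.+1 -> is_cycle x -> is_cycle y ->
  - seifert_form x y =
    x (ad false) * (y (ad false) - y (ab false)) + x (ab false) * (y (ab false) - y (bd false))
  + x C * (y C - y (col false m)) + x (bd false) * (y (bd false) - y (ad false))
  + x (ad true) * (y (ab true) - y (ad true)) + x (ab true) * (y (bd true) - y (ab true))
  + x C * (y (col true m) - y C) + x (bd true) * (y (ad true) - y (bd true))
  + (x (col true m) - n%:R * jump x 0) * jump y 0.
Proof.
move=> mn; have om : odd m by rewrite mn /= odd_double.
rewrite !is_cycle_odd // => /and5P[_ _ _ _ /and5P[_ _ _ _ tx]] /and5P[_ _ _ _ /and5P[_ _ _ _ ty]].
rewrite /seifert_form opprK [crossings D]/= /kan_crossings /half_crossings /fwd_ba /fwd_bdc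
  addn0 om.
rewrite !big_cat !big_cons !big_nil /= /left_in /left_out /under_in /under_out /over_in
  /over_out /=.
rewrite big_map iota_index big_nat.
rewrite (eq_bigr (fun k => (if odd k then - x (col false k) else x (col true k.+1)) * jump y
  0)); last first.
  move=> k /= km; rewrite /positive addbb /=; case ok: (odd k) => /=.
    have := jumpE ty (ltnW km); rewrite -signr_odd ok mulN1r => /(canLR opprK) <-.
    by rewrite /jump; ring.
  have := jumpE ty km; rewrite -signr_odd /= ok mulN1r => /(canLR opprK) <-.
  by rewrite /jump; ring.
have := @odd_twist_sum (fun k => x (col false k)) (fun k => x (col true k)) (jump x 0) (jump y 0) n.
rewrite -mn -big_nat => /= ->; last by move=> k; exact: (jumpE tx).
by ring.
Qed.

End SeifertForm.

(** * Sums of two hyperbolic planes *)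

Section HyperbolicForm.
Variable D : diagram.
Implicit Types x y z : H1vec D.

Definition linking_form x y : rat := - (seifert_form x y + seifert_form y x).

Lemma seifert_form_linearl k x x' y :
  seifert_form (k *: x + x') y = k * seifert_form x y + seifert_form x' y.
Proof.
rewrite /seifert_form mulrN mulr_sumr -opprD -big_split /=; congr (- _).
by apply: eq_bigr => c _; rewrite !ffunE -[k *: _]/(k * _); ring.
Qed.

Lemma seifert_form_linearr k x y y' :
  seifert_form x (k *: y + y') = k * seifert_form x y + seifert_form x y'.
Proof.
rewrite /seifert_form mulrN mulr_sumr -opprD -big_split /=; congr (- _).
by apply: eq_bigr => c _; rewrite !ffunE -!/(k * _) -![k *: _]/(k * _); ring.
Qed.

Lemma linking_form_linear k x x' y :
  linking_form (k *: x + x') y = k * linking_form x y + linking_form x' y.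
Proof. by rewrite /linking_form seifert_form_linearl seifert_form_linearr; ring. Qed.

Lemma linking_form_sym x y : linking_form x y = linking_form y x.
Proof. by rewrite /linking_form addrC. Qed.

Lemma hyperbolic_signature (s g d h : H1vec D -> rat) :
  (forall x y, is_cycle x -> is_cycle y ->
     linking_form x y = s x * g y + g x * s y + (d x * h y + h x * d y)) ->
  (forall v1 v2 v3 v4, exists2 z, is_cycle z & [/\ s z = v1, g z = v2, d z = v3 & h z = v4]) ->
  knot_signature D 0.
Proof.
move=> bE ex.
(* In the coordinates (s, g) the vectors (1, 1) and (1, -1) are orthogonal with values 2 and -2; the
   same is done in (d, h). By the form of [bE], what is orthogonal to all four vectors lies in the
   radical. *)
have [e1 c1 [s1 g1 d1 h1]] := ex 1 1 0 0; have [e2 c2 [s2 g2 d2 h2]] := ex 1 (-1) 0 0.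
have [e3 c3 [s3 g3 d3 h3]] := ex 0 0 1 1; have [e4 c4 [s4 g4 d4 h4]] := ex 0 0 1 (-1).
have -> : 0 = \sum_(x <- [:: e1; e2; e3; e4]) sgz (linking_form x x).
  rewrite !big_cons big_nil !bE // s1 g1 d1 h1 s2 g2 d2 h2 s3 g3 d3 h3 s4 g4 d4 h4.
  by [].
have [X [fX sX oX eX]] : form_signature (mem (cycle_space D)) linking_form
    (\sum_(x <- [:: e1; e2; e3; e4]) sgz (linking_form x x)).
  apply: form_signature_orthogonal.
  - exact: linking_form_linear.
  - exact: linking_form_sym.
  - by move=> x; rewrite !inE mem_cycle_space => /or4P[]/eqP->.
  - move=> [|[|[|[|k]]]] [|[|[|[|l]]]] //= _ _ _; rewrite bE //;
      rewrite ?s1 ?g1 ?d1 ?h1 ?s2 ?g2 ?d2 ?h2 ?s3 ?g3 ?d3 ?h3 ?s4 ?g4 ?d4 ?h4; ring.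
  - move=> [|[|[|[|k]]]] //= _; rewrite bE //;
      by rewrite ?s1 ?g1 ?d1 ?h1 ?s2 ?g2 ?d2 ?h2 ?s3 ?g3 ?d3 ?h3 ?s4 ?g4 ?d4 ?h4.
  move=> z x; rewrite !mem_cycle_space => cz cx orth.
  have := orth 0%N isT; have := orth 1%N isT; have := orth 2%N isT; have := orth 3%N isT.
  rewrite /= !bE // s1 g1 d1 h1 s2 g2 d2 h2 s3 g3 d3 h3 s4 g4 d4 h4 => b4 b3 b2 b1.
  have -> : s z = 0 by lra.
  have -> : g z = 0 by lra.
  have -> : d z = 0 by lra.
  have -> : h z = 0 by lra.
  by rewrite !mul0r !addr0.
by exists X; split=> // z; rewrite sX mem_cycle_space.
Qed.

End HyperbolicForm.

Section KanenobuSignature.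
Variable m : nat.
Local Notation D := (kan m).
Implicit Types x y z : H1vec D.

Local Notation col := (col_bc m 0).
Local Notation A := (ca_at_a m 0).
Local Notation C := (ca_at_c m 0).
Local Notation ab := (e_ab m 0).
Local Notation ad := (e_ad m 0).
Local Notation bd := (e_bd m 0).
Local Notation e := (e_cd1 m 0).
Local Notation f := (e_cd2 m 0).
Local Notation w h := (col_ab m 0 h 0).

(** With a' = a + s and u' = u + d, the value at (z, z) is M(u, a) - M(u', a') - m d^2 for M = 2u^2
    + 2ua - 2a^2. Every term of such a difference is divisible by s or by d; [g] and [h] are the
    cofactors, up to the factor 2 of the diagonal. *)
Lemma linking_form_even n x y : m = n.*2 -> is_cycle x -> is_cycle y ->
  let u z := z (col false 0) - z A in
  let a z := z (w false) - z (ab false) in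
  let s z := z (w true) - z (ab true) - a z in
  let d z := jump z 0 in
  let g z := - (u z - 2 * a z - s z + d z) in
  let h z := - (2 * u z + a z + (1 + n%:R) * d z) in
  linking_form x y = s x * g y + g x * s y + (d x * h y + h x * d y).
Proof.
move=> mn cx cy /=; have om : ~~ odd m by rewrite mn odd_double.
rewrite /linking_form opprD (seifert_form_even mn cx cy) (seifert_form_even mn cy cx).
have ends z : is_cycle z -> [/\ [/\ z (ad false) = z A + z (w false) - z (ab false),
      z (bd false) = z (w false) + z (col false 0) - z (ab false),
      z (ad true) = z A + z (w true) - z (ab true)
    & z (bd true) = z (w true) + z (col false 0) + jump z 0 - z (ab true)],
    z (col true m) = z C - z A + z (col false 0) + jump z 0
    & z (col false m) = z C - z A + z (col false 0)].
  rewrite is_cycle_even // => /and5P[/eqP e1 /eqP e2 /eqP e3 /eqP e4].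
  case/and5P=> /eqP e5 /eqP e6 /eqP e7 /eqP e8 tz.
  have := jumpE tz (leqnn m); rewrite -signr_odd (negPf om) mul1r /jump => jm.
  by split; first split; lra.
have [[x1 x2 x3 x4] x5 x6] := ends x cx; have [[y1 y2 y3 y4] y5 y6] := ends y cy.
rewrite x1 x2 x3 x4 x5 x6 y1 y2 y3 y4 y5 y6; ring.
Qed.

(** Now the value at (z, z) is M(u, a) - M(u', a') - m d^2 for M = 3u^2 - 2ua + 2a^2. This M is
    definite, but only the difference of its values on the two halves enters, so the form still
    splits into hyperbolic planes. *)
Lemma linking_form_odd n x y : m = n.*2.+1 -> is_cycle x -> is_cycle y ->
  let u z := z (col false 0) - z A in
  let a z := z (ab false) - z (bd false) in
  let s z := z (ab true) - z (bd true) - a z in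
  let d z := jump z 0 in
  let g z := - (2 * a z - u z + s z - d z) in
  let h z := - (3 * u z - a z + (2 + n%:R) * d z) in
  linking_form x y = s x * g y + g x * s y + (d x * h y + h x * d y).
Proof.
move=> mn cx cy /=; have om : odd m by rewrite mn /= odd_double.
rewrite /linking_form opprD (seifert_form_odd mn cx cy) (seifert_form_odd mn cy cx).
have ends z : is_cycle z -> [/\ z (ad false) = z (bd false) + z (col false 0) - z A,
      z (ad true) = z (bd true) + z (col false 0) + jump z 0 - z A,
    z (col true m) = z C + z A - z (col false 0) - jump z 0
    & z (col false m) = z C + z A - z (col false 0)].
  rewrite is_cycle_odd // => /and5P[/eqP e1 /eqP e2 /eqP e3 /eqP e4].
  case/and5P=> /eqP e5 /eqP e6 /eqP e7 /eqP e8 tz.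
  have := jumpE tz (leqnn m); rewrite -signr_odd om mulN1r /jump => jm.
  by split; lra.
have [x1 x2 x3 x4] := ends x cx; have [y1 y2 y3 y4] := ends y cy.
rewrite x1 x2 x3 x4 y1 y2 y3 y4; ring.
Qed.

Definition assemble (v : bool -> seq rat) (p q : rat) (c : bool -> nat -> rat) (r : bool -> rat) :
    H1vec D :=
  [ffun E : kan_edge m 0 => match E with
   | inl (inl (inl (t, i))) => nth 0 (v t) i
   | inl (inl (inr b)) => if b then q else p
   | inl (inr (t, k)) => c t k
   | inr (t, _) => r t
   end].

Section Assemble.
Variables (v : bool -> seq rat) (p q : rat) (c : bool -> nat -> rat) (r : bool -> rat).
Local Notation z := (assemble v p q c r).

Lemma assemble_inner t k : (k < 5)%N -> z (inner m 0 t k) = nth 0 (v t) k.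
Proof. by move=> hk; rewrite ffunE /= inordK. Qed.

Lemma assemble_col t k : (k <= m)%N -> z (col t k) = c t k.
Proof. by move=> hk; rewrite ffunE /= inordK. Qed.

Lemma assemble_A : z A = p. Proof. by rewrite ffunE. Qed.
Lemma assemble_C : z C = q. Proof. by rewrite ffunE. Qed.
Lemma assemble_w t : z (w t) = r t. Proof. by rewrite ffunE. Qed.

Definition assembleE := (assemble_inner, assemble_col, assemble_A, assemble_C, assemble_w).

Lemma assemble_twist :
  (forall k, c true k.+1 - c false k.+1 = - (c true k - c false k)) -> twist_cycle z.
Proof.
move=> cE; apply/allP=> k; rewrite mem_iota => /andP[_ km].
by rewrite /jump !assemble_col ?cE // ltnW.
Qed.

End Assemble.

Lemma kan_signature : knot_signature D 0.
Proof.
case om: (odd m).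
  have mn : m = m./2.*2.+1 by rewrite -[LHS]odd_double_half om.
  apply: (hyperbolic_signature (fun x y => @linking_form_odd _ x y mn)) => v1 v2 v3 v4.
  pose k := v4 + (2 + m./2%:R) * v3.
  pose j := v1 - v3 + v2.
  (* 2 a - u = - j and 3 u - a = - k *)
  pose u := - (2 * k + j) / 5; pose a := (- (j - u)) / 2.
  pose U (t : bool) := if t then u + v3 else u; pose B (t : bool) := if t then a + v1 else a.
  (* The edge at a along ca gets the value 0, so [U] is u on the left and u + d on the right;
     swapping the two values at every height makes [jump] alternate. *)
  pose z := assemble (fun t => [:: B t; U t; 0; 0; U t]) 0 (U false + U true)
    (fun t l => U (t (+) odd l)) (fun t => U t - B t).
  exists z.
    rewrite is_cycle_odd // /z !assembleE //= om /balanced /U /B.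
    rewrite assemble_twist ?andbT; last first.
      by move=> l /=; case: (odd l); rewrite /U /=; ring.
    by rewrite /=; do 7!(apply/andP; split; first by apply/eqP; ring); apply/eqP; ring.
  rewrite /jump /z !assembleE //= /U /B.
  by split; rewrite /a /u /j /k; field.
have mn : m = m./2.*2 by rewrite -[LHS]odd_double_half om.
apply: (hyperbolic_signature (fun x y => @linking_form_even _ x y mn)) => v1 v2 v3 v4.
(* Prescribing g and h amounts to u - 2a = j and 2u + a = k, a system of determinant 5, the
   determinant of the figure-eight knot. *)
pose j := v1 - v3 - v2; pose k := - v4 - (1 + m./2%:R) * v3.
pose u := (j + 2 * k) / 5; pose a := k - 2 * u.
pose U (t : bool) := if t then u + v3 else u; pose B (t : bool) := if t then a + v1 else a.
pose z := assemble (fun t => [:: 0; B t; U t + B t; U t; 0]) 0 0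
  (fun t l => U (t (+) odd l)) B.
exists z.
  rewrite is_cycle_even ?om // /z !assembleE //= om /balanced /U /B.
  rewrite assemble_twist ?andbT; last first.
    by move=> l /=; case: (odd l); rewrite /U /=; ring.
  by rewrite /=; do 7!(apply/andP; split; first by apply/eqP; ring); apply/eqP; ring.
rewrite /jump /z !assembleE //= /U /B.
by split; rewrite /a /u /j /k; field.
Qed.

End KanenobuSignature.

(** * The two closures of the outer tangle *)

Local Close Scope ring_scope.

(** * Finite maps on bit strings and sparse integer vectors *)

Inductive trie (V : Type) := Leaf | Node of option V & trie V & trie V.
Arguments Leaf {V}.

Section Trie.
Variable V : Type.

Fixpoint tget (t : trie V) (k : seq bool) : option V :=
  match t, k with
  | Leaf, _ => None
  | Node v _ _, [::] => v
  | Node _ l _, false :: k' => tget l k'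
  | Node _ _ r, true :: k' => tget r k'
  end.

Fixpoint tset (t : trie V) (k : seq bool) (x : V) : trie V :=
  match k, t with
  | [::], Leaf => Node (Some x) Leaf Leaf
  | [::], Node _ l r => Node (Some x) l r
  | false :: k', Leaf => Node None (tset Leaf k' x) Leaf
  | false :: k', Node v l r => Node v (tset l k' x) r
  | true :: k', Leaf => Node None Leaf (tset Leaf k' x)
  | true :: k', Node v l r => Node v l (tset r k' x)
  end.

Lemma tget_set t k x k' : tget (tset t k x) k' = if k == k' then Some x else tget t k'.
Proof.
elim: k t k' => [|b k IHk] t k'; first by case: t => [|v l r]; case: k' => [|[] k'].
by case: b; case: t => [|v l r]; case: k' => [|[] k'] //=; rewrite IHk.
Qed.

Fixpoint tall (p : V -> bool) (t : trie V) : bool :=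
  match t with
  | Leaf => true
  | Node v l r => [&& (if v is Some x then p x else true), tall p l & tall p r]
  end.

Lemma tallP p t k x : tall p t -> tget t k = Some x -> p x.
Proof.
elim: t k => [|v l IHl r IHr] [|b k] //= /and3P[pv pl pr]; first by move=> vx; rewrite vx in pv.
by case: b; [apply: IHr|apply: IHl].
Qed.

End Trie.

Definition memo_trie (V : Type) (f : seq bool -> V) (ks : seq (seq bool)) : trie V :=
  foldr (fun k t => tset t k (f k)) Leaf ks.

Lemma memo_trieE V (f : seq bool -> V) ks k :
  tget (memo_trie f ks) k = if k \in ks then Some (f k) else None.
Proof.
elim: ks => //= k' ks IHks; rewrite tget_set inE eq_sym IHks.
by have [->|] := eqVneq.
Qed.

(* Sparse integer vectors, as lists of (index, coefficient); indices may repeat. *)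
Definition svec := seq (seq bool * Z).

Definition lookup (t : trie svec) (k : seq bool) : svec :=
  if tget t k is Some l then l else [::].

Definition zadd (t : trie Z) (p : seq bool * Z) : trie Z :=
  tset t p.1 (Z.add p.2 (if tget t p.1 is Some z then z else Z0)).

Definition is_zero (l : svec) : bool :=
  tall (fun z => if z is Z0 then true else false) (foldl zadd Leaf l).

Definition scale (c : Z) (l : svec) : svec := [seq (p.1, Z.mul c p.2) | p <- l].

Definition bind (l : svec) (f : seq bool -> svec) : svec :=
  flatten [seq scale p.2 (f p.1) | p <- l].

Local Open Scope ring_scope.

Definition zrat (z : Z) : rat := (int_of_Z z)%:~R.

Lemma zratD x y : zrat (Z.add x y) = zrat x + zrat y.
Proof. by rewrite /zrat -intrD; congr (_%:~R); lia. Qed.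

Lemma zratM x y : zrat (Z.mul x y) = zrat x * zrat y.
Proof. by rewrite /zrat -intrM; congr (_%:~R); lia. Qed.

Lemma zrat0 : zrat Z0 = 0. Proof. by []. Qed.

Definition coef (l : svec) (k : seq bool) : rat :=
  \sum_(p <- l) (if p.1 == k then zrat p.2 else 0).

Lemma coef_nil k : coef [::] k = 0. Proof. exact: big_nil. Qed.

Lemma coef_cat l l' k : coef (l ++ l') k = coef l k + coef l' k.
Proof. exact: big_cat. Qed.

Lemma coef_scale c l k : coef (scale c l) k = zrat c * coef l k.
Proof.
rewrite /coef big_map mulr_sumr; apply: eq_bigr => p _ /=.
by case: eqP; rewrite ?mulr0 // zratM.
Qed.

Lemma coef_bind l f k : coef (bind l f) k = \sum_(p <- l) zrat p.2 * coef (f p.1) k.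
Proof.
elim: l => [|p l IHl]; first by rewrite coef_nil big_nil.
by rewrite /bind /= coef_cat coef_scale big_cons -IHl.
Qed.

Lemma is_zeroP l k : is_zero l -> coef l k = 0.
Proof.
have get t : zrat (if tget (foldl zadd t l) k is Some z then z else Z0) =
    zrat (if tget t k is Some z then z else Z0) + coef l k.
  elim: l t => [|p l IHl] t /=; first by rewrite coef_nil addr0.
  rewrite IHl /coef big_cons addrA; congr (_ + _); rewrite /zadd tget_set.
  by case: eqP => [->|_]; rewrite ?addr0 // zratD addrC.
move=> lz; have := get Leaf; rewrite /= zrat0 add0r => <-.
by case E: (tget _ _) => [z|//]; have := tallP lz E; case: (z).
Qed.

Definition mat (f : seq bool -> svec) (o o' : state) : rat := coef (f o) o'.

Definition vec (l : svec) : chain state := [ffun o => coef l (val o)].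

(** A sum over [state] sees only lists of length 26. The condition ensures that a composition of
    list-valued maps picks up nothing from other lists. *)
Definition proper (f : seq bool -> svec) := forall k, size k != 26%N -> f k = [::].

Lemma sum_coef l (F : seq bool -> rat) : (forall k, size k != 26%N -> F k = 0) ->
  \sum_(o : state) coef l o * F o = \sum_(p <- l) zrat p.2 * F p.1.
Proof.
move=> F0; elim: l => [|p l IHl].
  by rewrite big_nil big1 // => o _; rewrite coef_nil mul0r.
rewrite big_cons -IHl (eq_bigr (fun o : state =>
  (if p.1 == val o then zrat p.2 else 0) * F o + coef l o * F o)); last first.
  by move=> o _; rewrite -mulrDl /coef big_cons.
rewrite big_split /=; congr (_ + _); have [sp|np] := boolP (size p.1 == 26%N).
  rewrite (bigD1 (Tuple sp)) //= eqxx big1 ?addr0 // => o no.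
  case: eqP => [po|_]; last by rewrite mul0r.
  by case/eqP: no; apply: val_inj.
rewrite F0 // mulr0 big1 // => o _; case: eqP => [po|_]; last by rewrite mul0r.
by move: np; rewrite po size_tuple eqxx.
Qed.

Lemma matop_vec f l : proper f -> matop (mat f) (vec l) = vec (bind l f).
Proof.
move=> pf; apply/ffunP=> o; rewrite !ffunE coef_bind -(@sum_coef l (fun k => coef (f k) (val
  o))) => [|k hk]; last first.
  by rewrite pf ?coef_nil.
by apply: eq_bigr => o' _; rewrite ffunE.
Qed.

Lemma matop_mat f g x : proper f ->
  matop (mat f) (matop (mat g) x) = matop (mat (fun k => bind (g k) f)) x.
Proof.
move=> pf; apply/ffunP=> o; rewrite !ffunE.
rewrite (eq_bigr (fun a => \sum_b x b * (mat g b a * mat f a o))); last first.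
  by move=> a _; rewrite ffunE mulr_suml; apply: eq_bigr => b _; rewrite mulrA.
rewrite exchange_big /=; apply: eq_bigr => b _; rewrite -mulr_sumr; congr (_ * _).
rewrite /mat coef_bind -(@sum_coef _ (fun k => coef (f k) o)) // => k hk.
by rewrite pf ?coef_nil.
Qed.

Lemma matop_ext (A B : finType) (M N : A -> B -> rat) x :
  (forall a b, M a b = N a b) -> matop M x = matop N x.
Proof. by move=> MN; apply/ffunP=> b; rewrite !ffunE; apply: eq_bigr => a _; rewrite MN. Qed.

Lemma matopD (A B : finType) (M N : A -> B -> rat) x :
  matop (fun a b => M a b + N a b) x = matop M x + matop N x.
Proof.
apply/ffunP=> b; rewrite !ffunE -big_split /=; apply: eq_bigr => a _.
exact: mulrDr.
Qed.

Definition diff_zero (l l' : svec) := is_zero (l ++ scale (Zneg xH) l').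

Lemma diff_zeroP l l' k : diff_zero l l' -> coef l k = coef l' k.
Proof.
move=> h; have /eqP := is_zeroP k h; rewrite coef_cat coef_scale mulN1r subr_eq0.
by move/eqP.
Qed.

Definition table (f : seq bool -> svec) ks := lookup (memo_trie f ks).

Lemma tableE f ks k : table f ks k = if k \in ks then f k else [::].
Proof. by rewrite /table /lookup memo_trieE; case: ifP. Qed.

Lemma table_notin f ks k : k \notin ks -> table f ks k = [::].
Proof. by rewrite tableE => /negPf ->. Qed.

Local Close Scope ring_scope.

(** * Enumeration of the generators and tables of the maps *)

Fixpoint all_bits n : seq (seq bool) :=
  if n is n'.+1 then [seq false :: l | l <- all_bits n'] ++ [seq true :: l | l <- all_bits n']
  else [:: [::]].

Lemma mem_all_bits n l : size l = n -> l \in all_bits n.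
Proof.
elim: n l => [|n IHn] [|b l] //= [/IHn ln]; rewrite mem_cat.
by case: b; apply/orP; [right|left]; apply: map_f.
Qed.

Definition reps_trie := memo_trie reps (all_bits 9).

Definition fast_reps (bs : seq bool) : seq nat :=
  if tget reps_trie bs is Some r then r else reps bs.

Lemma fast_repsE bs : fast_reps bs = reps bs.
Proof. by rewrite /fast_reps memo_trieE; case: ifP. Qed.

Definition fast_rp t (o : seq bool) := fast_reps (rcons (take 8 o) t).

Lemma fast_rpE t o : fast_rp t o = rp t o. Proof. exact: fast_repsE. Qed.

(* Variants of the definitions for states that take the representatives as
   arguments, for the sake of sharing. *)
Definition valid_r (r : seq nat) (o : seq bool) :=
  (size o == 26) && all (fun x => lab o x == lab o (nth 0 r x)) (iota 0 18).

Definition agree_r (r : seq nat) (o o' : seq bool) a b :=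
  let ra := nth 0 r a in let rb := nth 0 r b in
  all (fun x => let rx := nth 0 r x in
    [|| rx == ra, rx == rb | lab o x == lab o' x]) (iota 0 18).

Definition coef_r (r : seq nat) (o : seq bool) a b (x y : bool) :=
  if nth 0 r a == nth 0 r b then comult_coef (lab o a) x y
  else mult_coef (lab o a) (lab o b) x.

Definition surgery_r (r : seq nat) k (o o' : seq bool) : bool :=
  let q := nth quad0 kan_quads k in
  let a := q.1.1.1 in let b := q.1.2 in
  [&& ~~ nth false (take 8 o) k,
      take 8 o' == take 8 (set_nth false (take 8 o) k true),
      agree_r r o o' a b & coef_r r o a b (lab o' a) (lab o' b)].

Lemma valid_fast t o : valid t o = valid_r (fast_rp t o) o.
Proof. by rewrite fast_rpE. Qed.

Lemma surgery_fast k t o o' : surgery k t o o' = surgery_r (fast_rp t o) k o o'.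
Proof. by rewrite fast_rpE. Qed.

Definition relabel (r : seq nat) a b (x y : bool) (l : seq bool) : seq bool :=
  let ra := nth 0 r a in let rb := nth 0 r b in
  [seq if p.1 == ra then x else if p.1 == rb then y else p.2 | p <- zip r l].

Definition bool_pairs := [:: (false, false); (false, true); (true, false); (true, true)].

Definition candidates k t t' (o : seq bool) : seq (seq bool) :=
  let q := nth quad0 kan_quads k in
  let a := q.1.1.1 in let b := q.1.2 in
  let r := fast_rp t o in
  let s := take 8 (set_nth false (take 8 o) k true) in
  let r' := fast_reps (rcons s t') in
  let same := nth 0 r' a == nth 0 r' b in
  if nth false (take 8 o) k then [::] else undup [seq o' <- [seq s ++ relabel r' a b p.1 p.2
    (drop 8 o) |
                     p <- bool_pairs & (same ==> (p.1 == p.2)) && coef_r r o a b p.1 p.2]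
         | surgery_r r k o o' && valid_r r' o'].

(** The circles near a crossing cover the same edges before and after the change of smoothing. Only
    the inclusion needed for the completeness of [candidates] is tested, on all 256 outer
    resolutions. *)
Definition planar k t t' (s : seq bool) : bool :=
  let q := nth quad0 kan_quads k in
  let a := q.1.1.1 in let b := q.1.2 in
  let r := fast_reps (rcons s t) in
  let r' := fast_reps (rcons (take 8 (set_nth false s k true)) t') in
  all (fun x => (nth 0 r x == nth 0 r a) || (nth 0 r x == nth 0 r b) ==>
    (nth 0 r' x == nth 0 r' a) || (nth 0 r' x == nth 0 r' b)) (iota 0 18).

Lemma all_planar : all (fun s =>
  all (fun k => planar k false false s && planar k true true s) (iota 0 8)
  && planar 8 false true s) (all_bits 8).
Proof. by vm_cast_no_check (erefl true). Qed.

Lemma quad_lt k : let q := nth quad0 kan_quads k in (q.1.1.1 < 18) && (q.1.2 < 18).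
Proof. by case: k => [|[|[|[|[|[|[|[|[|k]]]]]]]]] //=; rewrite nth_nil. Qed.

Lemma valid_lab t o x : valid t o -> x < 18 -> lab o (nth 0 (rp t o) x) = lab o x.
Proof. by case/andP=> _ /allP/(_ x) + hx; rewrite mem_iota => /(_ hx)/eqP. Qed.

Lemma nth_relabel r a b x y l i : size r = 18 -> size l = 18 -> i < 18 ->
  nth false (relabel r a b x y l) i =
  if nth 0 r i == nth 0 r a then x else if nth 0 r i == nth 0 r b then y else nth false l i.
Proof.
move=> sr sl hi; rewrite (nth_map (0, false)) ?size_zip ?sr ?sl //.
by rewrite nth_zip ?sr ?sl.
Qed.

Lemma uniq_candidates k t t' o : uniq (candidates k t t' o).
Proof. by rewrite /candidates; case: ifP => // _; apply: undup_uniq. Qed.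

(** By [planar], an edge off the new circles near the crossing was off the old ones, so its label is
    kept. Hence the target is determined by its labels at the two ends [a] and [b], and the four
    choices of these exhaust all targets. *)
Lemma mem_candidates k t t' (o o' : state) : planar k t t' (take 8 o) -> valid t o ->
  (val o' \in candidates k t t' o) = surgery k t o o' && valid t' o'.
Proof.
move=> pl vo; rewrite /candidates; case sk: (nth false _ k); first by rewrite /surgery sk andFb.
rewrite mem_undup mem_filter.
set s := take 8 _; set r := fast_rp t o; set r' := fast_reps _.
have /andP[ha hb] := quad_lt k; move: pl; rewrite /planar -/s -/r' -/(fast_rp t o) -/r.
set a := _.1.1.1 in ha *; set b := _.1.2 in hb * => pl.
rewrite surgery_fast; case sg: (surgery_r _ _ _ _); last by [].
rewrite !andTb.
have /and4P[_ /eqP t8 /allP ag cf] := sg.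
have r'E : rp t' o' = r' by rewrite /r' fast_repsE /rp t8.
have -> : valid_r r' o' = valid t' o' by rewrite -r'E.
case vo': (valid t' o'); last by [].
rewrite !andTb.
apply/mapP; exists (lab o' a, lab o' b).
  rewrite mem_filter cf andbT; apply/andP; split; last by case: (lab _ _); case: (lab _ _).
  by apply/implyP=> /eqP rab; rewrite /= -(valid_lab vo' ha) -(valid_lab vo' hb) r'E rab eqxx.
have sr' : size r' = 18 by rewrite /r' fast_repsE size_reps.
have sl : size (drop 8 o) = 18 by rewrite size_drop size_tuple.
rewrite -[LHS](cat_take_drop 8) t8; congr (_ ++ _).
apply: (@eq_from_nth _ false) => [|x]; rewrite size_drop size_tuple.
  by rewrite size_map size_zip sr' sl.
move=> hx; rewrite nth_relabel // !nth_drop -!/(lab _ _).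
case: eqP => [e|/eqP na]; first by rewrite -(valid_lab vo' hx) -(valid_lab vo' ha) r'E e.
case: eqP => [e|/eqP nb]; first by rewrite -(valid_lab vo' hx) -(valid_lab vo' hb) r'E e.
have xi : x \in iota 0 18 by rewrite mem_iota.
have /implyP := allP pl x xi; rewrite (negPf na) (negPf nb) /= => np.
by have /or3P[ra|rb|/eqP ->] := ag x xi; [move: np; rewrite ra => /(_ isT)|move: np;
  rewrite rb orbT => /(_ isT)|].
Qed.

(** Edges are labelled in increasing order; one that is not its own representative copies the label
    of its representative, which comes earlier. *)
Definition grow_labels (r : seq nat) (ls : seq (seq bool)) x : seq (seq bool) :=
  flatten [seq if nth 0 r x == x then [:: rcons l false; rcons l true]
               else [:: rcons l (nth false l (nth 0 r x))] | l <- ls].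

Definition all_labels (r : seq nat) := foldl (grow_labels r) [:: [::]] (iota 0 18).

Definition all_states t : seq (seq bool) :=
  [seq o <- flatten [seq [seq s ++ l | l <- all_labels (fast_reps (rcons s t))] | s <- all_bits 8]
   | valid_r (fast_rp t o) o].

Lemma reps_le bs x : x < 18 -> nth 0 (reps bs) x <= x.
Proof.
rewrite /reps; have : forall y, nth 0 (iota 0 18) y <= y.
  move=> y; have [hy|hy] := ltnP y 18; first by rewrite nth_iota.
  by rewrite nth_default.
have : 18 = size (iota 0 18) by []; move: (iota 0 18) (joins bs) => r l.
elim: l r => //= p l IHl r sr hr hx; apply: IHl => //; first by rewrite size_map.
move=> y; have [hy|hy] := ltnP y (size r); last by rewrite nth_default // size_map.
rewrite nth_merge //; case: eqP => // e; apply: leq_trans (hr y); rewrite e.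
by rewrite geq_min leq_max leqnn.
Qed.

Lemma mem_all_states t o : valid t o -> o \in all_states t.
Proof.
move=> vo; rewrite mem_filter -valid_fast vo andTb; have /andP[/eqP so _] := vo.
apply/flattenP; exists [seq take 8 o ++ l | l <- all_labels (fast_rp t o)].
  by apply/mapP; exists (take 8 o) => //; rewrite mem_all_bits // size_takel // so.
rewrite -[X in X \in _](cat_take_drop 8 o); apply: map_f.
rewrite fast_rpE /all_labels; set r := rp t o.
have sl : size (drop 8 o) = 18 by rewrite size_drop so.
have : forall n, n <= 18 -> take n (drop 8 o) \in foldl (grow_labels r) [:: [::]] (iota 0 n).
  elim=> [|n IHn] hn; first by rewrite take0.
  rewrite -addn1 iotaD foldl_cat /= addn1 (take_nth false) ?sl //.
  apply/flattenP; exists (if nth 0 r n == n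
    then [:: rcons (take n (drop 8 o)) false; rcons (take n (drop 8 o)) true]
    else [:: rcons (take n (drop 8 o)) (nth false (take n (drop 8 o)) (nth 0 r n))]).
    by apply/mapP; exists (take n (drop 8 o)) => //; apply/IHn/ltnW.
  case: eqP => [_|/eqP nr]; first by case: nth; rewrite !inE eqxx ?orbT.
  have rn : nth 0 r n < n by rewrite ltn_neqAle nr reps_le.
  by rewrite inE nth_take // !nth_drop -!/(lab _ _) (valid_lab vo hn).
by move=> /(_ 18 isT); rewrite take_oversize // sl.
Qed.

Lemma all_states_valid t o : o \in all_states t -> valid t o.
Proof. by rewrite mem_filter valid_fast => /andP[]. Qed.

Definition zsign (b : bool) : Z := if b then Zneg xH else Zpos xH.

Definition diff_list t (o : seq bool) : svec :=
  flatten [seq [seq (o', zsign (odd (count id (take k o)))) | o' <- candidates k t t o]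
           | k <- iota 0 8].

Definition saddle_list (o : seq bool) : svec :=
  [seq (o', Zpos xH) | o' <- candidates 8 false true o].

Definition dot_list p (o : seq bool) : svec :=
  if lab o p then
    let r := fast_rp true o in
    [seq (o', Zpos xH) |
      o' <- [:: take 8 o ++ relabel r p p false false (drop 8 o)] & valid_r r o']
  else [::].

Definition diff_table t := table (diff_list t) (all_states t).
Definition diff0 := diff_table false.
Definition diff1 := diff_table true.
Definition saddle0 := table saddle_list (all_states false).
Definition dot_bot := table (dot_list 13) (all_states true).
Definition dot_top := table (dot_list 14) (all_states true).

Local Open Scope ring_scope.

Lemma coef_uniq (l : seq (seq bool)) c o : uniq l ->
  coef [seq (o', c) | o' <- l] o = if o \in l then zrat c else 0.
Proof.
move=> ul; rewrite /coef big_map /=; case: ifP => ol; last first.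
  rewrite big1_seq // => o' /= ol'; case: eqP => // e.
  by rewrite -e ol' in ol.
rewrite (bigD1_seq o) //= eqxx big1 ?addr0 // => o' no.
by rewrite (negPf no).
Qed.

Lemma planar_diff k t (o : state) : (k < 8)%N -> planar k t t (take 8 o).
Proof.
move=> hk; have mb : take 8 o \in all_bits 8 by rewrite mem_all_bits // size_takel // size_tuple.
have ki : k \in iota 0 8 by rewrite mem_iota.
have /allP/(_ _ mb) := all_planar; move/andP=> [/allP h _]; move: (h k ki) => /andP[].
by case: t.
Qed.

Lemma planar_saddle (o : state) : planar 8 false true (take 8 o).
Proof.
have mb : take 8 o \in all_bits 8 by rewrite mem_all_bits // size_takel // size_tuple.
by have /allP/(_ _ mb) := all_planar; move/andP=> [].
Qed.

Lemma zrat_sign b : zrat (zsign b) = (-1) ^+ b.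
Proof. by case: b. Qed.

Lemma mat_table f t (o o' : state) :
  mat (table f (all_states t)) o o' = if valid t o then coef (f o) o' else 0.
Proof.
rewrite /mat tableE; case vo: (valid t o); first by rewrite mem_all_states.
by case: ifP => [/all_states_valid|_]; [rewrite vo|rewrite coef_nil].
Qed.

Lemma mat_diff t (o o' : state) : mat (diff_table t) o o' = state_diff t o o'.
Proof.
rewrite mat_table /state_diff; case vo: (valid t o); last by rewrite mul0r.
rewrite /diff_list /coef big_flatten big_map.
rewrite -[iota 0 8]/(index_iota 0 8) big_mkord mulr_sumr; apply: eq_bigr => k _.
rewrite -/(coef [seq (o1, zsign _) | o1 <- _] _) coef_uniq ?uniq_candidates //.
rewrite mem_candidates //; last exact: planar_diff.
by rewrite zrat_sign signr_odd; case: (surgery _ _ _ _); case: (valid _ _);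
  rewrite ?mul0r ?mulr0 ?mul1r ?mulr1.
Qed.

Lemma mat_saddle (o o' : state) : mat saddle0 o o' = saddle o o'.
Proof.
rewrite mat_table /saddle; case vo: (valid false o); last by rewrite andFb.
rewrite coef_uniq ?uniq_candidates // mem_candidates ?planar_saddle //.
by rewrite andTb andbC; case: (_ && _).
Qed.

Lemma mat_dot p (o o' : state) : (p < 18)%N ->
  mat (table (dot_list p) (all_states true)) o o' = dot p o o'.
Proof.
move=> hp; rewrite mat_table /dot; case vo: (valid true o); last by rewrite andFb.
rewrite andTb /dot_list /lowered; case: (lab o p); last by rewrite coef_nil andFb !andbF.
rewrite coef_uniq ?filter_uniq // mem_filter inE !andTb.
have rt : size (take 8 o) = 8 by rewrite size_takel // size_tuple.
have t8 l : take 8 (take 8 o ++ l) = take 8 o by rewrite take_size_cat.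
have sr : size (fast_rp true o) = 18 by rewrite fast_rpE size_reps.
have sl : size (drop 8 o) = 18 by rewrite size_drop size_tuple.
have -> : (valid_r (fast_rp true o) o' && (val o' == take 8 o ++ relabel (fast_rp true o) p p
  false false (drop 8 o)))
  = (valid true o' && [&& take 8 o' == take 8 o, ~~ lab o' p & agree true o o' p p]).
  have eqr : take 8 o' = take 8 o -> rp true o' = fast_rp true o by move=> e;
    rewrite fast_rpE /rp e.
  apply/andP/andP => [[vo' /eqP e]|[vo' /and3P[/eqP e np ag]]].
    have e8 : take 8 o' = take 8 o by rewrite e t8.
    have labE x : (x < 18)%N -> lab o' x = if nth 0%N (rp true o) x == nth 0%N (rp true o) p
      then false else lab o x.
      move=> hx; rewrite /lab e nth_cat rt ltnNge leq_addr addKn nth_relabel //.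
      by rewrite fast_rpE nth_drop; case: eqP.
    rewrite valid_fast fast_rpE eqr // vo' e8 eqxx labE // eqxx /=; split=> //.
    apply/allP=> x; rewrite mem_iota => /andP[_ hx]; rewrite labE //.
    by case: eqP => //= _; rewrite eqxx.
  move: (vo'); rewrite valid_fast fast_rpE eqr // => ->; split=> //.
  apply/eqP; rewrite -[LHS](cat_take_drop 8) e; congr (_ ++ _).
  apply: (@eq_from_nth _ false) => [|x]; rewrite size_drop size_tuple.
    by rewrite size_map size_zip sr sl.
  move=> hx; rewrite nth_relabel // !nth_drop -!/(lab _ _).
  have xi : x \in iota 0 18 by rewrite mem_iota.
  have := allP ag x xi; rewrite fast_rpE orbA orbb; case: eqP => [rx _|_ /eqP -> //].
  rewrite -(valid_lab vo' hx) eqr // fast_rpE rx -(fast_rpE) -eqr // valid_lab //.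
  exact/negbTE.
by case: (valid true o') => //=; case: (_ && _).
Qed.

Local Close Scope ring_scope.

(* The next definitions search for a contraction by Gaussian elimination; nothing
   is proved about them, since their output is checked below.  Coefficients are
   dyadic fractions, represented by their multiples by 64; vectors are sorted
   by decreasing index. *)
Fixpoint kcmp (k l : seq bool) : comparison :=
  match k, l with
  | [::], [::] => Eq
  | [::], _ => Lt
  | _, [::] => Gt
  | true :: _, false :: _ => Gt
  | false :: _, true :: _ => Lt
  | _ :: k', _ :: l' => kcmp k' l'
  end.

Definition six : Z := Zpos (xO (xI xH)).
Definition eight : Z := Zpos (xO (xO (xO xH))).
Definition one : Z := Z.mul eight eight.
Definition fmul (x y : Z) : Z := Z.shiftr (Z.mul x y) six.
Definition fdiv (x y : Z) : Z := Z.div (Z.shiftl x six) y.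

Fixpoint axpy (c : Z) (u : svec) : svec -> svec :=
  fix aux (v : svec) :=
  match u, v with
  | [::], _ => v
  | (k, x) :: u', [::] => (k, fmul c x) :: axpy c u' [::]
  | (k, x) :: u', (l, y) :: v' =>
      match kcmp k l with
      | Gt => (k, fmul c x) :: axpy c u' v
      | Lt => (l, y) :: aux v'
      | Eq => let z := Z.add (fmul c x) y in
              if Z.eqb z Z0 then axpy c u' v' else (l, z) :: axpy c u' v'
      end
  end.

Definition sort_svec (l : svec) : svec := foldr (fun p s => axpy one [:: p] s) [::] l.

(** A basis adapted to the differential, each vector stored at its leading index: a boundary with a
    chosen primitive, a vector of a complement of the cycles, or a cycle representing a homology
    class. *)
Inductive role := Boundary of svec & svec | Transverse of svec | Harmonic of svec.

Definition leading (l : svec) : Z := if l is (_, c) :: _ then c else Z0.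

Fixpoint reduce_diff (fuel : nat) (t : trie role) (v dv : svec) : svec * svec :=
  if fuel is fuel'.+1 then
    match dv with
    | (k, c) :: _ =>
        match tget t k with
        | Some (Boundary b pre) =>
            let x := Z.opp (fdiv c (leading b)) in
            reduce_diff fuel' t (axpy x pre v) (axpy x b dv)
        | _ => (v, dv)
        end
    | [::] => (v, dv)
    end
  else (v, dv).

Definition eliminate (d : seq bool -> svec) (t : trie role) (k : seq bool) : trie role :=
  match tget t k with
  | Some _ => t
  | None =>
      match reduce_diff 1000 t [:: (k, one)] (sort_svec (scale one (d k))) with
      | (v, [::]) => tset t k (Harmonic v)
      | (v, ((l, _) :: _) as dv) => tset (tset t l (Boundary dv v)) k (Transverse v)
      end
  end.

Fixpoint decompose (fuel : nat) (t : trie role) (u h r : svec) : svec * svec :=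
  if fuel is fuel'.+1 then
    match u with
    | (k, c) :: _ =>
        match tget t k with
        | Some (Boundary b pre) =>
            let x := fdiv c (leading b) in
            decompose fuel' t (axpy (Z.opp x) b u) (axpy x pre h) r
        | Some (Transverse b) =>
            decompose fuel' t (axpy (Z.opp (fdiv c (leading b))) b u) h r
        | Some (Harmonic b) =>
            let x := fdiv c (leading b) in
            decompose fuel' t (axpy (Z.opp x) b u) h ((k, x) :: r)
        | None => (h, r)
        end
    | [::] => (h, r)
    end
  else (h, r).

Definition by_weight (ks : seq (seq bool)) : seq (seq bool) :=
  flatten [seq [seq k <- ks | count id (take 8 k) == w] | w <- iota 0 9].

Definition elimination d ks : trie role := foldl (eliminate d) Leaf (by_weight ks).

Definition roles0 := elimination diff0 (all_states false).
Definition roles1 := elimination diff1 (all_states true).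

Definition div_scale (c : Z) (l : svec) : svec := [seq (p.1, Z.div p.2 c) | p <- l].

Definition harmonic_part (t : trie role) (k : seq bool) :=
  decompose 1000 t [:: (k, one)] [::] [::].

(* All the contractions are multiplied by 8. *)
Definition contr0 := table (fun k => div_scale eight (harmonic_part roles0 k).1) (all_states false).
Definition contr1 := table (fun k => div_scale eight (harmonic_part roles1 k).1) (all_states true).

Definition harmonic_vector (x : option role) : svec :=
  if x is Some (Harmonic v) then v else [::].

Definition harmonic_states : seq (seq bool) :=
  [seq k <- all_states true | harmonic_vector (tget roles1 k) != [::]].

Definition harmonic_cycle (n : nat) : svec :=
  harmonic_vector (tget roles1 (nth [::] harmonic_states n)).

(* The index [:: k; l] stands for the class X^k Y^l of two_circles. *)
Definition harmonic_basis (u : seq bool) : svec :=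
  if u == [:: false; false] then div_scale one (scale (Zpos (xO xH)) (harmonic_cycle 3))
  else if u == [:: true; false] then div_scale one (harmonic_cycle 1 ++ harmonic_cycle 2)
  else if u == [:: false; true] then
    div_scale one (harmonic_cycle 2 ++ scale (Zneg xH) (harmonic_cycle 1))
  else if u == [:: true; true] then div_scale one (scale (Zpos (xO xH)) (harmonic_cycle 0))
  else [::].

(** In order, the four harmonic cycles represent XY, X - Y, X + Y and 1. Passing to X and Y would
    introduce halves, so [harmonic_basis] represents twice the classes and this list carries four
    times the coordinates; the product 8 matches the scaling of the contraction. *)
Definition projection_list (k : seq bool) : svec :=
  flatten [seq
    let x := Z.div p.2 (Z.mul (Zpos (xO xH)) eight) in
    let n := index p.1 harmonic_states in
    if n == 0 then [:: ([:: true; true], x)]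
    else if n == 1 then [:: ([:: true; false], x); ([:: false; true], Z.opp x)]
    else if n == 2 then [:: ([:: true; false], x); ([:: false; true], x)]
    else [:: ([:: false; false], x)] | p <- (harmonic_part roles1 k).2].

Definition projection := table projection_list (all_states true).

Definition generator : svec := harmonic_basis [:: false; false].

Definition reverse_saddle (o : seq bool) : svec :=
  let r := fast_rp true o in let r' := fast_rp false o in
  let same := nth 0 r' 12 == nth 0 r' 15 in
  [seq (take 8 o ++ relabel r' 12 15 p.1 p.2 (drop 8 o), Zpos xH) |
    p <- bool_pairs & (same ==> (p.1 == p.2)) && coef_r r o 12 15 p.1 p.2].

(** Neck cutting: the reverse saddle followed by the saddle is multiplication by X + Y. Applied to 1
    it produces X + Y, and applied to X it produces X(X + Y) = XY, the value wanted from
    [cycle2]. *)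
Definition cycle1 : svec := bind generator reverse_saddle.
Definition cycle2 : svec := bind (bind generator dot_bot) reverse_saddle.

(* The weight and the numbers of circles labelled v+ and v-. *)
Definition degree t (k : seq bool) : nat * nat * nat :=
  let r := fast_rp t k in
  (state_weight t k, count (fun x => (nth 0 r x == x) && lab k x) (iota 0 18),
   count (fun x => (nth 0 r x == x) && ~~ lab k x) (iota 0 18)).

Definition degrees t := memo_trie (degree t) (all_states t).
Definition degrees0 := degrees false.
Definition degrees1 := degrees true.

Definition test_degree (t : bool) (P : nat * nat * nat -> bool) (k : seq bool) : bool :=
  if tget (if t then degrees1 else degrees0) k is Some x then P x else false.

(** The equation between quantum degrees, with the subtracted terms moved across so that it can be
    tested in [nat]. *)
Definition raises (dw : nat) (dq : nat) t t' (f : seq bool -> svec) k :=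
  test_degree t (fun x => all (fun p => test_degree t' (fun y =>
    (y.1.1 == x.1.1 + dw) && (y.1.2 + x.2 + y.1.1 + dq == x.1.2 + y.2 + x.1.1)) p.1) (f k)) k.

Definition lowers t (f : seq bool -> svec) k :=
  test_degree t (fun x => all (fun p => test_degree t (fun y =>
    (y.1.1 + 1 == x.1.1) && (y.1.2 + x.2 + y.1.1 == x.1.2 + y.2 + x.1.1)) p.1) (f k)) k.

Definition has_degree t w q (l : svec) :=
  all (fun p => test_degree t (fun x => (x.1.1 == w) && (x.1.2 + x.1.1 == x.2 + q)) p.1) l.

(** The last clause exempts the diagonals j - 2i = -3 and j - 2i = -5, which normalize to -1 + 2 and
    -1. They carry the homology of K(0,0), so no contraction exists on all of them. *)
Definition check0 (k : seq bool) : bool :=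
  [&& is_zero (bind (diff0 k) diff0),
      diff_zero (bind (diff0 k) saddle0) (bind (saddle0 k) diff1),
      diff_zero (bind (saddle0 k) dot_bot) (bind (saddle0 k) dot_top),
      raises 1 0 false false diff0 k,
      raises 1 0 false true saddle0 k,
      lowers false contr0 k
    & test_degree false (fun x => (x.1.2 + 3 == x.2 + x.1.1) || (x.1.2 + 5 == x.2 + x.1.1)) k
      || diff_zero [:: (k, eight)] (bind (contr0 k) diff0 ++ bind (diff0 k) contr0)].

Definition check1 (k : seq bool) : bool :=
  [&& is_zero (bind (diff1 k) diff1),
      diff_zero (bind (diff1 k) dot_bot) (bind (dot_bot k) diff1),
      diff_zero (bind (diff1 k) dot_top) (bind (dot_top k) diff1),
      is_zero (bind (dot_bot k) dot_bot),
      is_zero (bind (dot_top k) dot_top),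
      diff_zero (bind (dot_top k) dot_bot) (bind (dot_bot k) dot_top),
      raises 1 0 true true diff1 k
    & [&& raises 0 2 true true dot_bot k,
      raises 0 2 true true dot_top k,
      lowers true contr1 k,
      is_zero (bind (diff1 k) projection),
      all (fun p => test_degree true (fun x => (x.1.1 == 5) &&
        (x.1.2 + 2 * count id p.1 == x.2 + 2)) k) (projection k)
    & diff_zero [:: (k, eight)] (bind (contr1 k) diff1 ++ bind (diff1 k) contr1
        ++ bind (projection k) harmonic_basis)]].

Definition check_basis (u : bool * bool) : bool :=
  let e := harmonic_basis [:: u.1; u.2] in
  diff_zero (bind (bind e dot_bot) projection)
    (if u.1 then [::] else [:: ([:: true; u.2], eight)])
  && diff_zero (bind (bind e dot_top) projection)
    (if u.2 then [::] else [:: ([:: u.1; true], eight)]).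

Definition check_cycles : bool :=
  [&& has_degree true 5 7 generator, is_zero (bind generator diff1),
      diff_zero (bind generator projection) [:: ([:: false; false], eight)],
      has_degree false 4 5 cycle1, has_degree false 4 3 cycle2,
      is_zero (bind cycle1 diff0), is_zero (bind cycle2 diff0),
      diff_zero (bind cycle1 saddle0) (bind generator dot_bot ++ bind generator dot_top)
    & diff_zero (bind cycle2 saddle0) (bind (bind generator dot_top) dot_bot)].

Definition check_all : bool :=
  [&& all check0 (all_states false), all check1 (all_states true),
      all check_basis bool_pairs & check_cycles].

(** The evaluation that runs the elimination and tests its output on every generator of both
    closures. *)
Lemma check_allE : check_all.
Proof. vm_cast_no_check (erefl true). Qed.

Local Open Scope ring_scope.

Local Notation d0 := (state_diff false).
Local Notation d1 := (state_diff true).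
Local Notation g0 := (state_grading false).
Local Notation g1 := (state_grading true).
Local Notation xa := (dot 13).
Local Notation xb := (dot 14).

Lemma degree_grading t (o : state) i j : state_grading t o i j =
  [&& valid t o, i == (degree t o).1.1%:Z &
      j == (degree t o).1.2%:Z - (degree t o).2%:Z + (degree t o).1.1%:Z].
Proof.
rewrite /state_grading /degree /outer_circles !fast_rpE.
rewrite (eq_count (a2 := fun x => (nth 0%N (rp t o) x == x) && lab o x)); last first.
  by move=> x; case: (lab o x).
rewrite [X in - X%:Z](eq_count (a2 := fun x => (nth 0%N (rp t o) x == x) && ~~ lab o x)) //.
by move=> x; case: (lab o x).
Qed.

Lemma coef_neq0 l k : coef l k != 0 -> exists2 p, p \in l & p.1 = k.
Proof.
elim: l => [|p l IHl]; first by rewrite coef_nil eqxx.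
rewrite /coef big_cons; case: (p.1 =P k) => [pk _|_].
  by exists p => //; apply: mem_head.
rewrite add0r => /IHl[q ql qk]; exists q => //; by rewrite inE ql orbT.
Qed.

Lemma mat_hom t t' f i j i' j' x :
    (forall o o' : state, state_grading t o i j -> mat f o o' != 0 -> state_grading t' o' i' j') ->
  homogeneous (state_grading t) i j x -> homogeneous (state_grading t') i' j' (matop (mat f) x).
Proof.
move=> fh hx o'; rewrite ffunE => /eqP s0; apply/negPn/negP => ng; apply: s0.
rewrite big1 // => o _; have [->|xo] := eqVneq (x o) 0; first by rewrite mul0r.
have [->|fo] := eqVneq (mat f o o') 0; first by rewrite mulr0.
by rewrite (fh o o' (hx o xo) fo) in ng.
Qed.

Lemma zrat8 : zrat eight = 8. Proof. by []. Qed.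

Lemma coef_single (c : Z) (k k' : seq bool) : coef [:: (k, c)] k' = if k == k' then zrat c else 0.
Proof. by rewrite /coef big_seq1. Qed.

Lemma matop_scalar t i j (f : seq bool -> svec) x :
    (forall o : state, state_grading t o i j -> diff_zero [:: (val o, eight)] (f o)) ->
  homogeneous (state_grading t) i j x -> 8 *: x = matop (mat f) x.
Proof.
move=> ff hx; apply/ffunP=> o'; rewrite !ffunE -[8 *: _]/(8 * _).
rewrite (eq_bigr (fun o => 8 * (x o * (o == o')%:R))) => [|o _].
  by rewrite -mulr_sumr (bigD1 o') //= eqxx mulr1 big1 ?addr0 // => o /negPf ->; rewrite mulr0.
have [->|/hx go] := eqVneq (x o) 0; first by rewrite !mul0r mulr0.
rewrite /mat -(diff_zeroP _ (ff o go)) coef_single mulrCA -val_eqE.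
by case: eqP; rewrite ?mulr1 ?mulr0.
Qed.

Local Opaque degree.

Definition supported t (f : seq bool -> svec) := forall k, ~~ valid t k -> f k = [::].

Definition shifts (dw dq : nat) t t' (f : seq bool -> svec) := forall k p, valid t k -> p \in f k ->
  let x := degree t k in let y := degree t' p.1 in
  [/\ valid t' p.1, y.1.1 = (x.1.1 + dw)%N
    & (y.1.2 + x.2 + y.1.1 + dq = x.1.2 + y.2 + x.1.1)%N].

Definition unshifts t (f : seq bool -> svec) := forall k p, valid t k -> p \in f k ->
  let x := degree t k in let y := degree t p.1 in
  [/\ valid t p.1, (y.1.1 + 1 = x.1.1)%N & (y.1.2 + x.2 + y.1.1 = x.1.2 + y.2 + x.1.1)%N].

Definition located t w q (l : svec) := forall p, p \in l ->
  let x := degree t p.1 in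
  [/\ valid t p.1, x.1.1 = w & (x.1.2 + x.1.1 = x.2 + q)%N].

Definition bool_keys : seq (seq bool) := [seq [:: u.1; u.2] | u <- bool_pairs].

Lemma supported_proper t f : supported t f -> proper f.
Proof. by move=> sf k nk; apply: sf; rewrite /valid negb_and nk. Qed.

Lemma mat_supported_eq t f g x : supported t f -> supported t g ->
    (forall k, valid t k -> diff_zero (f k) (g k)) ->
  matop (mat f) x = matop (mat g) x.
Proof.
move=> sf sg fg; apply: matop_ext => o o'; rewrite /mat.
by have [/fg h|nk] := boolP (valid t o); [exact: diff_zeroP|rewrite sf // sg].
Qed.

Lemma matop_mat_eq t f g f' g' x : proper f -> proper f' -> supported t g -> supported t g' ->
    (forall k, valid t k -> diff_zero (bind (g k) f) (bind (g' k) f')) ->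
  matop (mat f) (matop (mat g) x) = matop (mat f') (matop (mat g') x).
Proof.
move=> pf pf' sg sg' fg; rewrite !matop_mat //; apply: (@mat_supported_eq t) => // k nk.
  by rewrite sg.
by rewrite sg'.
Qed.

Lemma matop_mat_eq0 t f g x : proper f -> supported t g ->
    (forall k, valid t k -> is_zero (bind (g k) f)) ->
  matop (mat f) (matop (mat g) x) = 0.
Proof.
move=> pf sg fg; rewrite matop_mat //; apply/ffunP=> o'; rewrite !ffunE big1 // => o _.
rewrite /mat; have [/fg h|nk] := boolP (valid t o); last by rewrite sg // coef_nil mulr0.
by rewrite (is_zeroP _ h) mulr0.
Qed.

Lemma shifts_hom t t' dw dq f i j x : shifts dw dq t t' f ->
  homogeneous (state_grading t) i j x ->
  homogeneous (state_grading t') (i + dw%:Z) (j - dq%:Z) (matop (mat f) x).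
Proof.
move=> rf; apply: mat_hom => o o'; rewrite !degree_grading => /and3P[vo /eqP -> /eqP ->].
move=> /coef_neq0[p pf po']; case: (rf _ _ vo pf); rewrite po' => -> ew eq.
by apply/andP; split; apply/eqP; lia.
Qed.

Lemma unshifts_hom t f i j x : unshifts t f ->
  homogeneous (state_grading t) i j x ->
  homogeneous (state_grading t) (i - 1) j (matop (mat f) x).
Proof.
move=> rf; apply: mat_hom => o o'; rewrite !degree_grading => /and3P[vo /eqP -> /eqP ->].
move=> /coef_neq0[p pf po']; case: (rf _ _ vo pf); rewrite po' => -> ew eq.
by apply/andP; split; apply/eqP; lia.
Qed.

Lemma located_hom t w q l c : located t w q l ->
  homogeneous (state_grading t) w%:Z q%:Z (c *: vec l).
Proof.
move=> hl; apply: homogeneousZ => o; rewrite ffunE -[val o]/(tval o) => /coef_neq0[p pl po].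
case: (hl p pl); rewrite po degree_grading => -> ew eq.
by apply/andP; split; apply/eqP; lia.
Qed.

Lemma vec_eq l l' : diff_zero l l' -> vec l = vec l'.
Proof. by move=> h; apply/ffunP=> o; rewrite !ffunE (diff_zeroP _ h). Qed.

Lemma vec_eq0 l : is_zero l -> vec l = 0.
Proof. by move=> h; apply/ffunP=> o; rewrite !ffunE (is_zeroP _ h). Qed.

Lemma sum_coef2 (l : svec) (F : seq bool -> rat) :
  (forall k, k \notin bool_keys -> F k = 0) ->
  \sum_(p <- l) zrat p.2 * F p.1 = \sum_(u : bool * bool) coef l [:: u.1; u.2] * F [:: u.1; u.2].
Proof.
move=> F0; elim: l => [|p l IHl].
  by rewrite big_nil big1 // => u _; rewrite coef_nil mul0r.
rewrite big_cons IHl [RHS](eq_bigr (fun u : bool * bool =>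
  (if p.1 == [:: u.1; u.2] then zrat p.2 else 0) * F [:: u.1; u.2]
   + coef l [:: u.1; u.2] * F [:: u.1; u.2]) ); last first.
  by move=> u _; rewrite -mulrDl /coef big_cons.
rewrite big_split /=; congr (_ + _).
have [/mapP[u _ pu]|np] := boolP (p.1 \in bool_keys).
  rewrite (bigD1 u) //= pu eqxx big1 ?addr0 // => -[v1 v2] nvu.
  case: eqP => [[e1 e2]|]; last by rewrite mul0r.
  by case/eqP: nvu; rewrite (surjective_pairing u) e1 e2.
rewrite F0 // mulr0 big1 // => -[v1 v2] _; case: eqP => [pv|]; last by rewrite mul0r.
by case/negP: np; rewrite pv; case: v1 {pv}; case: v2.
Qed.

(** All that the rest of the argument uses of the outer tangle. The field [d0_exact] is the
    vanishing of the homology of K(0,0) off the two diagonals. *)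
Record closure_spec : Prop := ClosureSpec {
  d0_d0 : forall x, matop d0 (matop d0 x) = 0;
  d1_d1 : forall x, matop d1 (matop d1 x) = 0;
  saddle_d : forall x, matop saddle (matop d0 x) = matop d1 (matop saddle x);
  xa_saddle : forall x, matop xa (matop saddle x) = matop xb (matop saddle x);
  xa_d1 : forall x, matop xa (matop d1 x) = matop d1 (matop xa x);
  xb_d1 : forall x, matop xb (matop d1 x) = matop d1 (matop xb x);
  xa_xa : forall x, matop xa (matop xa x) = 0;
  xb_xb : forall x, matop xb (matop xb x) = 0;
  xa_xb : forall x, matop xa (matop xb x) = matop xb (matop xa x);
  d0_hom : forall i j x, homogeneous g0 i j x -> homogeneous g0 (i + 1) j (matop d0 x);
  d1_hom : forall i j x, homogeneous g1 i j x -> homogeneous g1 (i + 1) j (matop d1 x);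
  saddle_hom : forall i j x, homogeneous g0 i j x -> homogeneous g1 (i + 1) j (matop saddle x);
  xa_hom : forall i j x, homogeneous g1 i j x -> homogeneous g1 i (j - 2) (matop xa x);
  xb_hom : forall i j x, homogeneous g1 i j x -> homogeneous g1 i (j - 2) (matop xb x);
  d0_exact : forall i j z, j - 2 * i != -3 -> j - 2 * i != -5 ->
    homogeneous g0 i j z -> matop d0 z = 0 ->
    exists2 y, homogeneous g0 (i - 1) j y & z = matop d0 y;
  hom_twist_states : forall m i j,
    hom (@grC state g0 g1 m) (@dC state d0 d1 saddle xa xb m) i j
      + ((i == 4) && ((j == 5) || (j == 3)))%:Z =
    hom g0 d0 i j + ((i == 4 + m%:Z) && ((j == 5 + 2 * m%:Z) || (j == 3 + 2 * m%:Z)))%:Z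
}.

(** * From the checked identities to the two closures *)

Section Certificate.
Variables diff0 diff1 saddle0 dot_bot dot_top contr0 contr1 projection : seq bool -> svec.
Variables (harmonic_basis : seq bool -> svec) (cycle1 cycle2 : svec).
Let generator := harmonic_basis [:: false; false].

Hypothesis mat_diff0 : forall o o' : state, mat diff0 o o' = d0 o o'.
Hypothesis mat_diff1 : forall o o' : state, mat diff1 o o' = d1 o o'.
Hypothesis mat_saddle0 : forall o o' : state, mat saddle0 o o' = saddle o o'.
Hypothesis mat_bot : forall o o' : state, mat dot_bot o o' = xa o o'.
Hypothesis mat_top : forall o o' : state, mat dot_top o o' = xb o o'.

Hypothesis diff0_supported : supported false diff0.
Hypothesis saddle0_supported : supported false saddle0.
Hypothesis contr0_supported : supported false contr0.
Hypothesis diff1_supported : supported true diff1.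
Hypothesis bot_supported : supported true dot_bot.
Hypothesis top_supported : supported true dot_top.
Hypothesis contr1_supported : supported true contr1.
Hypothesis projection_supported : supported true projection.
Hypothesis basis_supported : forall k, k \notin bool_keys -> harmonic_basis k = [::].

Hypothesis diff0_diff0 : forall k, valid false k -> is_zero (bind (diff0 k) diff0).
Hypothesis diff0_saddle : forall k, valid false k ->
  diff_zero (bind (diff0 k) saddle0) (bind (saddle0 k) diff1).
Hypothesis saddle_bot : forall k, valid false k ->
  diff_zero (bind (saddle0 k) dot_bot) (bind (saddle0 k) dot_top).
Hypothesis diff0_shifts : shifts 1 0 false false diff0.
Hypothesis saddle0_shifts : shifts 1 0 false true saddle0.
Hypothesis contr0_shifts : unshifts false contr0.
Hypothesis contraction0 : forall k, valid false k ->
  let x := degree false k in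
  (x.1.2 + 3 == x.2 + x.1.1)%N || (x.1.2 + 5 == x.2 + x.1.1)%N
    || diff_zero [:: (k, eight)] (bind (contr0 k) diff0 ++ bind (diff0 k) contr0).

Hypothesis diff1_diff1 : forall k, valid true k -> is_zero (bind (diff1 k) diff1).
Hypothesis diff1_bot : forall k, valid true k ->
  diff_zero (bind (diff1 k) dot_bot) (bind (dot_bot k) diff1).
Hypothesis diff1_top : forall k, valid true k ->
  diff_zero (bind (diff1 k) dot_top) (bind (dot_top k) diff1).
Hypothesis bot_bot : forall k, valid true k -> is_zero (bind (dot_bot k) dot_bot).
Hypothesis top_top : forall k, valid true k -> is_zero (bind (dot_top k) dot_top).
Hypothesis top_bot : forall k, valid true k ->
  diff_zero (bind (dot_top k) dot_bot) (bind (dot_bot k) dot_top).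
Hypothesis diff1_shifts : shifts 1 0 true true diff1.
Hypothesis bot_shifts : shifts 0 2 true true dot_bot.
Hypothesis top_shifts : shifts 0 2 true true dot_top.
Hypothesis contr1_shifts : unshifts true contr1.
Hypothesis diff1_projection : forall k, valid true k -> is_zero (bind (diff1 k) projection).
Hypothesis projection_shifts : forall k p, valid true k -> p \in projection k ->
  let x := degree true k in x.1.1 = 5 /\ (x.1.2 + 2 * count id p.1 = x.2 + 2)%N.
Hypothesis contraction1 : forall k, valid true k ->
  diff_zero [:: (k, eight)] (bind (contr1 k) diff1 ++ bind (diff1 k) contr1
    ++ bind (projection k) harmonic_basis).

Hypothesis basis_bot : forall u : bool * bool,
  diff_zero (bind (bind (harmonic_basis [:: u.1; u.2]) dot_bot) projection)
    (if u.1 then [::] else [:: ([:: true; u.2], eight)]).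
Hypothesis basis_top : forall u : bool * bool,
  diff_zero (bind (bind (harmonic_basis [:: u.1; u.2]) dot_top) projection)
    (if u.2 then [::] else [:: ([:: u.1; true], eight)]).

Hypothesis generator_located : located true 5 7 generator.
Hypothesis cycle1_located : located false 4 5 cycle1.
Hypothesis cycle2_located : located false 4 3 cycle2.
Hypothesis generator_diff : is_zero (bind generator diff1).
Hypothesis cycle1_diff : is_zero (bind cycle1 diff0).
Hypothesis cycle2_diff : is_zero (bind cycle2 diff0).
Hypothesis generator_projection :
  diff_zero (bind generator projection) [:: ([:: false; false], eight)].
Hypothesis cycle1_saddle :
  diff_zero (bind cycle1 saddle0) (bind generator dot_bot ++ bind generator dot_top).
Hypothesis cycle2_saddle :
  diff_zero (bind cycle2 saddle0) (bind (bind generator dot_top) dot_bot).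

Let diff0_proper := supported_proper diff0_supported.
Let saddle0_proper := supported_proper saddle0_supported.
Let contr0_proper := supported_proper contr0_supported.
Let diff1_proper := supported_proper diff1_supported.
Let bot_proper := supported_proper bot_supported.
Let top_proper := supported_proper top_supported.
Let contr1_proper := supported_proper contr1_supported.
Let projection_proper := supported_proper projection_supported.

Let matop_d0 x : matop d0 x = matop (mat diff0) x.
Proof. by apply: matop_ext => o o'; rewrite -mat_diff0. Qed.
Let matop_d1 x : matop d1 x = matop (mat diff1) x.
Proof. by apply: matop_ext => o o'; rewrite -mat_diff1. Qed.
Let matop_saddle x : matop saddle x = matop (mat saddle0) x.
Proof. by apply: matop_ext => o o'; rewrite -mat_saddle0. Qed.
Let matop_xa x : matop xa x = matop (mat dot_bot) x.
Proof. by apply: matop_ext => o o'; rewrite -mat_bot. Qed.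
Let matop_xb x : matop xb x = matop (mat dot_top) x.
Proof. by apply: matop_ext => o o'; rewrite -mat_top. Qed.

Let d0_d0 x : matop d0 (matop d0 x) = 0.
Proof. by rewrite !matop_d0; apply: matop_mat_eq0 diff0_diff0. Qed.

Let d1_d1 x : matop d1 (matop d1 x) = 0.
Proof. by rewrite !matop_d1; apply: matop_mat_eq0 diff1_diff1. Qed.

Let saddle_d x : matop saddle (matop d0 x) = matop d1 (matop saddle x).
Proof. by rewrite matop_d1 matop_d0 !matop_saddle; apply: matop_mat_eq diff0_saddle. Qed.

Let xa_saddle x : matop xa (matop saddle x) = matop xb (matop saddle x).
Proof. by rewrite matop_xa matop_xb matop_saddle; apply: matop_mat_eq saddle_bot. Qed.

Let xa_d1 x : matop xa (matop d1 x) = matop d1 (matop xa x).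
Proof. by rewrite !matop_d1 !matop_xa; apply: matop_mat_eq diff1_bot. Qed.

Let xb_d1 x : matop xb (matop d1 x) = matop d1 (matop xb x).
Proof. by rewrite !matop_d1 !matop_xb; apply: matop_mat_eq diff1_top. Qed.

Let xa_xa x : matop xa (matop xa x) = 0.
Proof. by rewrite !matop_xa; apply: matop_mat_eq0 bot_bot. Qed.

Let xb_xb x : matop xb (matop xb x) = 0.
Proof. by rewrite !matop_xb; apply: matop_mat_eq0 top_top. Qed.

Let xa_xb x : matop xa (matop xb x) = matop xb (matop xa x).
Proof. by rewrite !matop_xa !matop_xb; apply: matop_mat_eq top_bot. Qed.

Let d0_hom i j x : homogeneous g0 i j x -> homogeneous g0 (i + 1) j (matop d0 x).
Proof. by move/(shifts_hom diff0_shifts); rewrite matop_d0 subr0. Qed.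

Let d1_hom i j x : homogeneous g1 i j x -> homogeneous g1 (i + 1) j (matop d1 x).
Proof. by move/(shifts_hom diff1_shifts); rewrite matop_d1 subr0. Qed.

Let saddle_hom i j x : homogeneous g0 i j x -> homogeneous g1 (i + 1) j (matop saddle x).
Proof. by move/(shifts_hom saddle0_shifts); rewrite matop_saddle subr0. Qed.

Let xa_hom i j x : homogeneous g1 i j x -> homogeneous g1 i (j - 2) (matop xa x).
Proof. by move/(shifts_hom bot_shifts); rewrite matop_xa addr0. Qed.

Let xb_hom i j x : homogeneous g1 i j x -> homogeneous g1 i (j - 2) (matop xb x).
Proof. by move/(shifts_hom top_shifts); rewrite matop_xb addr0. Qed.

Let d0_exact i j z : j - 2 * i != -3 -> j - 2 * i != -5 ->
  homogeneous g0 i j z -> matop d0 z = 0 ->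
  exists2 y, homogeneous g0 (i - 1) j y & z = matop d0 y.
Proof.
move=> j3 j5 hz dz; pose y := matop (mat contr0) z.
have hy : homogeneous g0 (i - 1) j y by apply: unshifts_hom hz.
(* The tables contain eight times a contraction, so that their entries are integers. *)
exists (8^-1 *: y); first exact: homogeneousZ.
have E : 8 *: z = matop (mat (fun k => bind (contr0 k) diff0 ++ bind (diff0 k) contr0)) z.
  apply: matop_scalar hz => o; rewrite degree_grading => /and3P[vo /eqP ei /eqP ej].
  have /orP[h|//] := contraction0 vo; exfalso.
  move: j3 j5 h; rewrite ei ej; case: (degree _ _) => -[w p] n /= j3 j5; clear -j3 j5.
  by case/orP=> /eqP h; [case/eqP: j3|case/eqP: j5]; lia.
have E2 : matop (mat (fun k => bind (contr0 k) diff0 ++ bind (diff0 k) contr0)) z =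
    matop (mat diff0) y + matop (mat contr0) (matop (mat diff0) z).
  rewrite /y !matop_mat //.
  by rewrite -matopD; apply: matop_ext => o o'; rewrite /mat coef_cat.
rewrite E2 -!matop_d0 dz linear0 addr0 in E.
by rewrite linearZ /= -E scalerA mulVf // scale1r.
Qed.

(** The factor 1/4 undoes the scaling of [projection]: the chains of [harmonic_basis] represent
    twice the classes, and 4 * 2 = 8. *)
Definition proj_mat (o : state) (u : bool * bool) : rat :=
  4^-1 * coef (projection o) [:: u.1; u.2].

Local Notation R := (matop proj_mat).

Lemma proj_vec l u : R (vec l) u = 4^-1 * coef (bind l projection) [:: u.1; u.2].
Proof.
rewrite ffunE coef_bind -(@sum_coef l (fun k => coef (projection k) [:: u.1; u.2])); last first.
  by move=> k hk; rewrite projection_proper ?coef_nil.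
by rewrite mulr_sumr; apply: eq_bigr => o _; rewrite ffunE mulrCA.
Qed.

Lemma proj_matop f x u :
  R (matop (mat f) x) u = 4^-1 * \sum_o x o * coef (bind (f o) projection) [:: u.1; u.2].
Proof.
rewrite ffunE (eq_bigr (fun o : state => \sum_a x a * (4^-1 * (coef (f a) o * coef (projection
  o) [:: u.1; u.2])))).
  rewrite exchange_big mulr_sumr; apply: eq_bigr => a _; rewrite -!mulr_sumr mulrCA.
  rewrite coef_bind -(@sum_coef _ (fun k => coef (projection k) [:: u.1; u.2])) // => k hk.
  by rewrite projection_proper ?coef_nil.
move=> o _; rewrite ffunE mulr_suml; apply: eq_bigr => a _.
by rewrite /mat /proj_mat -!mulrA [coef (f a) o * (4^-1 * _)]mulrCA.
Qed.

Lemma R_d1 x : R (matop d1 x) = 0.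
Proof.
apply/ffunP=> u; rewrite matop_d1 proj_matop ffunE big1 ?mulr0 // => o _.
have [/diff1_projection h|no] := boolP (valid true o); first by rewrite (is_zeroP _ h) mulr0.
by rewrite diff1_supported // coef_nil mulr0.
Qed.

Lemma R_hom i j x : homogeneous g1 i j x -> homogeneous two_circles_grading i j (R x).
Proof.
move=> hx u; rewrite ffunE => /eqP s0; apply/negPn/negP => ng; apply: s0.
rewrite big1 // => o _; have [->|xo] := eqVneq (x o) 0; first by rewrite mul0r.
rewrite /proj_mat; have [->|] := eqVneq (coef (projection o) [:: u.1; u.2]) 0;
  first by rewrite !mulr0.
move=> /coef_neq0[p pp pu]; case/negP: ng; have := hx o xo; rewrite degree_grading.
move=> /and3P[vo /eqP -> /eqP ->]; have := projection_shifts vo pp.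
rewrite pu /two_circles_grading /= addn0 => -[+ +].
move: (degree true o) => [[w p'] n] /= -> {p pp pu x hx xo vo}; case: u => -[] [] /= e;
  by apply/eqP; lia.
Qed.

Definition basis_chain (u : bool * bool) : chain state := vec (harmonic_basis [:: u.1; u.2]).

(** The contraction identity evaluated at a cycle: the term through [d1 z] drops out, leaving a
    boundary and the harmonic part. *)
Lemma d1_decomp i j z : homogeneous g1 i j z -> matop d1 z = 0 ->
  exists2 y, homogeneous g1 (i - 1) j y &
    8 *: z = matop d1 y + \sum_u (4 * R z u) *: basis_chain u.
Proof.
move=> hz dz; exists (matop (mat contr1) z).
  exact: unshifts_hom hz.
have E : 8 *: z = matop (mat (fun k => bind (contr1 k) diff1 ++ bind (diff1 k) contr1
    ++ bind (projection k) harmonic_basis)) z.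
  apply: matop_scalar hz => o; rewrite degree_grading => /and3P[vo _ _].
  exact: contraction1.
have E2 : matop (mat (fun k => bind (contr1 k) diff1 ++ bind (diff1 k) contr1
      ++ bind (projection k) harmonic_basis)) z =
    matop (mat diff1) (matop (mat contr1) z) + matop (mat contr1) (matop (mat diff1) z)
    + matop (mat (fun k => bind (projection k) harmonic_basis)) z.
  rewrite !matop_mat //.
  by rewrite -!matopD; apply: matop_ext => o o'; rewrite /mat !coef_cat addrA.
rewrite E E2 -!matop_d1 dz linear0 addr0; congr (_ + _).
apply/ffunP=> o'; rewrite ffunE sum_ffunE.
rewrite (eq_bigr (fun o => \sum_u z o * (coef (projection o) [:: u.1; u.2]
  * coef (harmonic_basis [:: u.1; u.2]) o'))); last first.
  move=> o _; rewrite /mat coef_bind (@sum_coef2 _ (fun k => coef (harmonic_basis k) o'))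
    ?mulr_sumr //.
  by move=> k /basis_supported ->; rewrite coef_nil.
rewrite exchange_big; apply: eq_bigr => u _; rewrite !ffunE -[_ *: _]/(_ * _).
rewrite mulr_sumr mulr_suml; apply: eq_bigr => o _.
by rewrite /proj_mat !mulrA [4 * _]mulrC -[z o * 4 * _]mulrA mulfV // mulr1.
Qed.

Lemma R_exact i j z : homogeneous g1 i j z -> matop d1 z = 0 -> R z = 0 ->
  exists2 y, homogeneous g1 (i - 1) j y & z = matop d1 y.
Proof.
move=> hz dz Rz; have [y hy] := d1_decomp hz dz.
rewrite big1 ?addr0 => [E|u _]; last by rewrite Rz ffunE mulr0 scale0r.
exists (8^-1 *: y); first exact: homogeneousZ.
by rewrite linearZ /= -E scalerA mulVf // scale1r.
Qed.

Lemma R_basis_xa u : R (matop xa (basis_chain u)) = 2 *: matop mulX (dlt u).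
Proof.
apply/ffunP=> v; rewrite matop_xa matop_vec //.
rewrite proj_vec; have h := basis_bot u; rewrite (diff_zeroP _ h) !ffunE.
rewrite (bigD1 u) //= big1 ?addr0 => [|w /negPf nw]; rewrite !ffunE;
  last by rewrite eq_sym nw mul0r.
rewrite eqxx mul1r /mulX; case: u {h} => -[] l /=; first by rewrite coef_nil mulr0 scaler0.
rewrite coef_single !eqseq_cons /= andbT zrat8 -[2 *: _]/(2 * _); case: v => -[] l' /=.
  by rewrite xpair_eqE /= [l' == l]eq_sym; case: eqP; rewrite ?mulr0 // mulr1.
by rewrite ?xpair_eqE !mulr0.
Qed.

Lemma R_basis_xb u : R (matop xb (basis_chain u)) = 2 *: matop mulY (dlt u).
Proof.
apply/ffunP=> v; rewrite matop_xb matop_vec //.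
rewrite proj_vec; have h := basis_top u; rewrite (diff_zeroP _ h) !ffunE.
rewrite (bigD1 u) //= big1 ?addr0 => [|w /negPf nw]; rewrite !ffunE;
  last by rewrite eq_sym nw mul0r.
rewrite eqxx mul1r /mulY; case: u {h} => k [] /=; first by rewrite coef_nil mulr0 scaler0.
rewrite coef_single !eqseq_cons /= andbT zrat8 -[2 *: _]/(2 * _); case: v => k' [] /=.
  by rewrite xpair_eqE /= andbT [k' == k]eq_sym; case: eqP; rewrite ?mulr0 // mulr1.
by rewrite ?xpair_eqE ?andbF !mulr0.
Qed.

(** Modulo boundaries a cycle is a combination of basis cycles. X commutes with [d1] and [R] kills
    boundaries, so the four identities checked on the basis suffice. *)
Lemma R_xa i j z : homogeneous g1 i j z -> matop d1 z = 0 ->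
  R (matop xa z) = matop mulX (R z).
Proof.
move=> hz dz; have [y _ E] := d1_decomp hz dz.
have n8 : (8 : rat) != 0 by [].
apply: (scalerI n8); have -> : 8 *: R (matop xa z) = R (matop xa (8 *: z)) by rewrite !linearZ.
rewrite E linearD linearD /= xa_d1 R_d1 add0r [R z in RHS]chain_dlt !linear_sum.
apply: eq_bigr => u _ /=.
by rewrite !linearZ /= R_basis_xa !scalerA; congr (_ *: _); ring.
Qed.

Lemma R_xb i j z : homogeneous g1 i j z -> matop d1 z = 0 ->
  R (matop xb z) = matop mulY (R z).
Proof.
move=> hz dz; have [y _ E] := d1_decomp hz dz.
have n8 : (8 : rat) != 0 by [].
apply: (scalerI n8); have -> : 8 *: R (matop xb z) = R (matop xb (8 *: z)) by rewrite !linearZ.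
rewrite E linearD linearD /= xb_d1 R_d1 add0r [R z in RHS]chain_dlt !linear_sum.
apply: eq_bigr => u _ /=.
by rewrite !linearZ /= R_basis_xb !scalerA; congr (_ *: _); ring.
Qed.

Let hom_twist_states m i j :
  hom (@grC state g0 g1 m) (@dC state d0 d1 saddle xa xb m) i j
    + ((i == 4) && ((j == 5) || (j == 3)))%:Z =
  hom g0 d0 i j + ((i == 4 + m%:Z) && ((j == 5 + 2 * m%:Z) || (j == 3 + 2 * m%:Z)))%:Z.
Proof.
(* [generator] represents twice the unit, and the two cycles were derived from it; hence the common
   factor 1/2. *)
pose v := 2^-1 *: vec generator; pose y1 := 2^-1 *: vec cycle1; pose y2 := 2^-1 *: vec cycle2.
apply: (@hom_twist state g0 g1 d0 d1 saddle xa xb d1_d1 saddle_d xa_d1 xb_d1 xa_xa xb_xb xa_xb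
  xa_saddle d1_hom saddle_hom xa_hom xb_hom R R_d1 R_hom R_exact R_xa R_xb v _ _ _ y1 y2).
- exact: located_hom.
- by rewrite /v linearZ /= matop_d1 matop_vec // vec_eq0 ?scaler0.
- apply/ffunP=> u; rewrite /v linearZ /= ffunE proj_vec (diff_zeroP _ generator_projection).
  by rewrite coef_single ffunE zrat8; case: u => -[] []; rewrite /= ?mulr0 ?scaler0.
- exact: located_hom.
- exact: located_hom.
- by rewrite /y1 linearZ /= matop_d0 matop_vec // vec_eq0 ?scaler0.
- by rewrite /y2 linearZ /= matop_d0 matop_vec // vec_eq0 ?scaler0.
- rewrite /y1 /v !linearZ /= -scalerDr; congr (_ *: _).
  rewrite matop_saddle matop_xa matop_xb !matop_vec //.
  by rewrite (vec_eq cycle1_saddle); apply/ffunP=> o; rewrite !ffunE coef_cat.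
rewrite /y2 /v !linearZ /=; congr (_ *: _).
rewrite matop_saddle matop_xa matop_xb !matop_vec //.
exact: vec_eq.
Qed.

Theorem certificate_closure : closure_spec.
Proof.
exact: ClosureSpec d0_d0 d1_d1 saddle_d xa_saddle xa_d1 xb_d1 xa_xa xb_xb xa_xb
  d0_hom d1_hom saddle_hom xa_hom xb_hom d0_exact hom_twist_states.
Qed.

End Certificate.

Local Close Scope ring_scope.

Lemma check_allP : [/\ all check0 (all_states false), all check1 (all_states true),
  all check_basis bool_pairs & check_cycles].
Proof. exact: (and4P check_allE). Qed.

Lemma check0P k : valid false k ->
  [/\ is_zero (bind (diff0 k) diff0),
      diff_zero (bind (diff0 k) saddle0) (bind (saddle0 k) diff1)
    & diff_zero (bind (saddle0 k) dot_bot) (bind (saddle0 k) dot_top)] /\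
  [/\ raises 1 0 false false diff0 k,
      raises 1 0 false true saddle0 k,
      lowers false contr0 k
    & test_degree false (fun x => (x.1.2 + 3 == x.2 + x.1.1) || (x.1.2 + 5 == x.2 + x.1.1)) k
      || diff_zero [:: (k, eight)] (bind (contr0 k) diff0 ++ bind (diff0 k) contr0)].
Proof.
move=> vk; case: check_allP => /allP h _ _ _.
case/andP: (h k (mem_all_states vk)) => a /andP[b] /andP[c] /andP[d] /andP[e] /andP[f g].
split; split; assumption.
Qed.

Lemma check1P k : valid true k ->
  [/\ is_zero (bind (diff1 k) diff1),
      diff_zero (bind (diff1 k) dot_bot) (bind (dot_bot k) diff1)
    & diff_zero (bind (diff1 k) dot_top) (bind (dot_top k) diff1)] /\
  [/\ is_zero (bind (dot_bot k) dot_bot),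
      is_zero (bind (dot_top k) dot_top)
    & diff_zero (bind (dot_top k) dot_bot) (bind (dot_bot k) dot_top)] /\
  [/\ raises 1 0 true true diff1 k,
      raises 0 2 true true dot_bot k,
      raises 0 2 true true dot_top k
    & lowers true contr1 k] /\
  [/\ is_zero (bind (diff1 k) projection),
      all (fun p => test_degree true (fun x => (x.1.1 == 5) &&
        (x.1.2 + 2 * count id p.1 == x.2 + 2)) k) (projection k)
    & diff_zero [:: (k, eight)] (bind (contr1 k) diff1 ++ bind (diff1 k) contr1
        ++ bind (projection k) harmonic_basis)].
Proof.
move=> vk; case: check_allP => _ /allP h _ _.
case/andP: (h k (mem_all_states vk)) => a /andP[b] /andP[c] /andP[d] /andP[e] /andP[f].
case/andP=> g /andP[a'] /andP[b'] /andP[c'] /andP[d'] /andP[e' f'].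
split; [|split; [|split]]; split; assumption.
Qed.

Lemma check_basisP u : check_basis u.
Proof. case: check_allP => _ _ /allP h _; apply: h; case: u => -[] []; exact: erefl. Qed.

Lemma check_cyclesP :
  [/\ has_degree true 5 7 generator, is_zero (bind generator diff1),
      diff_zero (bind generator projection) [:: ([:: false; false], eight)],
      has_degree false 4 5 cycle1 & has_degree false 4 3 cycle2] /\
  [/\ is_zero (bind cycle1 diff0), is_zero (bind cycle2 diff0),
      diff_zero (bind cycle1 saddle0) (bind generator dot_bot ++ bind generator dot_top)
    & diff_zero (bind cycle2 saddle0) (bind (bind generator dot_top) dot_bot)].
Proof.
case: check_allP => _ _ _ /andP[a] /andP[b] /andP[c] /andP[d] /andP[e] /andP[f] /andP[g]
  /andP[a' b'].
split; split; assumption.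
Qed.

Lemma test_degreeP t P k : test_degree t P k -> valid t k /\ P (degree t k).
Proof.
rewrite /test_degree; have -> : (if t then degrees1 else degrees0) = degrees t.
  by case: t; exact (erefl _).
by rewrite /degrees memo_trieE; case: ifP => // /all_states_valid.
Qed.

Lemma raises_shifts dw dq t t' f :
  (forall k, valid t k -> raises dw dq t t' f k) -> shifts dw dq t t' f.
Proof.
move=> rf k p vk pf; have /test_degreeP[_ /allP/(_ p pf)] := rf k vk.
by case/test_degreeP=> vp /andP[/eqP ew /eqP eq].
Qed.

Lemma lowers_unshifts t f : (forall k, valid t k -> lowers t f k) -> unshifts t f.
Proof.
move=> rf k p vk pf; have /test_degreeP[_ /allP/(_ p pf)] := rf k vk.
by case/test_degreeP=> vp /andP[/eqP ew /eqP eq].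
Qed.

Lemma has_degree_located t w q l : has_degree t w q l -> located t w q l.
Proof.
move=> /allP hl p pl; case/test_degreeP: (hl p pl) => vp /andP[/eqP ew /eqP eq].
by split.
Qed.

Lemma table_supported f t : supported t (table f (all_states t)).
Proof.
by move=> k nk; apply: table_notin; apply: contra nk => /all_states_valid.
Qed.

Lemma bool_keys_default k (e1 e2 e3 e4 : svec) : k \notin bool_keys ->
  (if k == [:: false; false] then e1 else if k == [:: true; false] then e2
   else if k == [:: false; true] then e3 else if k == [:: true; true] then e4 else [::]) = [::].
Proof. by do 4!case: eqP => [->//|_]. Qed.

Lemma basis_supported k : k \notin bool_keys -> harmonic_basis k = [::].
Proof. move=> nk; exact (bool_keys_default _ _ _ _ nk). Qed.

Theorem closures : closure_spec.
Proof.
refine (@certificate_closure diff0 diff1 saddle0 dot_bot dot_top contr0 contr1 projection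
  harmonic_basis cycle1 cycle2
  _ _ _ _ _ _ _ _ _ _ _ _ _ basis_supported _ _ _ _ _ _ _ _ _ _ _ _ _ _ _ _ _ _ _ _ _ _ _ _ _ _
    _ _ _ _ _).
- exact (mat_diff false).
- exact (mat_diff true).
- exact mat_saddle.
- exact (fun o o' => @mat_dot 13 o o' isT).
- exact (fun o o' => @mat_dot 14 o o' isT).
- exact (@table_supported _ _).
- exact (@table_supported _ _).
- exact (@table_supported _ _).
- exact (@table_supported _ _).
- exact (@table_supported _ _).
- exact (@table_supported _ _).
- exact (@table_supported _ _).
- exact (@table_supported _ _).
- by move=> k vk; case: (check0P vk) => -[h _ _] _; exact h.
- by move=> k vk; case: (check0P vk) => -[_ h _] _; exact h.
- by move=> k vk; case: (check0P vk) => -[_ _ h] _; exact h.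
- by apply: raises_shifts => k vk; case: (check0P vk) => _ [h _ _ _]; exact h.
- by apply: raises_shifts => k vk; case: (check0P vk) => _ [_ h _ _]; exact h.
- by apply: lowers_unshifts => k vk; case: (check0P vk) => _ [_ _ h _]; exact h.
- move=> k vk; case: (check0P vk) => _ [_ _ _ h].
  by cbv zeta; case/orP: h => [/test_degreeP[_ h]|h]; apply/orP; [left|right]; exact h.
- by move=> k vk; case: (check1P vk) => -[h _ _] _; exact h.
- by move=> k vk; case: (check1P vk) => -[_ h _] _; exact h.
- by move=> k vk; case: (check1P vk) => -[_ _ h] _; exact h.
- by move=> k vk; case: (check1P vk) => _ [[h _ _] _]; exact h.
- by move=> k vk; case: (check1P vk) => _ [[_ h _] _]; exact h.
- by move=> k vk; case: (check1P vk) => _ [[_ _ h] _]; exact h.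
- by apply: raises_shifts => k vk; case: (check1P vk) => _ [_ [[h _ _ _] _]]; exact h.
- by apply: raises_shifts => k vk; case: (check1P vk) => _ [_ [[_ h _ _] _]]; exact h.
- by apply: raises_shifts => k vk; case: (check1P vk) => _ [_ [[_ _ h _] _]]; exact h.
- by apply: lowers_unshifts => k vk; case: (check1P vk) => _ [_ [[_ _ _ h] _]]; exact h.
- by move=> k vk; case: (check1P vk) => _ [_ [_ [h _ _]]]; exact h.
- move=> k p vk pk; case: (check1P vk) => _ [_ [_ [_ /allP/(_ p pk)/test_degreeP[_] /andP[/eqP
  ew /eqP eq] _]]].
  by split.
- by move=> k vk; case: (check1P vk) => _ [_ [_ [_ _ h]]]; exact h.
- by move=> u; case/andP: (check_basisP u) => h _; exact h.
- by move=> u; case/andP: (check_basisP u) => _ h; exact h.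
- by case: check_cyclesP => -[h _ _ _ _] _; apply: has_degree_located; exact h.
- by case: check_cyclesP => -[_ _ _ h _] _; apply: has_degree_located; exact h.
- by case: check_cyclesP => -[_ _ _ _ h] _; apply: has_degree_located; exact h.
- by case: check_cyclesP => -[_ h _ _ _] _; exact h.
- by case: check_cyclesP => _ [h _ _ _]; exact h.
- by case: check_cyclesP => _ [_ h _ _]; exact h.
- by case: check_cyclesP => -[_ _ h _ _] _; exact h.
- by case: check_cyclesP => _ [_ _ h _]; exact h.
- by case: check_cyclesP => _ [_ _ _ h]; exact h.
Qed.

(** * The Khovanov homology of K(-m, 0) *)

Local Open Scope ring_scope.

Local Notation word_grading m := (@grC state g0 g1 m).
Local Notation word_diff m := (@dC state d0 d1 saddle (dot 13) (dot 14) m).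

Section KhovanovHomology.
Variable m : nat.
Local Notation D := (kan m).

Lemma weight_word (S : labelled D) :
  weight S.1 = (count id (take 8 (state_of S)) + count id (twist_bits S.1))%N.
Proof. by rewrite weight_bits bits_split count_cat take_state. Qed.

(** Words carry unnormalized degrees. With 4 + m negative and 4 positive crossings the normalization
    subtracts 4 + m and 2(4 + m) - 4 = 4 + 2m. *)
Lemma word_grading_of (S : labelled D) i j : is_gen S ->
  word_grading m (word_of S) (i + (4 + m%:Z)) (j + (4 + 2 * m%:Z)) =
  (hdeg S == i) && (qdeg S == j).
Proof.
move=> gS; have ss := size_small S; have := valid_state gS.
rewrite grC_word ?size_tb // /hdeg /qdeg !circlesE // n_minus_kan n_plus_kan weight_word.
rewrite /cut /state_grading /state_weight.
have ct : count_mem true (small_labels S) = count id (small_labels S).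
  by apply: eq_count => -[].
have cf : (count_mem false (small_labels S) + count id (small_labels S) = size (small_labels S))%N.
  by rewrite -(count_predC id) addnC; congr (_ + _)%N; apply: eq_count => -[].
rewrite ct; move: cf; rewrite ss.
have := has_count id (twist_bits S.1).
move: (state_of S) (count id (small_labels S)) (count_mem false (small_labels S)) => o s u.
case: (has id (twist_bits S.1)); move: (count id (twist_bits S.1)) => t ht ust -> /=;
move: (outer_circles _ _ _) (outer_circles _ _ _) (count id _) => x y z {gS ss ct o};
apply/andP/andP=> -[/eqP e1 /eqP e2]; split; apply/eqP; lia.
Qed.

Lemma eps_neq0 (S : labelled D) : eps S != 0.
Proof. by rewrite /eps signr_eq0. Qed.

Lemma word_surj w i j : word_grading m w i j ->
  exists2 S : labelled D, is_gen S & word_of S = w.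
Proof.
have [tb [sm [o [stb ssm ->]]]] := make_word_surj w.
rewrite grC_word // => gw.
have vo : valid (has id tb) o by move: gw; case: (has id tb) => /and3P[].
have [S gS [Stb Ssm So]] := gen_surj stb ssm vo.
by exists S; rewrite // /word_of Stb Ssm So.
Qed.

Lemma kh_dim_kan i j : (kh_dim D i j)%:Z =
  hom (word_grading m) (word_diff m) (i + (4 + m%:Z)) (j + (4 + 2 * m%:Z)).
Proof.
have cl := closures; apply: (@kh_dim_hom D _ _ _ _ _ (@word_of m) (@eps m)).
- exact: eps_neq0.
- by move=> S i' j' gS; apply: word_grading_of.
- exact: word_of_inj.
- exact: word_surj.
- exact: incidence_word.
- exact: dC_hom (d0_hom cl) (d1_hom cl) (saddle_hom cl) (xa_hom cl) (xb_hom cl) m.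
exact: dC_dC (d1_d1 cl) (d0_d0 cl) (saddle_d cl) (xa_d1 cl) (xb_d1 cl) (xa_xa cl) (xb_xb cl)
  (xa_xb cl) (xa_saddle cl) m.
Qed.

End KhovanovHomology.

Lemma hom_exact (A : finType) (g : grading A) (d : A -> A -> rat) i j :
  (forall z, homogeneous g i j z -> matop d z = 0 ->
    exists2 y, homogeneous g (i - 1) j y & z = matop d y) -> hom g d i j <= 0.
Proof.
move=> ex; have sub : (cycles g d i j <= linfun (matop d) @: piece g (i - 1) j)%VS.
  apply/subvP=> z /mem_cycles[hz dz]; have [y hy ->] := ex z hz dz.
  by apply/memv_imgP; exists y; rewrite ?lfunE //; apply/mem_piece.
have := dimvS sub; have := dim_cycles g d i j; rewrite -/(rk g d (i - 1) j) /hom.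
move: (\dim _) (rk _ _ _ _) (rk _ _ _ _) #|_| => a b c n <- ac.
by rewrite PoszD; lia.
Qed.

Lemma kh_dim_kan0 i j : (kh_dim (kan 0) i j)%:Z = hom g0 d0 (i + 4) (j + 4).
Proof. by rewrite kh_dim_kan !mulr0 !addr0. Qed.

(* The homology of K(0,0) is shifted by (-m, -2m), except for one class in each of
   the degrees (0, 1) and (0, -1). *)
Lemma kh_dim_twist m i j :
  (kh_dim (kan m) i j)%:Z + ((i == - m%:Z) && ((j == 1 - 2 * m%:Z) || (j == -1 - 2 * m%:Z)))%:Z =
  (kh_dim (kan 0) (i + m%:Z) (j + 2 * m%:Z))%:Z + ((i == 0) && ((j == 1) || (j == -1)))%:Z.
Proof.
have := hom_twist_states closures m (i + (4 + m%:Z)) (j + (4 + 2 * m%:Z)).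
rewrite -kh_dim_kan kh_dim_kan0.
have -> : i + m%:Z + 4 = i + (4 + m%:Z) by ring.
have -> : j + 2 * m%:Z + 4 = j + (4 + 2 * m%:Z) by ring.
move=> h; rewrite -[RHS]/(_ + _); move: h.
have -> : (i + (4 + m%:Z) == 4) = (i == - m%:Z) by lia.
have -> : (j + (4 + 2 * m%:Z) == 5) = (j == 1 - 2 * m%:Z) by lia.
have -> : (j + (4 + 2 * m%:Z) == 3) = (j == -1 - 2 * m%:Z) by lia.
have -> : (i + (4 + m%:Z) == 4 + m%:Z) = (i == 0) by lia.
have -> : (j + (4 + 2 * m%:Z) == 5 + 2 * m%:Z) = (j == 1) by lia.
have -> : (j + (4 + 2 * m%:Z) == 3 + 2 * m%:Z) = (j == -1) by lia.
by [].
Qed.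

(** The shift by (m, 2m) preserves j - 2i and the corrections lie on the two diagonals, so the
    vanishing off them is inherited from K(0,0). *)
Lemma kh_dim_support m i j : kh_dim (kan m) i j <> 0%N ->
  j - 2 * i = 1 \/ j - 2 * i = -1.
Proof.
move=> nz; have [e|n1] := eqVneq (j - 2 * i) 1; first by left.
have [e|n2] := eqVneq (j - 2 * i) (-1); first by right.
have h0 : hom g0 d0 (i + m%:Z + 4) (j + 2 * m%:Z + 4) <= 0.
  by apply: hom_exact => z; apply: (d0_exact closures); lia.
by exfalso; have := kh_dim_twist m i j; rewrite kh_dim_kan0; lia.
Qed.

Lemma kanenobu_neg n : kanenobu (Negz n) 0 = kan n.+1.
Proof. by []. Qed.

Lemma kanenobu00 : kanenobu 0 0 = kan 0.
Proof. by rewrite /kanenobu ltxx. Qed.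

(** As p < 0, the corrections at (0, 1), (0, -1) and at (p, 2p + 1), (p, 2p - 1) never meet. For p =
    -1 the places (-1, -1) and (-1, -3) are the latter two, which is why that value is excluded in
    the clauses for them. *)
Lemma knight_move_cases (h0 : int -> int -> int) (k p i j : int) : p < 0 ->
  k + ((i == p) && ((j == 1 + 2 * p) || (j == -1 + 2 * p)))%:Z =
    h0 (i - p) (j - 2 * p) + ((i == 0) && ((j == 1) || (j == -1)))%:Z ->
  k =
      if (i, j) == (0, 1) then h0 (- p) (- 2 * p + 1) + 1
      else if (i, j) == (0, -1) then h0 (- p) (- 2 * p - 1) + 1
      else if ((i, j) == (-1, -3)) && (p != -1)
        then h0 (- p - 1) (- 2 * p - 3)
      else if ((i, j) == (-1, -1)) && (p != -1)
        then h0 (- p - 1) (- 2 * p - 1)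
      else if (i, j) == (p, 2 * p + 1) then h0 0 1 - 1
      else if (i, j) == (p, 2 * p - 1) then h0 0 (-1) - 1
      else h0 (i - p) (j - 2 * p).
Proof.
move=> p_lt0; rewrite !xpair_eqE.
case: ifP => [/andP[/eqP -> /eqP ->]|n1].
  have -> : 0 - p = - p by lia.
  have -> : 1 - 2 * p = - 2 * p + 1 by lia.
  by clear -p_lt0; lia.
case: ifP => [/andP[/eqP -> /eqP ->]|n2].
  have -> : 0 - p = - p by lia.
  have -> : -1 - 2 * p = - 2 * p - 1 by lia.
  by clear -p_lt0; lia.
case: ifP => [/andP[/andP[/eqP -> /eqP ->] np]|n3].
  have -> : -1 - p = - p - 1 by lia.
  have -> : -3 - 2 * p = - 2 * p - 3 by lia.
  by clear -p_lt0 np; lia.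
case: ifP => [/andP[/andP[/eqP -> /eqP ->] np]|n4].
  have -> : -1 - p = - p - 1 by lia.
  have -> : -1 - 2 * p = - 2 * p - 1 by lia.
  by clear -p_lt0 np; lia.
case: ifP => [/andP[/eqP -> /eqP ->]|n5].
  have -> : p - p = 0 by lia.
  have -> : 2 * p + 1 - 2 * p = 1 by lia.
  by clear -p_lt0; lia.
case: ifP => [/andP[/eqP -> /eqP ->]|n6].
  have -> : p - p = 0 by lia.
  have -> : 2 * p - 1 - 2 * p = -1 by lia.
  by clear -p_lt0; lia.
have -> : (i == p) && ((j == 1 + 2 * p) || (j == -1 + 2 * p)) = false.
  by clear -n5 n6; lia.
have -> : (i == 0) && ((j == 1) || (j == -1)) = false by clear -n1 n2; lia.
by rewrite !addr0.
Qed.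

Theorem theorem4p7 (p : int) (p_lt0 : p < 0) :
  let h0 (i j : int) : int := (kh_dim (kanenobu 0 0) i j)%:Z in
  homologically_thin (kanenobu p 0) /\
  forall i j : int,
    (kh_dim (kanenobu p 0) i j)%:Z =
      if (i, j) == (0, 1) then h0 (- p) (- 2 * p + 1) + 1
      else if (i, j) == (0, -1) then h0 (- p) (- 2 * p - 1) + 1
      else if ((i, j) == (-1, -3)) && (p != -1)
        then h0 (- p - 1) (- 2 * p - 3)
      else if ((i, j) == (-1, -1)) && (p != -1)
        then h0 (- p - 1) (- 2 * p - 1)
      else if (i, j) == (p, 2 * p + 1) then h0 0 1 - 1
      else if (i, j) == (p, 2 * p - 1) then h0 0 (-1) - 1
      else h0 (i - p) (j - 2 * p).
Proof.
case: p p_lt0 => // n _; rewrite kanenobu_neg kanenobu00 => h0; split.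
  exists 0; first exact: kan_signature.
  by move=> i j /kh_dim_support[e|e]; [left|right]; lia.
move=> i j; apply: (@knight_move_cases h0) => //; rewrite /h0 NegzE !mulrN !opprK.
exact: kh_dim_twist.
Qed.
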